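(* Let $F=\alpha+\beta$ be a Randers metric on an $n$-dimensional manifold $M$, where $\alpha=\sqrt{a_{ij}(x)y^iy^j}$ is a Riemannian metric and $\beta=b_i(x)y^i$ is a nowhere vanishing 1-form with $\|\beta_x\|_\alpha<1$ for all $x\in M$. Suppose that $\beta$ is a Killing 1-form with respect to $\alpha$. If $F$ is of scalar flag curvature $\mathbf{K}=\mathbf{K}(x,y)$, then there is a scalar function $c=c(x)$ on $M$ such that $\alpha$ and $\beta$ satisfy both of the following equations for all $x\in M$ and $y\in T_xM$: $$s^m_{\ 0;m}=-(n-1)\,b^{-2}c(x)\,\beta,$$ $$t_{00}+s_{0;0}=c(x)\left(\alpha^2-b^{-2}\beta^2\right),$$ where $b:=\|\beta_x\|_\alpha$ denotes the norm of $\beta$ with respect to $\alpha$.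
   Context: Local coordinates $(x^i)$ on $M$ induce coordinates $(x^i,y^i)$ on $TM$. Indices are raised and lowered with $(a_{ij})$ and its inverse $(a^{ij})$; $b^i:=a^{ij}b_j$, $b^2=\|\beta_x\|_\alpha^2=a^{ij}b_ib_j$. The symbol '';'' denotes the covariant derivative with respect to the Levi-Civita connection of $\alpha$. The 1-form $\beta$ is Killing with respect to $\alpha$ if $b_{i;j}+b_{j;i}=0$. Notation: $s_{ij}:=\frac12(b_{i;j}-b_{j;i})$, $s^i_{\ j}:=a^{ik}s_{kj}$, $s_j:=b^is_{ij}$, $t_{ij}:=s_{im}s^m_{\ j}$. An index $0$ means contraction with $y$: $s^m_{\ 0;m}:=s^m_{\ j;m}y^j$, $t_{00}:=t_{ij}y^iy^j$, $s_{0;0}:=s_{i;j}y^iy^j$. Scalar flag curvature: let $g_{ij}=\frac12[F^2]_{y^iy^j}$, let $G^i=\frac14 g^{il}\{[F^2]_{x^ky^l}y^k-[F^2]_{x^l}\}$ be the geodesic coefficients of $F$, and let $$R^i_{\ k}=2\frac{\partial G^i}{\partial x^k}-\frac{\partial^2G^i}{\partial x^m\partial y^k}y^m+2G^m\frac{\partial^2G^i}{\partial y^m\partial y^k}-\frac{\partial G^i}{\partial y^m}\frac{\partial G^m}{\partial y^k}$$ be the Riemann curvature. The flag curvature of a plane $P=\mathrm{span}\{y,u\}$ with flagpole $y$ is $\mathbf{K}(x,y,P)=\dfrac{g_y(\mathbf{R}_y(u),u)}{g_y(y,y)g_y(u,u)-[g_y(u,y)]^2}$. $F$ is of scalar flag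 curvature $\mathbf{K}(x,y)$ if $\mathbf{K}$ is independent of $P$ containing $y$, i.e. it is a scalar function on $TM\setminus\{0\}$; equivalently $R^i_{\ k}=\mathbf{K}(x,y)\left(F^2\delta^i_{\ k}-FF_{y^k}y^i\right)$. *)

(* Defs.v *)
From mathcomp Require Import all_boot all_order all_algebra.
From mathcomp Require Import all_classical all_reals all_analysis.
Set Implicit Arguments.
Unset Strict Implicit.
Unset Printing Implicit Defensive.
Import Order.TTheory GRing.Theory Num.Theory numFieldNormedType.Exports.
Local Open Scope classical_set_scope.
Local Open Scope ring_scope.

Section Calculus.
Context {R : realType} {n : nat}.

Definition partial (k : 'I_n) (f : 'rV[R]_n -> R) : 'rV[R]_n -> R :=
  fun p => 'D_(delta_mx 0 k) f p.

Definition iter_partial (s : seq 'I_n) (f : 'rV[R]_n -> R) : 'rV[R]_n -> R :=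
  foldr partial f s.

(* C^infinity on an open set: f and all its iterated partial derivatives are
   (Frechet) differentiable there. *)
Definition smooth_on (U : set 'rV[R]_n) (f : 'rV[R]_n -> R) : Prop :=
  forall (s : seq 'I_n) (p : 'rV[R]_n),
    U p -> differentiable (iter_partial s f) p.

End Calculus.

(* The atlas need not be maximal.  [chart_inv i] is only meaningful on the
   image of [chart_dom i]. *)
Record manifold (R : realType) (n : nat) := Manifold {
  manifold_points :> topologicalType;
  chart : Type;
  chart_dom : chart -> set manifold_points;
  chart_map : chart -> manifold_points -> 'rV[R]_n;
  chart_inv : chart -> 'rV[R]_n -> manifold_points;
  manifold_hausdorff : hausdorff_space manifold_points;
  manifold_second_countable : @second_countable manifold_points;
  dom_cover : forall x, exists i, chart_dom i x;
  dom_open : forall i, open (chart_dom i);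
  image_open : forall i, open (chart_map i @` chart_dom i);
  chart_mapK : forall i x, chart_dom i x -> chart_inv i (chart_map i x) = x;
  chart_map_continuous : forall i x,
    chart_dom i x -> {for x, continuous (chart_map i)};
  chart_inv_continuous : forall i p,
    (chart_map i @` chart_dom i) p -> {for p, continuous (chart_inv i)};
  transition_smooth : forall i j (k : 'I_n),
    smooth_on (chart_map i @` (chart_dom i `&` chart_dom j))
              (fun p => chart_map j (chart_inv i p) 0 k)
}.

Arguments chart {R n} m.
Arguments chart_dom {R n m} i.
Arguments chart_map {R n m} i.
Arguments chart_inv {R n m} i.

Section TensorFields.
Context {R : realType} {n : nat} (M : manifold R n).

Definition transition (i j : chart M) : 'rV[R]_n -> 'rV[R]_n :=
  fun p => chart_map j (chart_inv i p).

(* Row convention: entry (k, l) is the derivative of the l-th j-coordinate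
   with respect to the k-th i-coordinate. *)
Definition transition_jacobian (i j : chart M) (x : M) : 'M[R]_n :=
  'J (transition i j) (chart_map i x).

(* An element of T_x M, given by its components in all the charts around x;
   the components in the other charts are set to 0, so that a tangent vector
   has a unique representation. *)
Record tangent (x : M) := Tangent {
  components :> chart M -> 'rV[R]_n;
  components_law : forall i j, chart_dom i x -> chart_dom j x ->
    components j = components i *m transition_jacobian i j x;
  components_out : forall i, ~ chart_dom i x -> components i = 0
}.

(* Covariant tensor fields are given by their component functions in each
   chart, as functions of the coordinates. *)
Record riemannian_metric := RiemannianMetric {
  metric_comp :> chart M -> 'rV[R]_n -> 'M[R]_n;
  metric_smooth : forall i k l,
    smooth_on (chart_map i @` chart_dom i) (fun p => metric_comp i p k l);
  metric_sym : forall i x, chart_dom i x ->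
    (metric_comp i (chart_map i x))^T = metric_comp i (chart_map i x);
  metric_pos : forall i x (y : 'rV[R]_n), chart_dom i x -> y != 0 ->
    0 < (y *m metric_comp i (chart_map i x) *m y^T) 0 0;
  metric_law : forall i j x, chart_dom i x -> chart_dom j x ->
    metric_comp i (chart_map i x) =
    transition_jacobian i j x *m metric_comp j (chart_map j x)
      *m (transition_jacobian i j x)^T
}.

Record one_form := OneForm {
  form_comp :> chart M -> 'rV[R]_n -> 'rV[R]_n;
  form_smooth : forall i k,
    smooth_on (chart_map i @` chart_dom i) (fun p => form_comp i p 0 k);
  form_law : forall i j x, chart_dom i x -> chart_dom j x ->
    form_comp i (chart_map i x) =
    form_comp j (chart_map j x) *m (transition_jacobian i j x)^T
}.

End TensorFields.

Section RiemannianCoordinates.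
Context {R : realType} {n : nat}.
Variables (a : 'rV[R]_n -> 'M[R]_n) (b : 'rV[R]_n -> 'rV[R]_n).
Implicit Types (p y : 'rV[R]_n) (i j k l m : 'I_n).

Definition ainv p : 'M[R]_n := invmx (a p).

Definition alpha_of p y : R :=
  Num.sqrt (\sum_i \sum_j a p i j * y 0 i * y 0 j).

Definition beta_of p y : R := \sum_i b p 0 i * y 0 i.

Definition b_up i p : R := \sum_j ainv p i j * b p 0 j.

Definition b_norm p : R :=
  Num.sqrt (\sum_i \sum_j ainv p i j * b p 0 i * b p 0 j).

(* christoffel k i j is Gamma^k_ij. *)
Definition christoffel k i j p : R :=
  2^-1 * \sum_l ainv p k l *
    (partial i (fun q => a q j l) p + partial j (fun q => a q i l) p
     - partial l (fun q => a q i j) p).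

(* cov1 w i j is w_{i;j}. *)
Definition cov1 (w : 'I_n -> 'rV[R]_n -> R) i j p : R :=
  partial j (w i) p - \sum_k christoffel k i j p * w k p.

(* cov11 T i j k is T^i_{j;k}. *)
Definition cov11 (T : 'I_n -> 'I_n -> 'rV[R]_n -> R) i j k p : R :=
  partial k (T i j) p + \sum_l christoffel i k l p * T l j p
  - \sum_l christoffel l k j p * T i l p.

Definition cov_b i j p : R := cov1 (fun k q => b q 0 k) i j p.

Definition s_low i j p : R := 2^-1 * (cov_b i j p - cov_b j i p).

Definition s_mix i j p : R := \sum_k ainv p i k * s_low k j p.

Definition s_one j p : R := \sum_i b_up i p * s_low i j p.

Definition t_low i j p : R := \sum_m s_low i m p * s_mix m j p.

(* s^m_{0;m} *)
Definition div_s0 p y : R := \sum_j (\sum_m cov11 s_mix m j m p) * y 0 j.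

Definition t00 p y : R := \sum_i \sum_j t_low i j p * y 0 i * y 0 j.

(* s_{0;0} *)
Definition s0_0 p y : R := \sum_i \sum_j cov1 s_one i j p * y 0 i * y 0 j.

Definition randers p y : R := alpha_of p y + beta_of p y.

End RiemannianCoordinates.

Section FinslerCoordinates.
Context {R : realType} {n : nat}.
Implicit Types (f F : 'rV[R]_n -> 'rV[R]_n -> R) (p y u v : 'rV[R]_n).
Implicit Types (i j k l m : 'I_n).

Definition dx k f p y : R := partial k (fun q => f q y) p.
Definition dy k f p y : R := partial k (f p) y.

Variable F : 'rV[R]_n -> 'rV[R]_n -> R.

Definition Fsq p y : R := F p y ^+ 2.

Definition g_fund p y : 'M[R]_n := \matrix_(i, j) (2^-1 * dy j (dy i Fsq) p y).

Definition G_spray i p y : R :=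
  4^-1 * \sum_l invmx (g_fund p y) i l *
    ((\sum_k dy l (dx k Fsq) p y * y 0 k) - dx l Fsq p y).

(* riem i k is R^i_k. *)
Definition riem i k p y : R :=
  2 * dx k (G_spray i) p y
  - \sum_m dy k (dx m (G_spray i)) p y * y 0 m
  + 2 * \sum_m G_spray m p y * dy k (dy m (G_spray i)) p y
  - \sum_m dy m (G_spray i) p y * dy k (G_spray m) p y.

Definition riem_map p y u : 'rV[R]_n := \row_i \sum_k riem i k p y * u 0 k.

Definition g_prod p y u v : R := \sum_i \sum_j g_fund p y i j * u 0 i * v 0 j.

(* Flag curvature at p of the plane spanned by y and u, with flagpole y. *)
Definition flag_curvature p y u : R :=
  g_prod p y (riem_map p y u) u /
  (g_prod p y y y * g_prod p y u u - g_prod p y u y ^+ 2).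

End FinslerCoordinates.

Section Global.
Context {R : realType} {n : nat} {M : manifold R n}.

Definition nowhere_vanishing (beta : one_form M) : Prop :=
  forall i x, chart_dom i x -> beta i (chart_map i x) != 0.

Definition norm_lt1 (alpha : riemannian_metric M) (beta : one_form M) : Prop :=
  forall i x, chart_dom i x -> b_norm (alpha i) (beta i) (chart_map i x) < 1.

Definition killing (alpha : riemannian_metric M) (beta : one_form M) : Prop :=
  forall i x (k l : 'I_n), chart_dom i x ->
    cov_b (alpha i) (beta i) k l (chart_map i x)
    + cov_b (alpha i) (beta i) l k (chart_map i x) = 0.

(* F is given by its expression in each chart; only the values of K at
   nonzero vectors matter. *)
Definition scalar_flag_curvature
    (F : chart M -> 'rV[R]_n -> 'rV[R]_n -> R)
    (K : forall x : M, tangent x -> R) : Prop :=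
  forall (i : chart M) (x : M) (y u : tangent x),
    chart_dom i x -> free [:: y i; u i] ->
    flag_curvature (F i) (chart_map i x) (y i) (u i) = K x y.

End Global.

(* Main.v *)
From HB Require Import structures.
Require Import Defs.
From mathcomp Require Import all_boot all_order all_algebra.
From mathcomp Require Import all_classical all_reals all_analysis.
From mathcomp Require Import ring lra.
Set Implicit Arguments.
Unset Strict Implicit.
Unset Printing Implicit Defensive.
Import Order.TTheory GRing.Theory Num.Theory numFieldNormedType.Exports.
Local Open Scope ring_scope.

(** The geodesic coefficients of F are G^i = Gbar^i + alpha s^i_0 + P y^i with
    P = - alpha s_0 / F.  The projective term P y^i changes the curvature only by
    multiples of the identity and of y^i, so for u orthogonal to y (for alpha) the
    hypothesis says that a(u, R_y u) is a multiple of |u|^2, where R is the curvature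
    of the spray Gbar^i + alpha s^i_0.  The difference of its values at y and -y is
    4 alpha s_{ij;k} u^i y^j u^k, hence the latter equals mu(y) |u|^2.  Since d beta
    is closed, this forces s_{ij;k} = a_{ik} omega_j - a_{jk} omega_i for a 1-form
    omega.  Now b^k s_{ij;k} = 0, because d beta is invariant under the Killing field
    b^i; so omega is proportional to beta, say omega = - b^{-2} c beta.  The trace of
    s_{ij;k} gives the first equation; its contraction with b^i gives the second, by
    t_{ij} + s_{i;j} = b^m s_{mi;j}.  Taking y = b^i in the formula for mu expresses c
    through K at b^i and -b^i, the norm of beta and the norm of s_i, so that c does
    not depend on the chart. *)
(** * Symmetry of second derivatives *)

(** Reversing y turns F into alpha - beta, so the curvatures at y and -y belong to sprays that
    differ only in the sign e of beta; hence the parameter [e] with e^2 = 1. In the difference, the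
    curvature of alpha and the terms quadratic in alpha s^i_0 cancel. The function mu collects K(y),
    K(-y) and the projective terms, and nothing is known beforehand about its dependence on y. Its
    linearity is extracted: for fixed y the condition on u is a quadratic identity, whose trace over
    u gives mu(y) = omega(y), where omega is the trace of s_{ij;k} divided by n - 1. The remainder
    of s_{ij;k} is then skew in all indices, and the cyclic identity kills it. Since alpha is not
    smooth at y = 0, functions are differentiated only at pairs with y nonzero. Chart independence
    of c is the second obstacle: a direct proof would need the transformation law of covariant
    derivatives. The formula for c avoids it, because s_i is half the differential of b^2 and so
    transforms by the chain rule. Dimension one, where there is no flag and n - 1 vanishes, is
    handled apart with c = 0. *)

Section Schwarz.
Local Open Scope classical_set_scope.
Context {R : realType} {V : normedModType R}.
Implicit Types (f : V -> R) (p u v : V).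

Lemma is_derive_line f p u t : differentiable f (p + t *: u) ->
  is_derive t 1 (fun s => f (p + s *: u)) ('D_u f (p + t *: u)).
Proof.
move=> df; have dv : derivable f (p + t *: u) u by exact: diff_derivable.
have E : (fun h : R => h^-1 *: (((fun s => f (p + s *: u)) \o shift t) (h *: 1) - f (p + t *: u)))
   = (fun h : R => h^-1 *: ((f \o shift (p + t *: u)) (h *: u) - f (p + t *: u))).
  apply/funext => h; rewrite /= [_%:A]mulr1 scalerDl.
  by rewrite addrCA.
by apply: DeriveDef; rewrite /derivable /derive E.
Qed.

(** The mean value theorem in the direction [u], applied to the increment of [f] along [h *: v],
    turns the second difference into [h] times an increment of ['D_u f]. The Frechet expansion of
    ['D_u f] at the single point [p] then estimates it. *)
Lemma second_difference f p u v (e : R) : 0 < e ->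
  (\forall q \near p, differentiable f q) -> differentiable ('D_u f) p ->
  \forall h \near 0^'+,
    `|f (p + h *: u + h *: v) - f (p + h *: u) - f (p + h *: v) + f p
      - h ^+ 2 * 'D_v ('D_u f) p| <= e * h ^+ 2.
Proof.
move=> e0 /nbhs_normP [d1 /= d1_gt0 df] dg.
set g := 'D_u f.
(* The two displacements to be controlled have total length at most h (2 |u| + |v|), hence at most h
   C; the summand 1 keeps [C] positive when [u] and [v] vanish. *)
pose C := 2 * (`|u| + `|v| + 1).
have C0 : 0 < C by rewrite mulr_gt0 // ltr_wpDl // addr_ge0.
have /= := diff_locallyxC dg.
set r := (X in forall h, _ = _ + X h) => gE0.
have gE w : g (p + w) = g p + 'd g p w + r w by exact: gE0.
have : \forall w \near (0 : V), `|r w| <= (e / C) * `|w|.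
  by apply: (littleoP [littleo of r]); rewrite divr_gt0.
move=> /nbhs_normP [d2 /= d2_gt0 hr].
near=> h.
have h0 : 0 < h by near: h; exact: nbhs_right_gt.
have hC1 : h * C < d1 by rewrite -ltr_pdivlMr //; near: h; apply: nbhs_right_lt; rewrite divr_gt0.
have hC2 : h * C < d2 by rewrite -ltr_pdivlMr //; near: h; apply: nbhs_right_lt; rewrite divr_gt0.
have nu := normr_ge0 u; have nv := normr_ge0 v.
have bnd t : 0 <= t <= h -> `|t *: u| <= h * `|u| /\ `|t *: u + h *: v| <= h * (`|u| + `|v|).
  move=> /andP[t0 th]; have ht : `|t *: u| <= h * `|u|.
    by rewrite normrZ ger0_norm // ler_wpM2r.
  split => //; apply: le_trans (ler_normD _ _) _.
  by rewrite mulrDr lerD // normrZ ger0_norm // ltW.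
have small t : 0 <= t <= h -> (`|t *: u| < d1 /\ `|t *: u + h *: v| < d1) /\
    (`|t *: u| < d2 /\ `|t *: u + h *: v| < d2).
  move=> /bnd [b1 b2].
  have c1 : h * `|u| <= h * C by rewrite ler_wpM2l ?(ltW h0) // /C; lra.
  have c2 : h * (`|u| + `|v|) <= h * C by rewrite ler_wpM2l ?(ltW h0) // /C; lra.
  have k1 := le_trans b1 c1; have k2 := le_trans b2 c2.
  by split; split; [exact: le_lt_trans hC1|exact: le_lt_trans hC1|
    exact: le_lt_trans hC2|exact: le_lt_trans hC2].
pose k (t : R) := f ((p + h *: v) + t *: u) - f (p + t *: u).
pose dk (t : R) := g ((p + h *: v) + t *: u) - g (p + t *: u).
have hk t : 0 <= t <= h -> is_derive t 1 k (dk t).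
  move=> /small [[s1 s2] _]; apply: is_deriveB; apply: is_derive_line; apply: df => /=.
    by rewrite -[p + _ + _]addrA opprD addrA subrr sub0r normrN addrC.
  by rewrite opprD addrA subrr sub0r normrN.
have [||xi] := @MVT R k dk 0 h h0.
- by move=> t; rewrite in_itv /= => /andP[t0 th]; apply: hk; rewrite !ltW.
- apply: derivable_within_continuous => t; rewrite in_itv /= => ht.
  by case: (hk t ht).
rewrite in_itv /= subr0 => /andP[/ltW x0 /ltW xh] E.
have xi_ok : 0 <= xi <= h by rewrite x0.
have [b1 b2] := bnd _ xi_ok; have [_ [s1 s2]] := small _ xi_ok.
have -> : f (p + h *: u + h *: v) - f (p + h *: u) - f (p + h *: v) + f p = k h - k 0.
  by rewrite /k scale0r !addr0 (addrAC p); ring.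
rewrite E /dk -addrA (addrC (h *: v)) !gE linearD deriveE // -/g.
have -> : 'd g p (h *: v) = h * 'd g p v by rewrite linearZ.
set L1 := 'd g p (xi *: u); set L2 := 'd g p v.
have -> : (g p + (L1 + h * L2) + r (xi *: u + h *: v) - (g p + L1 + r (xi *: u))) * h
   - h ^+ 2 * L2 = h * (r (xi *: u + h *: v) - r (xi *: u)) by ring.
rewrite normrM gtr0_norm // expr2 mulrCA ler_pM2l //.
have r1 := hr (xi *: u); have r2 := hr (xi *: u + h *: v).
rewrite /= !sub0r !normrN in r1 r2.
apply: le_trans (ler_normB _ _) _.
apply: le_trans (lerD (r2 s2) (r1 s1)) _.
rewrite -mulrDr -mulrA ler_pM2l // mulrC ler_pdivrMr //.
apply: le_trans (lerD b2 b1) _.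
by rewrite -mulrDr ler_pM2l // /C; lra.
Unshelve. all: by end_near. Qed.

(** Both iterated derivatives approximate the same second difference, which is symmetric in [u] and
    [v]. *)
Lemma schwarz f p u v : (\forall q \near p, differentiable f q) ->
  differentiable ('D_u f) p -> differentiable ('D_v f) p ->
  'D_u ('D_v f) p = 'D_v ('D_u f) p.
Proof.
move=> df du dv; apply/eqP; rewrite -subr_eq0 -normr_le0.
apply/ler_addgt0Pl => e e0; rewrite addr0.
have e2 : 0 < e / 2 by rewrite divr_gt0.
have H1 := @second_difference f p u v _ e2 df du.
have H2 := @second_difference f p v u _ e2 df dv.
have [h [h0 [{}H1 {}H2]]] : exists h, 0 < h /\
    (`|f (p + h *: u + h *: v) - f (p + h *: u) - f (p + h *: v) + f p
      - h ^+ 2 * 'D_v ('D_u f) p| <= e / 2 * h ^+ 2 /\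
    `|f (p + h *: v + h *: u) - f (p + h *: v) - f (p + h *: u) + f p
      - h ^+ 2 * 'D_u ('D_v f) p| <= e / 2 * h ^+ 2).
  have FF := at_right_proper_filter (0 : R).
  have [h [h0 [h1 h2]]] := @filter_ex _ _ FF _ (filterI (nbhs_right_gt (0 : R)) (filterI H1 H2)).
  exact: (ex_intro _ h (conj h0 (conj h1 h2))).
move: H1 H2; rewrite (addrAC p (h *: v)).
have h2 : 0 < h ^+ 2 by rewrite exprn_gt0.
set X := f _; set A := f (p + h *: u); set B := f (p + h *: v).
move: X A B ('D_u _ p) ('D_v _ p) => X A B D1 D2 H2 H1.
rewrite -(ler_pM2l h2) -[X in X * `|_|](gtr0_norm h2) -normrM.
have -> : h ^+ 2 * (D1 - D2) = (X - A - B + f p - h ^+ 2 * D2) - (X - B - A + f p - h ^+ 2 * D1) by ring.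
apply: le_trans (ler_normB _ _) _.
by apply: le_trans (lerD H2 H1) _; rewrite -mulrDl -splitr mulrC.
Qed.

End Schwarz.

(** * Calculus of functions of position and direction *)

Section DirectionalDerivatives.
Local Open Scope classical_set_scope.
Context {R : realType} {V : normedModType R}.

Lemma is_derive_sqrt_comp (f : V -> R) x v : 0 < f x -> derivable f x v ->
  is_derive x v (fun z => Num.sqrt (f z)) ('D_v f x / (2 * Num.sqrt (f x))).
Proof.
move=> f0 df; pose k := fun h : R => f (h *: v + x).
have k0 : k 0 = f x by rewrite /k scale0r add0r.
have dk : is_derive (0 : R) 1 k ('D_v f x).
  apply: DeriveDef; first exact: (derivable1P f x v).1.
  have E : (fun h : R => h^-1 *: ((k \o shift 0) (h *: 1) - f x))
    = (fun h : R => h^-1 *: ((f \o shift x) (h *: v) - f x)).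
    by apply/funext => h; rewrite /k /= [_%:A]mulr1 addr0.
  by rewrite /derive k0 E.
have sk : is_derive (k 0) 1 Num.sqrt ((2 * Num.sqrt (f x))^-1).
  by rewrite k0; apply: is_derive1_sqrt.
have [ds es] := is_derive1_comp sk dk.
apply: DeriveDef; first exact: (derivable1P (fun z => Num.sqrt (f z)) x v).2.
have E : (fun h : R => h^-1 *: (((Num.sqrt \o k) \o shift 0) (h *: 1) - Num.sqrt (f x)))
  = (fun h : R => h^-1 *: (((fun z => Num.sqrt (f z)) \o shift x) (h *: v) - Num.sqrt (f x))).
  by apply/funext => h; rewrite /k /= [_%:A]mulr1 addr0.
by rewrite mulrC -es /derive -E /= k0.
Qed.

End DirectionalDerivatives.

(* Locked: unfolding derivatives during unification diverges. *)
HB.lock Definition pd {R : realType} {n : nat} (d : 'I_n + 'I_n)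
    (f : 'rV[R]_n -> 'rV[R]_n -> R) : 'rV[R]_n -> 'rV[R]_n -> R :=
  match d with inl k => dx k f | inr k => dy k f end.

HB.lock Definition pderivable {R : realType} {n : nat} (d : 'I_n + 'I_n)
    (f : 'rV[R]_n -> 'rV[R]_n -> R) (p y : 'rV[R]_n) : Prop :=
  match d with
  | inl k => derivable (fun q => f q y) p (delta_mx 0 k)
  | inr k => derivable (f p) y (delta_mx 0 k)
  end.

Section PositionDirection.
Local Open Scope classical_set_scope.
Context {R : realType} {n : nat}.
Local Notation V := 'rV[R]_n.
Local Notation fn := (V -> V -> R).
Local Notation dir := ('I_n + 'I_n)%type.
Implicit Types (f g : fn) (p y : V) (d e : dir).

Lemma dx_pd k f : dx k f = pd (inl k) f. Proof. by rewrite pd.unlock. Qed.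

Lemma dy_pd k f : dy k f = pd (inr k) f. Proof. by rewrite pd.unlock. Qed.

Lemma pdD d f g p y : pderivable d f p y -> pderivable d g p y ->
  pderivable d (fun p y => f p y + g p y) p y /\
  pd d (fun p y => f p y + g p y) p y = pd d f p y + pd d g p y.
Proof.
rewrite pd.unlock pderivable.unlock.
by case: d => k df dg; split; [apply: derivableD df dg|apply: deriveD df dg|
  apply: derivableD df dg|apply: deriveD df dg].
Qed.

Lemma pdM d f g p y : pderivable d f p y -> pderivable d g p y ->
  pderivable d (fun p y => f p y * g p y) p y /\
  pd d (fun p y => f p y * g p y) p y = pd d f p y * g p y + f p y * pd d g p y.
Proof.
rewrite pd.unlock pderivable.unlock.
case: d => k df dg; split; first exact: derivableM df dg.
- by rewrite addrC (mulrC _ (g p y)); apply: deriveM df dg.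
- exact: derivableM df dg.
- by rewrite addrC (mulrC _ (g p y)); apply: deriveM df dg.
Qed.

Lemma pd_cst d (c : R) p y :
  pderivable d (fun _ _ => c) p y /\ pd d (fun _ _ => c) p y = 0.
Proof.
rewrite pd.unlock pderivable.unlock.
by case: d => k; split; [apply: derivable_cst|apply: derive_cst|
  apply: derivable_cst|apply: derive_cst].
Qed.

Lemma pdV d f p y : f p y != 0 -> pderivable d f p y ->
  pderivable d (fun p y => (f p y)^-1) p y /\
  pd d (fun p y => (f p y)^-1) p y = - ((f p y)^-1 * (f p y)^-1) * pd d f p y.
Proof.
rewrite pd.unlock pderivable.unlock.
rewrite -invfM -expr2; case: d => k f0 df; split.
- exact: (@derivableV _ _ (fun q => f q y)).
- exact: (@deriveV _ _ (fun q => f q y)).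
- exact: (@derivableV _ _ (f p)).
- exact: (@deriveV _ _ (f p)).
Qed.

Lemma pd_sqrt d f p y : 0 < f p y -> pderivable d f p y ->
  pderivable d (fun p y => Num.sqrt (f p y)) p y /\
  pd d (fun p y => Num.sqrt (f p y)) p y = pd d f p y * (2 * Num.sqrt (f p y))^-1.
Proof.
rewrite pd.unlock pderivable.unlock.
case: d => k f0 df; have [h1 h2] := is_derive_sqrt_comp f0 df.
- by split; [exact: h1|exact: h2].
- by split; [exact: h1|exact: h2].
Qed.

Lemma pd_coord d (j : 'I_n) p y :
  pderivable d (fun _ y => y 0 j) p y /\
  pd d (fun _ y => y 0 j) p y =
    match d with inl _ => 0 | inr k => (k == j)%:R end.
Proof.
rewrite pd.unlock pderivable.unlock; case: d => k.
  by split; [exact: derivable_cst|exact: derive_cst].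
have dif := @differentiable_coord R 1 n y 0 j.
split; first exact: diff_derivable.
rewrite /= /dy /partial deriveE //.
have := @derive_mx R V 1 n id y (delta_mx 0 k) (@derivable_id R V y (delta_mx 0 k)).
rewrite derive_id => /matrixP /(_ 0 j); rewrite !mxE eqxx /= -deriveE // => <-.
by rewrite eq_sym.
Qed.

Lemma pd_base_x k (h : V -> R) :
  pd (inl k) (fun p _ => h p) = fun p _ => partial k h p.
Proof. by rewrite pd.unlock. Qed.

Lemma pd_base_y k (h : V -> R) p y : pd (inr k) (fun p _ => h p) p y = 0.
Proof. by rewrite pd.unlock; exact: derive_cst. Qed.

End PositionDirection.

(** * Smooth functions of a position and a nonzero direction *)

Section SmoothOnSlit.
Local Open Scope classical_set_scope.
Context {R : realType} {n : nat}.
Local Notation V := 'rV[R]_n.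
Local Notation fn := (V -> V -> R).
Local Notation dir := ('I_n + 'I_n)%type.
Variable U : set V.
Hypothesis U_open : open U.
Implicit Types (f g : fn) (p y : V) (d e : dir) (N : nat).

(** The zero direction is removed because alpha is not differentiable there. *)
Definition slit p y : Prop := U p /\ y != 0.

Local Notation W := slit.

Definition eqW f g := forall p y, W p y -> f p y = g p y.

Lemma nonzero_open (y : V) : y != 0 -> \forall z \near y, z != 0.
Proof.
move=> y0; apply/nbhs_normP; exists `|y|; first by rewrite /= normr_gt0.
by move=> z /=; apply: contraTneq => ->; rewrite subr0 ltxx.
Qed.

Lemma eqW_pd d f g : eqW f g -> eqW (pd d f) (pd d g).
Proof.
move=> E p y [Up y0]; rewrite pd.unlock; case: d => k; apply: near_eq_derive.
- near=> q; apply: E; split => //; near: q; exact: open_nbhs_nbhs.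
- near=> z; apply: E; split => //; near: z; exact: nonzero_open.
Unshelve. all: by end_near. Qed.

Lemma eqW_pderivable d f g p y : eqW f g -> W p y ->
  pderivable d f p y -> pderivable d g p y.
Proof.
move=> E [Up y0]; rewrite pderivable.unlock; case: d => k /=; apply: near_eq_derivable.
- near=> q; apply: E; split => //; near: q; exact: open_nbhs_nbhs.
- near=> z; apply: E; split => //; near: z; exact: nonzero_open.
Unshelve. all: by end_near. Qed.

Definition commW f := forall d e, eqW (pd d (pd e f)) (pd e (pd d f)).

(** Differentiability along coordinate lines up to order [N], with the symmetry of second
    derivatives carried as part of the definition: [schwarz] is invoked only for functions of
    position, and the algebraic operations then preserve commutation. The guard demands commutation
    only where two derivatives are available. *)
Fixpoint Sm N f : Prop :=
  match N with
  | 0 => True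
  | N'.+1 => [/\ forall d p y, W p y -> pderivable d f p y,
                 forall d, Sm N' (pd d f) & (0 < N')%N -> commW f]
  end.

Lemma eqW_sym f g : eqW f g -> eqW g f.
Proof. by move=> E p y Wp; rewrite E. Qed.

Lemma eqW_trans f g h : eqW f g -> eqW g h -> eqW f h.
Proof. by move=> E F p y Wp; rewrite E ?F. Qed.

Lemma Sm_le N f : Sm N.+1 f -> Sm N f.
Proof.
elim: N f => // N IH f [h1 h2 h3]; split => //.
- by move=> d; apply: IH.
- by move=> N0; apply: h3.
Qed.

Lemma Sm_ext N f g : eqW f g -> Sm N f -> Sm N g.
Proof.
elim: N f g => // N IH f g E [h1 h2 h3]; split.
- by move=> d p y Wp; apply: (eqW_pderivable E) => //; apply: h1.
- by move=> d; apply: IH (h2 d); apply: eqW_pd.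
- move=> N0 d e.
  have E2 d' e' := eqW_pd d' (eqW_pd e' E).
  exact: eqW_trans (eqW_sym (E2 d e)) (eqW_trans (h3 N0 d e) (E2 e d)).
Qed.

Lemma Sm_cst N (c : R) : Sm N (fun _ _ => c).
Proof.
elim: N c => // N IH c; have E d : eqW (pd d (fun _ _ => c)) (fun _ _ => 0).
  by move=> p y _; case: (pd_cst d c p y).
split.
- by move=> d p y _; case: (pd_cst d c p y).
- by move=> d; apply: Sm_ext (IH 0); apply: eqW_sym.
- move=> _ d e p y Wp; rewrite (eqW_pd d (E e) Wp) (eqW_pd e (E d) Wp).
  by rewrite (pd_cst d 0 p y).2 (pd_cst e 0 p y).2.
Qed.

Lemma Sm_coord N j : Sm N (fun _ y => y 0 j).
Proof.
case: N => // N.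
pose c d : R := match d with inl _ => 0 | inr k => (k == j)%:R end.
have E d : eqW (pd d (fun _ y => y 0 j)) (fun _ _ => c d).
  by move=> p y _; case: (pd_coord d j p y).
split.
- by move=> d p y _; case: (pd_coord d j p y).
- by move=> d; apply: Sm_ext (Sm_cst N (c d)); apply: eqW_sym.
- move=> _ d e p y Wp; rewrite (eqW_pd d (E e) Wp) (eqW_pd e (E d) Wp).
  by rewrite (pd_cst d _ p y).2 (pd_cst e _ p y).2.
Qed.

Lemma SmD N f g : Sm N f -> Sm N g -> Sm N (fun p y => f p y + g p y).
Proof.
elim: N f g => // N IH f g [f1 f2 f3] [g1 g2 g3].
have E d : eqW (fun p y => pd d f p y + pd d g p y) (pd d (fun p y => f p y + g p y)).
  by move=> p y Wp; have [_ ->] := pdD (f1 d p y Wp) (g1 d p y Wp).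
split.
- by move=> d p y Wp; have [] := pdD (f1 d p y Wp) (g1 d p y Wp).
- by move=> d; apply: (Sm_ext (E d)); apply: IH; [exact: f2|exact: g2].
- move=> N0 d e p y Wp; rewrite -(eqW_pd d (E e) Wp) -(eqW_pd e (E d) Wp).
  case: N N0 {IH} f2 f3 g2 g3 => // N _ f2 f3 g2 g3.
  have [a1 _ _] := f2 d; have [a2 _ _] := f2 e.
  have [b1 _ _] := g2 d; have [b2 _ _] := g2 e.
  have [_ ->] := pdD (a2 d p y Wp) (b2 d p y Wp).
  have [_ ->] := pdD (a1 e p y Wp) (b1 e p y Wp).
  by rewrite f3 // g3.
Qed.

Lemma SmM N f g : Sm N f -> Sm N g -> Sm N (fun p y => f p y * g p y).
Proof.
elim: N f g => // N IH f g Sf Sg.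
have Sf' := Sm_le Sf; have Sg' := Sm_le Sg.
case: Sf => f1 f2 f3; case: Sg => g1 g2 g3.
have E d : eqW (fun p y => pd d f p y * g p y + f p y * pd d g p y)
    (pd d (fun p y => f p y * g p y)).
  by move=> p y Wp; have [_ ->] := pdM (f1 d p y Wp) (g1 d p y Wp).
split.
- by move=> d p y Wp; have [] := pdM (f1 d p y Wp) (g1 d p y Wp).
- by move=> d; apply: (Sm_ext (E d)); apply: SmD; apply: IH => //; [exact: f2|exact: g2].
- move=> N0 d e p y Wp; rewrite -(eqW_pd d (E e) Wp) -(eqW_pd e (E d) Wp).
  case: N N0 {IH Sf' Sg'} f2 f3 g2 g3 => // N _ f2 f3 g2 g3.
  have [a1 _ _] := f2 d; have [a2 _ _] := f2 e.
  have [b1 _ _] := g2 d; have [b2 _ _] := g2 e.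
  have [k1 e1] := pdM (a2 d p y Wp) (g1 d p y Wp).
  have [k2 e2] := pdM (f1 d p y Wp) (b2 d p y Wp).
  have [k3 e3] := pdM (a1 e p y Wp) (g1 e p y Wp).
  have [k4 e4] := pdM (f1 e p y Wp) (b1 e p y Wp).
  have [_ ->] := pdD k1 k2; have [_ ->] := pdD k3 k4.
  rewrite e1 e2 e3 e4 (f3 isT d e) // (g3 isT d e) //.
  by move: (pd e f p y) (pd d f p y) (pd e g p y) (pd d g p y) => *; ring.
Qed.

(** The derivative of the inverse is a polynomial in the inverse and in the derivative of [f], so
    order [N] of the inverse yields order [N.+1]. The square root below bootstraps in the same
    way. *)
Lemma SmV N f : (forall p y, W p y -> f p y != 0) -> Sm N f ->
  Sm N (fun p y => (f p y)^-1).
Proof.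
move=> f0; elim: N => // N IH Sf; have Sf' := Sm_le Sf.
have {IH Sf'} := IH Sf'.
case: Sf => f1 f2 f3; set h := fun p y => (f p y)^-1 => IH.
have E d : eqW (fun p y => (fun p y => -1 * (h p y * h p y)) p y * pd d f p y) (pd d h).
  by move=> p y Wp; have [_ ->] := pdV (f0 p y Wp) (f1 d p y Wp); rewrite mulN1r.
have D d p y : W p y -> pderivable d h p y.
  by move=> Wp; have [] := pdV (f0 p y Wp) (f1 d p y Wp).
split => //.
- move=> d; apply: (Sm_ext (E d)).
  exact: (SmM (SmM (Sm_cst N (-1)) (SmM IH IH)) (f2 d)).
- move=> N0 d e p y Wp; rewrite -(eqW_pd d (E e) Wp) -(eqW_pd e (E d) Wp).
  case: N N0 {IH} f2 f3 => // N _ f2 f3.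
  have [a1 _ _] := f2 d; have [a2 _ _] := f2 e.
  have Q d' : pderivable d' (fun p y => -1 * (h p y * h p y)) p y /\
      pd d' (fun p y => -1 * (h p y * h p y)) p y = -1 * (pd d' h p y * h p y + h p y * pd d' h p y).
    have [q1 q2] := pdM (D d' p y Wp) (D d' p y Wp).
    have [c1 c2] := pd_cst d' (-1) p y.
    by have [z1 ->] := pdM c1 q1; split => //; rewrite q2 c2 mul0r add0r.
  have [_ ->] := pdM (Q d).1 (a2 d p y Wp).
  have [_ ->] := pdM (Q e).1 (a1 e p y Wp).
  rewrite (Q d).2 (Q e).2 (f3 isT d e) // -!(E _ p y Wp).
  by move: (pd e f p y) (pd d f p y) => *; ring.
Qed.

Lemma Sm_sqrt N f : (forall p y, W p y -> 0 < f p y) -> Sm N f ->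
  Sm N (fun p y => Num.sqrt (f p y)).
Proof.
move=> f0; elim: N => // N IH Sf; have Sf' := Sm_le Sf.
have {IH Sf'} := IH Sf'.
case: Sf => f1 f2 f3; set h := fun p y => Num.sqrt (f p y) => IH.
have h0 p y : W p y -> h p y != 0.
  by move=> Wp; rewrite gt_eqF // sqrtr_gt0 f0.
have h20 p y : W p y -> 2 * h p y != 0.
  by move=> Wp; rewrite mulf_neq0 ?h0 // pnatr_eq0.
pose k : fn := fun p y => (2 * h p y)^-1.
have E d : eqW (fun p y => pd d f p y * k p y) (pd d h).
  by move=> p y Wp; have [_ ->] := pd_sqrt (f0 p y Wp) (f1 d p y Wp).
have D d p y : W p y -> pderivable d h p y.
  by move=> Wp; have [] := pd_sqrt (f0 p y Wp) (f1 d p y Wp).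
split => //.
- move=> d; apply: (Sm_ext (E d)).
  exact: (SmM (f2 d) (SmV h20 (SmM (Sm_cst N 2) IH))).
- move=> N0 d e p y Wp; rewrite -(eqW_pd d (E e) Wp) -(eqW_pd e (E d) Wp).
  case: N N0 {IH} f2 f3 => // N _ f2 f3.
  have [a1 _ _] := f2 d; have [a2 _ _] := f2 e.
  have Q d' : pderivable d' k p y /\
      pd d' k p y = - (k p y * k p y) * (2 * pd d' h p y).
    have [c1 c2] := pd_cst d' (2 : R) p y.
    have [q1 q2] := pdM c1 (D d' p y Wp).
    by have [z1 ->] := pdV (h20 _ _ Wp) q1; split => //; rewrite q2 c2 mul0r add0r.
  have [_ ->] := pdM (a2 d p y Wp) (Q d).1.
  have [_ ->] := pdM (a1 e p y Wp) (Q e).1.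
  rewrite (Q d).2 (Q e).2 (f3 isT d e) // -!(E _ p y Wp).
  by move: (pd e f p y) (pd d f p y) (k p y) => *; ring.
Qed.

Lemma Sm_sum N (I : Type) (r : seq I) (P : pred I) (f : I -> fn) :
  (forall i, Sm N (f i)) -> Sm N (fun p y => \sum_(i <- r | P i) f i p y).
Proof.
move=> Sf; elim: r => [|i r IH].
  by apply: Sm_ext (Sm_cst N 0) => p y _; rewrite big_nil.
case Pi: (P i).
  by apply: Sm_ext (SmD (Sf i) IH) => p y _; rewrite big_cons Pi.
by apply: Sm_ext IH => p y _; rewrite big_cons Pi.
Qed.

Lemma Sm_prod N (I : Type) (r : seq I) (P : pred I) (f : I -> fn) :
  (forall i, Sm N (f i)) -> Sm N (fun p y => \prod_(i <- r | P i) f i p y).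
Proof.
move=> Sf; elim: r => [|i r IH].
  by apply: Sm_ext (Sm_cst N 1) => p y _; rewrite big_nil.
case Pi: (P i).
  by apply: Sm_ext (SmM (Sf i) IH) => p y _; rewrite big_cons Pi.
by apply: Sm_ext IH => p y _; rewrite big_cons Pi.
Qed.

Lemma smooth_on_partial (h : V -> R) (k : 'I_n) : smooth_on U h -> smooth_on U (partial k h).
Proof.
move=> sh s p Up; have := sh (rcons s k) p Up.
by rewrite /iter_partial foldr_rcons.
Qed.

Lemma Sm_base N (h : V -> R) : smooth_on U h -> Sm N (fun p _ => h p).
Proof.
elim: N h => // N IH h sh.
have dh q : U q -> differentiable h q by exact: (sh [::]).
split.
- rewrite pderivable.unlock => - [] k p y [Up _] /=; first exact/diff_derivable/dh.
  exact: derivable_cst.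
- case=> k; first by rewrite pd_base_x; exact: IH (smooth_on_partial k sh).
  by apply: Sm_ext (Sm_cst N 0) => p y _; rewrite pd_base_y.
- move=> _.
  have Z k : eqW (pd (inr k) (fun p _ => h p)) (fun _ _ => 0).
    by move=> p y _; exact: pd_base_y.
  have Z0 d p y : W p y -> pd d (fun _ _ => 0) p y = 0.
    by move=> _; case: (pd_cst d 0 p y).
  case=> k [] l p y Wp.
  (* Two position directions are the only substantial case: a function of position has zero
     derivative in [y]. *)
  + have Up := Wp.1; rewrite pd.unlock; apply: schwarz.
    * by near=> q; apply: dh; near: q; exact: open_nbhs_nbhs.
    * exact: (@smooth_on_partial h k sh [::] p Up).
    * exact: (@smooth_on_partial h l sh [::] p Up).
  + rewrite (eqW_pd _ (Z l) Wp) Z0 // pd_base_x.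
    by rewrite pd_base_y.
  + rewrite (eqW_pd (inl l) (Z k) Wp) Z0 // pd_base_x.
    by rewrite pd_base_y.
  + by rewrite (eqW_pd _ (Z k) Wp) (eqW_pd _ (Z l) Wp) !Z0.
Unshelve. all: by end_near. Qed.

End SmoothOnSlit.

(** * Derivation rules, Euler homogeneity, reflection of the direction, curvature of a spray *)

Section SmoothCalculus.
Context {R : realType} {n : nat}.
Local Notation V := 'rV[R]_n.
Local Notation fn := (V -> V -> R).
Variable U : set V.
Hypothesis U_open : open U.
Implicit Types (f g : fn) (p y : V) (d e : 'I_n + 'I_n).

Local Notation W := (slit U).

Definition smoothW f := forall N, Sm U N f.

Lemma sm_derivable f d p y : smoothW f -> W p y -> pderivable d f p y.
Proof. by move=> sf; have [h _ _] := sf 1%N; apply: h. Qed.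

Lemma sm_pd f d : smoothW f -> smoothW (pd d f).
Proof. by move=> sf N; have [_ h _] := sf N.+1; apply: h. Qed.

Lemma pd_comm f d e p y : smoothW f -> W p y ->
  pd d (pd e f) p y = pd e (pd d f) p y.
Proof. by move=> sf; have [_ _ h] := sf 2%N; exact: h. Qed.

Lemma sm_ext f g : eqW U f g -> smoothW f -> smoothW g.
Proof. by move=> E sf N; exact: Sm_ext (sf N). Qed.

Lemma sm_cst (c : R) : smoothW (fun _ _ => c).
Proof. by move=> N; exact: Sm_cst. Qed.

Lemma sm_coord j : smoothW (fun _ y => y 0 j).
Proof. by move=> N; exact: Sm_coord. Qed.

Lemma sm_base (h : V -> R) : smooth_on U h -> smoothW (fun p _ => h p).
Proof. by move=> sh N; exact: Sm_base. Qed.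

Lemma smD f g : smoothW f -> smoothW g -> smoothW (fun p y => f p y + g p y).
Proof. by move=> sf sg N; exact: SmD (sf N) (sg N). Qed.

Lemma smM f g : smoothW f -> smoothW g -> smoothW (fun p y => f p y * g p y).
Proof. by move=> sf sg N; exact: SmM (sf N) (sg N). Qed.

Lemma smN f : smoothW f -> smoothW (fun p y => - f p y).
Proof.
move=> sf; apply: sm_ext (smM (sm_cst (-1)) sf) => p y _; exact: mulN1r.
Qed.

Lemma smB f g : smoothW f -> smoothW g -> smoothW (fun p y => f p y - g p y).
Proof. by move=> sf sg; apply: smD => //; exact: smN. Qed.

Lemma sm_sum (I : Type) (r : seq I) (P : pred I) (f : I -> fn) :
  (forall i, smoothW (f i)) -> smoothW (fun p y => \sum_(i <- r | P i) f i p y).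
Proof. by move=> sf N; apply: Sm_sum => // i; exact: sf. Qed.

Lemma sm_prod (I : Type) (r : seq I) (P : pred I) (f : I -> fn) :
  (forall i, smoothW (f i)) -> smoothW (fun p y => \prod_(i <- r | P i) f i p y).
Proof. by move=> sf N; apply: Sm_prod => // i; exact: sf. Qed.

Lemma smV f : (forall p y, W p y -> f p y != 0) -> smoothW f ->
  smoothW (fun p y => (f p y)^-1).
Proof. by move=> f0 sf N; apply: SmV => //. Qed.

Lemma sm_sqrt f : (forall p y, W p y -> 0 < f p y) -> smoothW f ->
  smoothW (fun p y => Num.sqrt (f p y)).
Proof. by move=> f0 sf N; apply: Sm_sqrt => //. Qed.

Lemma sm_pdD d f g p y : smoothW f -> smoothW g -> W p y ->
  pd d (fun p y => f p y + g p y) p y = pd d f p y + pd d g p y.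
Proof.
by move=> sf sg Wp; have [_] := pdD (sm_derivable d sf Wp) (sm_derivable d sg Wp).
Qed.

Lemma sm_pdM d f g p y : smoothW f -> smoothW g -> W p y ->
  pd d (fun p y => f p y * g p y) p y = pd d f p y * g p y + f p y * pd d g p y.
Proof.
by move=> sf sg Wp; have [_] := pdM (sm_derivable d sf Wp) (sm_derivable d sg Wp).
Qed.

Lemma sm_pdZ d (c : R) f p y : smoothW f -> W p y ->
  pd d (fun p y => c * f p y) p y = c * pd d f p y.
Proof.
move=> sf Wp; rewrite (sm_pdM d (sm_cst c) sf Wp) (pd_cst d c p y).2.
by rewrite mul0r add0r.
Qed.

Lemma sm_pdN d f p y : smoothW f -> W p y ->
  pd d (fun p y => - f p y) p y = - pd d f p y.
Proof.
move=> sf Wp; rewrite -mulN1r -sm_pdZ //; apply: (eqW_pd U_open) Wp.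
by move=> q z _; rewrite mulN1r.
Qed.

Lemma sm_pdB d f g p y : smoothW f -> smoothW g -> W p y ->
  pd d (fun p y => f p y - g p y) p y = pd d f p y - pd d g p y.
Proof. by move=> sf sg Wp; rewrite (sm_pdD d sf (smN sg)) // sm_pdN. Qed.

Lemma sm_pd_sum (I : Type) (r : seq I) (P : pred I) (f : I -> fn) d p y :
  (forall i, smoothW (f i)) -> W p y ->
  pd d (fun p y => \sum_(i <- r | P i) f i p y) p y =
  \sum_(i <- r | P i) pd d (f i) p y.
Proof.
move=> sf Wp; elim: r => [|i r IH].
  rewrite big_nil; transitivity (pd d (fun _ _ => 0 : R) p y).
    by apply: (eqW_pd U_open) Wp => q z _; rewrite big_nil.
  by case: (pd_cst d (0 : R) p y).
rewrite big_cons -IH; case Pi: (P i); last first.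
  by apply: (eqW_pd U_open) Wp => q z _; rewrite big_cons Pi.
rewrite -(sm_pdD d (sf i) (sm_sum r P sf) Wp).
by apply: (eqW_pd U_open) Wp => q z _; rewrite big_cons Pi.
Qed.

Lemma pd_coord_x k j p y : pd (inl k) (fun _ y : V => y 0 j) p y = 0.
Proof. exact: (pd_coord (inl k) j p y).2. Qed.

Lemma pd_coord_y k j p y : pd (inr k) (fun _ y : V => y 0 j) p y = (k == j)%:R.
Proof. exact: (pd_coord (inr k) j p y).2. Qed.

(** Homogeneity of degree [c] in [y], encoded as Euler's equation: in this form it passes to
    derivatives by differentiating the equation. *)
Definition homog (c : R) f := forall p y, W p y ->
  \sum_k y 0 k * pd (inr k) f p y = c * f p y.

Lemma sum_delta_l (k : 'I_n) (F : 'I_n -> R) : \sum_m (k == m)%:R * F m = F k.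
Proof.
rewrite (bigD1 k) //= eqxx mul1r big1 ?addr0 // => m mk.
by rewrite eq_sym (negbTE mk) mul0r.
Qed.

Lemma sum_delta_r (k : 'I_n) (F : 'I_n -> R) : \sum_m F m * (k == m)%:R = F k.
Proof. by rewrite -[RHS]sum_delta_l; apply: eq_bigr => m _; rewrite mulrC. Qed.

Lemma homog_pd_x c f m : smoothW f -> homog c f -> homog c (pd (inl m) f).
Proof.
move=> sf hf p y Wp.
have E : eqW U (fun p y => \sum_k y 0 k * pd (inr k) f p y) (fun p y => c * f p y).
  exact: hf.
have := eqW_pd U_open (inl m) E Wp; rewrite sm_pdZ // => <-.
have sk k : smoothW (fun p y => y 0 k * pd (inr k) f p y).
  by apply: smM; [exact: sm_coord|exact: sm_pd].
rewrite (sm_pd_sum _ _ _ sk) //; apply: eq_bigr => k _.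
rewrite (sm_pdM _ (sm_coord k) (sm_pd (inr k) sf)) //.
by rewrite pd_coord_x mul0r add0r pd_comm.
Qed.

Lemma homog_pd_y c f m : smoothW f -> homog c f -> homog (c - 1) (pd (inr m) f).
Proof.
move=> sf hf p y Wp.
have E : eqW U (fun p y => \sum_k y 0 k * pd (inr k) f p y) (fun p y => c * f p y).
  exact: hf.
have := eqW_pd U_open (inr m) E Wp; rewrite sm_pdZ // mulrBl mul1r => <-.
have sk k : smoothW (fun p y => y 0 k * pd (inr k) f p y).
  by apply: smM; [exact: sm_coord|exact: sm_pd].
rewrite (sm_pd_sum _ _ _ sk) //.
under [in RHS]eq_bigr => k _.
  rewrite (sm_pdM _ (sm_coord k) (sm_pd (inr k) sf)) // pd_coord_y.
  rewrite (pd_comm (inr m)) //; over.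
by rewrite big_split /= sum_delta_l addrAC subrr add0r.
Qed.

Lemma homog_base (h : V -> R) : homog 0 (fun p _ => h p).
Proof.
by move=> p y _; rewrite mul0r big1 // => k _; rewrite pd_base_y mulr0.
Qed.

Lemma homog_coord j : homog 1 (fun _ y => y 0 j).
Proof.
move=> p y _; rewrite mul1r -[RHS](sum_delta_r j (fun k => y 0 k)).
by apply: eq_bigr => k _; rewrite pd_coord_y eq_sym.
Qed.

Lemma homogM c c' f g : smoothW f -> smoothW g -> homog c f -> homog c' g ->
  homog (c + c') (fun p y => f p y * g p y).
Proof.
move=> sf sg hf hg p y Wp.
under eq_bigr => k _ do rewrite (sm_pdM _ sf sg Wp) mulrDr.
rewrite big_split /=.
under eq_bigr => k _ do rewrite mulrA.
rewrite -mulr_suml hf //.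
under eq_bigr => k _ do rewrite mulrCA.
by rewrite -mulr_sumr hg //; ring.
Qed.

Lemma homogD c f g : smoothW f -> smoothW g -> homog c f -> homog c g ->
  homog c (fun p y => f p y + g p y).
Proof.
move=> sf sg hf hg p y Wp.
under eq_bigr => k _ do rewrite (sm_pdD _ sf sg Wp) mulrDr.
by rewrite big_split /= hf // hg // mulrDr.
Qed.

Lemma homogN c f : smoothW f -> homog c f -> homog c (fun p y => - f p y).
Proof.
move=> sf hf p y Wp.
under eq_bigr => k _ do rewrite (sm_pdN _ sf Wp) mulrN.
by rewrite sumrN hf // mulrN.
Qed.

Lemma sm_pdV d f p y : (forall p y, W p y -> f p y != 0) -> smoothW f -> W p y ->
  pd d (fun p y => (f p y)^-1) p y = - ((f p y)^-1 * (f p y)^-1) * pd d f p y.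
Proof. by move=> f0 sf Wp; have [_] := pdV (f0 _ _ Wp) (sm_derivable d sf Wp). Qed.

Lemma homogV c f : (forall p y, W p y -> f p y != 0) -> smoothW f -> homog c f ->
  homog (- c) (fun p y => (f p y)^-1).
Proof.
move=> f0 sf hf p y Wp.
under eq_bigr => k _ do rewrite (sm_pdV _ f0 sf Wp) mulrCA.
by rewrite -mulr_sumr hf //; field; exact: f0.
Qed.

Lemma sm_pd_sqrt d f p y : (forall p y, W p y -> 0 < f p y) -> smoothW f -> W p y ->
  pd d (fun p y => Num.sqrt (f p y)) p y = pd d f p y * (2 * Num.sqrt (f p y))^-1.
Proof. by move=> f0 sf Wp; have [_] := pd_sqrt (f0 _ _ Wp) (sm_derivable d sf Wp). Qed.

Lemma homog_sqrt c f : (forall p y, W p y -> 0 < f p y) -> smoothW f -> homog (2 * c) f ->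
  homog c (fun p y => Num.sqrt (f p y)).
Proof.
move=> f0 sf hf p y Wp.
under eq_bigr => k _ do rewrite (sm_pd_sqrt _ f0 sf Wp) mulrA.
have fp := f0 _ _ Wp.
rewrite -mulr_suml hf // -{1}(sqr_sqrtr (ltW fp)); field.
by rewrite gt_eqF // sqrtr_gt0.
Qed.

Definition refl f : fn := fun p y => f p (- y).

Lemma slit_opp p y : W p y -> W p (- y).
Proof. by case=> Up y0; split => //; rewrite oppr_eq0. Qed.

Lemma pd_refl_x k f : pd (inl k) (refl f) = refl (pd (inl k) f).
Proof. by rewrite pd.unlock. Qed.

Lemma derive_opp (h : V -> R) (v y : V) : derivable h (- y) v ->
  is_derive y v (fun z => h (- z)) (- 'D_v h (- y)).
Proof.
move=> dh; pose k := fun t : R => h (t *: v - y).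
have k0 : k 0 = h (- y) by rewrite /k scale0r add0r.
have dk : is_derive (- 0 : R) 1 k ('D_v h (- y)).
  rewrite oppr0; apply: DeriveDef; first exact: (derivable1P h (- y) v).1.
  have E : (fun t : R => t^-1 *: ((k \o shift 0) (t *: 1) - h (- y)))
    = (fun t : R => t^-1 *: ((h \o shift (- y)) (t *: v) - h (- y))).
    by apply/funext => t; rewrite /k /= [_%:A]mulr1 addr0.
  by rewrite /derive k0 E.
have [ds es] := is_derive1_comp dk (is_deriveNid (0 : R) 1).
have E : (k \o -%R) = (fun t => h (- (t *: v + y))).
  by apply/funext => t; rewrite /k /= scaleNr opprD.
apply: DeriveDef; first by apply: (derivable1P _ y v).2; rewrite -E.
have E2 : (fun t : R => t^-1 *: (((k \o -%R) \o shift 0) (t *: 1) - (k \o -%R) 0))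
  = (fun t : R => t^-1 *: (((fun z => h (- z)) \o shift y) (t *: v) - h (- y))).
  by apply/funext => t; rewrite E /= [_%:A]mulr1 addr0 scale0r add0r.
by rewrite -mulrN1 -es /derive E2.
Qed.

Lemma pd_refl_y k f p y : smoothW f -> W p y ->
  pd (inr k) (refl f) p y = - pd (inr k) f p (- y).
Proof.
move=> sf Wp; have := sm_derivable (inr k) sf (slit_opp Wp).
by rewrite pd.unlock pderivable.unlock => /derive_opp [].
Qed.

Lemma pd_refl d f : smoothW f -> eqW U (pd d (refl f))
  (fun p y => (if d is inl _ then 1 else -1) * refl (pd d f) p y).
Proof.
move=> sf p y Wp; case: d => k; first by rewrite pd_refl_x mul1r.
by rewrite pd_refl_y // mulN1r.
Qed.

Lemma pderivable_refl d f p y : smoothW f -> W p y -> pderivable d (refl f) p y.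
Proof.
move=> sf Wp; have := sm_derivable d sf (slit_opp Wp).
rewrite pderivable.unlock; case: d => k dk; first exact: dk.
exact: (@ex_derive _ _ _ _ _ _ _ (derive_opp dk)).
Qed.

Lemma sm_refl f : smoothW f -> smoothW (refl f).
Proof.
move=> sf N; elim: N f sf => // N IH f sf; split.
- by move=> d p y Wp; exact: pderivable_refl.
- move=> d; apply: (Sm_ext U_open (eqW_sym (pd_refl d sf))).
  by apply: SmM => //; [exact: Sm_cst|apply: IH; exact: sm_pd].
- move=> _ d e p y Wp.
  have h (c : R) f1 d1 : smoothW f1 -> pd d1 (fun p y => c * refl f1 p y) p y = c * pd d1 (refl f1) p y.
    move=> s1; have [k1 k2] := pd_cst d1 c p y.
    by have [_ ->] := pdM k1 (pderivable_refl d1 s1 Wp); rewrite k2 mul0r add0r.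
  rewrite (eqW_pd U_open _ (pd_refl e sf) Wp) (eqW_pd U_open _ (pd_refl d sf) Wp).
  rewrite !h; [|exact: sm_pd|exact: sm_pd].
  rewrite (pd_refl d (sm_pd e sf) Wp) (pd_refl e (sm_pd d sf) Wp).
  by rewrite /refl (pd_comm d e sf (slit_opp Wp)) mulrCA.
Qed.

(** The expression of [riem] for arbitrary coefficients, so that it also applies to [spray_H], which
    is not introduced through a metric. *)
Definition curv (G : 'I_n -> fn) i k p y : R :=
  2 * dx k (G i) p y
  - \sum_m dy k (dx m (G i)) p y * y 0 m
  + 2 * \sum_m G m p y * dy k (dy m (G i)) p y
  - \sum_m dy m (G i) p y * dy k (G m) p y.

Lemma curvE G i k p y : curv G i k p y =
  2 * pd (inl k) (G i) p y
  - \sum_m pd (inr k) (pd (inl m) (G i)) p y * y 0 m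
  + 2 * (\sum_m G m p y * pd (inr k) (pd (inr m) (G i)) p y)
  - \sum_m pd (inr m) (G i) p y * pd (inr k) (G m) p y.
Proof. by rewrite pd.unlock. Qed.

Lemma riem_curv (F : fn) : riem F = curv (G_spray F).
Proof. by []. Qed.

Lemma curv_ext (G H : 'I_n -> fn) i k p y : (forall j, eqW U (G j) (H j)) ->
  W p y -> curv G i k p y = curv H i k p y.
Proof.
move=> E Wp; have E1 d j := eqW_pd U_open d (E j).
have E2 e d j := eqW_pd U_open e (E1 d j).
rewrite !curvE (E1 _ _ _ _ Wp).
congr (_ - _ + 2 * _ - _); apply: eq_bigr => m _.
- by rewrite (E2 _ _ _ _ _ Wp).
- by rewrite (E2 _ _ _ _ _ Wp) (E m _ _ Wp).
- by rewrite !(E1 _ _ _ _ Wp).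
Qed.

(** In each term of [curv] the derivatives in [y] occur twice, or once together with a factor [y],
    so the signs cancel. This converts curvature at -y into curvature at y of the reflected
    spray. *)
Lemma curv_refl (G : 'I_n -> fn) i k p y : (forall j, smoothW (G j)) -> W p y ->
  curv (fun j => refl (G j)) i k p y = curv G i k p (- y).
Proof.
move=> sG Wp; rewrite !curvE pd_refl_x.
congr (_ - _ + 2 * _ - _); apply: eq_bigr => m _.
- rewrite pd_refl_x pd_refl_y //; last exact: sm_pd.
  by rewrite mxE mulrN mulNr.
- congr (_ * _).
  have E : eqW U (pd (inr m) (refl (G i))) (fun p y => - refl (pd (inr m) (G i)) p y).
    by move=> q z Wq; rewrite pd_refl_y.
  rewrite (eqW_pd U_open _ E Wp).
  have s1 : smoothW (pd (inr m) (G i)) by exact: sm_pd.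
  by rewrite (sm_pdN _ (sm_refl s1)) // pd_refl_y // opprK.
- by rewrite !pd_refl_y // mulrNN.
Qed.

(** By Euler's equation in degree 2 the first two terms of [curv] cancel on [y], and so do the last
    two. Consequently a multiple of [y] may be added to [u] without changing the curvature
    vector. *)
Lemma curv_y (G : 'I_n -> fn) i p y : (forall j, smoothW (G j)) ->
  (forall j, homog 2 (G j)) -> W p y -> \sum_k curv G i k p y * y 0 k = 0.
Proof.
move=> sG hG Wp.
have h1 := hG i p y Wp.
have h2 m := @homog_pd_x 2 (G i) m (sG i) (hG i) p y Wp.
have h3 m := @homog_pd_y 2 (G i) m (sG i) (hG i) p y Wp.
have E k : curv G i k p y * y 0 k = 2 * (pd (inl k) (G i) p y * y 0 k)
   - (\sum_m pd (inr k) (pd (inl m) (G i)) p y * y 0 m) * y 0 k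
   + 2 * ((\sum_m G m p y * pd (inr k) (pd (inr m) (G i)) p y) * y 0 k)
   - (\sum_m pd (inr m) (G i) p y * pd (inr k) (G m) p y) * y 0 k.
  by rewrite curvE; ring.
under eq_bigr => k _ do rewrite E.
rewrite !big_split /= !sumrN -!mulr_sumr.
have -> : \sum_k (\sum_m pd (inr k) (pd (inl m) (G i)) p y * y 0 m) * y 0 k =
    2 * \sum_m pd (inl m) (G i) p y * y 0 m.
  under eq_bigr => k _ do rewrite mulr_suml.
  rewrite exchange_big mulr_sumr /=; apply: eq_bigr => m _.
  rewrite mulrA -h2 mulr_suml; apply: eq_bigr => k _; ring.
have -> : \sum_k (\sum_m G m p y * pd (inr k) (pd (inr m) (G i)) p y) * y 0 k =
    \sum_m G m p y * pd (inr m) (G i) p y.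
  under eq_bigr => k _ do rewrite mulr_suml.
  rewrite exchange_big /=; apply: eq_bigr => m _.
  have -> : pd (inr m) (G i) p y = (2 - 1) * pd (inr m) (G i) p y by ring.
  by rewrite -h3 mulr_sumr; apply: eq_bigr => k _; ring.
have -> : \sum_k (\sum_m pd (inr m) (G i) p y * pd (inr k) (G m) p y) * y 0 k =
    2 * \sum_m G m p y * pd (inr m) (G i) p y.
  under eq_bigr => k _ do rewrite mulr_suml.
  rewrite exchange_big mulr_sumr /=; apply: eq_bigr => m _.
  by rewrite mulrA -(hG m p y Wp) mulr_suml; apply: eq_bigr => k _; ring.
ring.
Qed.

End SmoothCalculus.

(** * Sprays under a projective change *)

Ltac smooth_hyp := match goal with
  | H : smoothW _ _ |- _ => exact H
  | H : forall _, smoothW _ _ |- _ => exact (H _)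
  | H : forall _ _, smoothW _ _ |- _ => exact (H _ _)
  | H : forall _ _ _, smoothW _ _ |- _ => exact (H _ _ _)
  end.

Ltac sm := repeat first [ assumption | smooth_hyp | apply: sm_coord | apply: sm_sum; [assumption | intro] | match goal with
  | |- smoothW _ (pd _ _) => apply: sm_pd
  | |- smoothW _ (fun _ _ => ?c) => apply: sm_cst
  | |- smoothW _ (fun p y => _ * _) => apply: smM
  | |- smoothW _ (fun p y => _ + _) => apply: smD
  | |- smoothW _ (fun p y => - _) => apply: smN
  | |- smoothW _ (fun p y => pd ?d ?f p y) => apply: (@sm_pd _ _ _ f d)
  end ].

Section LinearFunctions.
Context {R : realType} {n : nat}.
Local Notation V := 'rV[R]_n.
Variable U : set V.
Hypothesis U_open : open U.
Local Notation W := (slit U).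
Implicit Types (p y : V) (i j k : 'I_n).

Lemma pd_y_linear (h : 'I_n -> V -> R) k p y :
  (forall j, smoothW U (fun p _ => h j p)) -> W p y ->
  pd (inr k) (fun p y => \sum_j h j p * y 0 j) p y = h k p.
Proof.
move=> sh Wp; rewrite (sm_pd_sum (U := U)) //; last by move=> ?; sm.
rewrite -[RHS](sum_delta_r k (fun j => h j p)); apply: eq_bigr => j _.
rewrite (sm_pdM (U := U)) //; last by sm.
by rewrite pd_base_y mul0r add0r pd_coord_y.
Qed.

Lemma pd_x_linear (h : 'I_n -> V -> R) k p y :
  (forall j, smoothW U (fun p _ => h j p)) -> W p y ->
  pd (inl k) (fun p y => \sum_j h j p * y 0 j) p y = \sum_j partial k (h j) p * y 0 j.
Proof.
move=> sh Wp; rewrite (sm_pd_sum (U := U)) //; last by move=> ?; sm.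
apply: eq_bigr => j _; rewrite (sm_pdM (U := U)) //; last by sm.
by rewrite pd_base_x pd_coord_x mulr0 addr0.
Qed.

Lemma homog_linear (h : 'I_n -> V -> R) : (forall j, smoothW U (fun p _ => h j p)) ->
  homog U 1 (fun p y => \sum_j h j p * y 0 j).
Proof.
move=> sh p y Wp; rewrite mul1r; apply: eq_bigr => k _.
by rewrite pd_y_linear // mulrC.
Qed.

End LinearFunctions.

Section ProjectiveChange.
Context {R : realType} {n : nat}.
Local Notation V := 'rV[R]_n.
Local Notation fn := (V -> V -> R).
Variable U : set V.
Hypothesis U_open : open U.
Implicit Types (f g : fn) (p y : V) (d e : 'I_n + 'I_n).

Local Notation W := (slit U).

(** P^2 minus the derivative of P along the spray y^m d/dx^m - 2 H^m d/dy^m. *)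
Definition Xi (H : 'I_n -> fn) (P : fn) p y : R :=
  P p y ^+ 2 - \sum_m pd (inl m) P p y * y 0 m
  + 2 * \sum_m H m p y * pd (inr m) P p y.

(** The terms mixing P with H^i or its derivatives cancel by homogeneity; every other new term
    carries the identity or a factor y^i. The coefficient [tau] stays anonymous because it
    disappears when paired with a vector orthogonal to y. *)
Lemma curv_proj (H : 'I_n -> fn) (P : fn) p y :
  (forall j, smoothW U (H j)) -> (forall j, homog U 2 (H j)) ->
  smoothW U P -> homog U 1 P -> W p y ->
  exists tau : 'I_n -> R, forall i k,
    curv (fun i p y => H i p y + P p y * y 0 i) i k p y =
    curv H i k p y + Xi H P p y * (k == i)%:R + tau k * y 0 i.
Proof.
move=> sH hH sP hP Wp.
pose G : 'I_n -> fn := fun i p y => H i p y + P p y * y 0 i.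
have sPy i : smoothW U (fun p y => P p y * y 0 i) by sm.
pose dP d := pd d P p y.
(* The witness gathers the coefficients of y^i in the expansions [S1], [S2], [S3] below. *)
exists (fun k => 2 * dP (inl k) - \sum_m pd (inr k) (pd (inl m) P) p y * y 0 m
  + 2 * (\sum_m G m p y * pd (inr k) (pd (inr m) P) p y)
  + P p y * dP (inr k) - \sum_m dP (inr m) * pd (inr k) (G m) p y) => i k.
change (curv G i k p y = curv H i k p y + Xi H P p y * (k == i)%:R
  + (2 * dP (inl k) - \sum_m pd (inr k) (pd (inl m) P) p y * y 0 m
  + 2 * (\sum_m G m p y * pd (inr k) (pd (inr m) P) p y)
  + P p y * dP (inr k) - \sum_m dP (inr m) * pd (inr k) (G m) p y) * y 0 i).
rewrite !curvE.
have Gx m : eqW U (pd (inl m) (G i)) (fun p y => pd (inl m) (H i) p y + pd (inl m) P p y * y 0 i).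
  move=> q z Wq; rewrite (sm_pdD _ (sH i) (sPy i)) // (sm_pdM _ sP (sm_coord _ i)) //.
  by rewrite pd_coord_x mulr0 addr0.
have Gy j m : eqW U (pd (inr m) (G j))
    (fun p y => pd (inr m) (H j) p y + (pd (inr m) P p y * y 0 j + P p y * (m == j)%:R)).
  move=> q z Wq; rewrite (sm_pdD _ (sH j) (sPy j)) // (sm_pdM _ sP (sm_coord _ j)) //.
  by rewrite pd_coord_y.
have Gyx m : pd (inr k) (pd (inl m) (G i)) p y = pd (inr k) (pd (inl m) (H i)) p y
   + (pd (inr k) (pd (inl m) P) p y * y 0 i + pd (inl m) P p y * (k == i)%:R).
  rewrite (eqW_pd U_open _ (Gx m) Wp) (sm_pdD (U := U)) //; [|by sm|by sm].
  by rewrite (sm_pdM (U := U)) //; [rewrite pd_coord_y|sm|sm].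
have Gyy m : pd (inr k) (pd (inr m) (G i)) p y = pd (inr k) (pd (inr m) (H i)) p y
   + (pd (inr k) (pd (inr m) P) p y * y 0 i + dP (inr m) * (k == i)%:R + dP (inr k) * (m == i)%:R).
  rewrite (eqW_pd U_open _ (Gy i m) Wp) (sm_pdD (U := U)) //; [|by sm|by sm].
  rewrite (sm_pdD (U := U)) //; [|by sm|by sm].
  rewrite (sm_pdM (U := U)) //; [|by sm|by sm]; rewrite pd_coord_y.
  rewrite (sm_pdM (U := U)) //; [|by sm].
  by rewrite (pd_cst (inr k) (m == i)%:R p y).2 mulr0 addr0.
have sd (F : 'I_n -> R) j : \sum_m F m * (m == j)%:R = F j.
  by rewrite -[RHS](sum_delta_r j F); apply: eq_bigr => m _; rewrite eq_sym.
have S1 : \sum_m pd (inr k) (pd (inl m) (G i)) p y * y 0 m =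
    (\sum_m pd (inr k) (pd (inl m) (H i)) p y * y 0 m)
  + y 0 i * (\sum_m pd (inr k) (pd (inl m) P) p y * y 0 m)
  + (k == i)%:R * (\sum_m pd (inl m) P p y * y 0 m).
  by rewrite !mulr_sumr -!big_split /=; apply: eq_bigr => m _; rewrite Gyx; ring.
have e2 : \sum_m y 0 m * dP (inr m) = P p y by rewrite hP // mul1r.
have e3 : \sum_m y 0 m * pd (inr k) (pd (inr m) (H i)) p y = pd (inr k) (H i) p y.
  rewrite -[RHS]mul1r; have -> : 1 = 2 - 1 :> R by ring.
  rewrite -(homog_pd_y U_open k (sH i) (hH i) Wp).
  by apply: eq_bigr => m _; rewrite (pd_comm (inr m) _ (sH i)).
have S2 : \sum_m G m p y * pd (inr k) (pd (inr m) (G i)) p y =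
    (\sum_m H m p y * pd (inr k) (pd (inr m) (H i)) p y)
  + P p y * pd (inr k) (H i) p y
  + y 0 i * (\sum_m G m p y * pd (inr k) (pd (inr m) P) p y)
  + (k == i)%:R * (\sum_m H m p y * dP (inr m))
  + (k == i)%:R * P p y * P p y
  + dP (inr k) * (H i p y + P p y * y 0 i).
  transitivity (\sum_m (H m p y * pd (inr k) (pd (inr m) (H i)) p y
    + P p y * (y 0 m * pd (inr k) (pd (inr m) (H i)) p y)
    + y 0 i * (G m p y * pd (inr k) (pd (inr m) P) p y)
    + (k == i)%:R * (H m p y * dP (inr m))
    + (k == i)%:R * P p y * (y 0 m * dP (inr m))
    + dP (inr k) * (G m p y * (m == i)%:R))).
    by apply: eq_bigr => m _; rewrite Gyy /G; ring.
  by rewrite !big_split /= -!mulr_sumr e3 e2 sd.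
have S3 : \sum_m pd (inr m) (G i) p y * pd (inr k) (G m) p y =
    (\sum_m pd (inr m) (H i) p y * pd (inr k) (H m) p y)
  + dP (inr k) * (2 * H i p y)
  + P p y * pd (inr k) (H i) p y
  + y 0 i * (\sum_m dP (inr m) * pd (inr k) (G m) p y)
  + P p y * pd (inr k) (G i) p y.
  transitivity (\sum_m (pd (inr m) (H i) p y * pd (inr k) (H m) p y
    + dP (inr k) * (y 0 m * pd (inr m) (H i) p y)
    + P p y * (pd (inr m) (H i) p y * (k == m)%:R)
    + y 0 i * (dP (inr m) * pd (inr k) (G m) p y)
    + P p y * (pd (inr k) (G m) p y * (m == i)%:R))).
    apply: eq_bigr => m _; rewrite (Gy i m p y Wp) -/(dP (inr m)).
    by rewrite (Gy m k p y Wp) -/(dP (inr k)); ring.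
  by rewrite !big_split /= -!mulr_sumr (hH i _ _ Wp) sd sum_delta_r.
rewrite S1 S2 S3 (Gx k p y Wp) (Gy i k p y Wp) /Xi /dP.
ring.
Qed.

End ProjectiveChange.

(** * Riemannian metrics in coordinates *)

Section IndexSums.
Context {R : realType} {n : nat}.

Lemma sum_antisym (S : 'I_n -> 'I_n -> R) (y : 'I_n -> R) :
  (forall i j, S i j = - S j i) -> \sum_i \sum_j S i j * y i * y j = 0.
Proof.
move=> hS; set X := LHS; have : X = - X.
  rewrite {1}/X exchange_big /= -sumrN; apply: eq_bigr => i _.
  by rewrite -sumrN; apply: eq_bigr => j _; rewrite hS; ring.
lra.
Qed.

Lemma mulmx_sum3 (y : 'rV[R]_n) (A : 'M[R]_n) (z : 'rV[R]_n) :
  (y *m A *m z^T) 0 0 = \sum_i \sum_j A i j * y 0 i * z 0 j.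
Proof.
rewrite mxE exchange_big /=; apply: eq_bigr => j _; rewrite !mxE mulr_suml.
by apply: eq_bigr => i _; rewrite (mulrC (y 0 i)).
Qed.

End IndexSums.

Record metric_on {R : realType} {n : nat} (U : set 'rV[R]_n)
    (a : 'rV[R]_n -> 'M[R]_n) : Prop := MetricOn {
  mo_open : open U;
  mo_smooth : forall i j, smooth_on U (fun p => a p i j);
  mo_sym : forall p, U p -> (a p)^T = a p;
  mo_pos : forall p (y : 'rV[R]_n), U p -> y != 0 -> 0 < (y *m a p *m y^T) 0 0
}.

Section RiemannianMetric.
Context {R : realType} {n : nat}.
Local Notation V := 'rV[R]_n.
Local Notation fn := (V -> V -> R).
Variable U : set V.
Local Notation W := (slit U).
Variable a : V -> 'M[R]_n.
Hypothesis Hm : metric_on U a.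
Let U_open := mo_open Hm.
Let a_smooth := mo_smooth Hm.
Let a_sym := mo_sym Hm.
Let a_pos := mo_pos Hm.
Implicit Types (p y u v : V) (i j k l m : 'I_n).

Lemma a_symE p i j : U p -> a p i j = a p j i.
Proof. by move=> Up; rewrite -{1}(a_sym Up) mxE. Qed.

Lemma a_unit p : U p -> a p \in unitmx.
Proof.
move=> Up; rewrite -row_free_unit -kermx_eq0; apply/eqP/row_matrixP => i.
rewrite row0; apply/eqP; apply: contraT => h.
have := a_pos Up h.
suff -> : row i (kermx (a p)) *m a p = 0 by rewrite mul0mx mxE ltxx.
by rewrite -row_mul mulmx_ker row0.
Qed.

Lemma ainvK p i j : U p -> \sum_k a p i k * ainv a p k j = (i == j)%:R.
Proof.
move=> Up; have := mulmxV (a_unit Up).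
by move=> /matrixP /(_ i j); rewrite !mxE.
Qed.

Lemma ainvKr p i j : U p -> \sum_k ainv a p i k * a p k j = (i == j)%:R.
Proof.
move=> Up; have := mulVmx (a_unit Up).
by move=> /matrixP /(_ i j); rewrite !mxE.
Qed.

Lemma ainv_sym p i j : U p -> ainv a p i j = ainv a p j i.
Proof.
by move=> Up; rewrite /ainv -{1}(a_sym Up) -trmx_inv mxE.
Qed.

Lemma lower_raise p l (F : 'I_n -> R) : U p ->
  \sum_i a p l i * (\sum_k ainv a p i k * F k) = F l.
Proof.
move=> Up; under eq_bigr => i _ do rewrite mulr_sumr.
rewrite exchange_big /= -[RHS](sum_delta_l l F); apply: eq_bigr => k _.
by rewrite -(ainvK _ _ Up) mulr_suml; apply: eq_bigr => i _; rewrite mulrA.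
Qed.

Lemma raise_lower p l (F : 'I_n -> R) : U p ->
  \sum_i ainv a p l i * (\sum_k a p i k * F k) = F l.
Proof.
move=> Up; under eq_bigr => i _ do rewrite mulr_sumr.
rewrite exchange_big /= -[RHS](sum_delta_l l F); apply: eq_bigr => k _.
by rewrite -(ainvKr _ _ Up) mulr_suml; apply: eq_bigr => i _; rewrite mulrA.
Qed.

Lemma sm_a i j : smoothW U (fun p _ => a p i j).
Proof. exact: sm_base. Qed.

Lemma sm_partial k (h : V -> R) : smoothW U (fun p _ => h p) ->
  smoothW U (fun p _ => partial k h p).
Proof. by move=> sh; rewrite -pd_base_x; exact: sm_pd. Qed.

Lemma sm_det (N : nat) (B : V -> 'M[R]_N) :
  (forall r c, smoothW U (fun p _ => B p r c)) -> smoothW U (fun p _ => \det (B p)).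
Proof.
move=> sB; apply: sm_sum => // s; apply: smM => //; first exact: sm_cst.
by apply: sm_prod => // r; exact: sB.
Qed.

(** Cramer's rule writes the inverse through determinants, that is through sums and products of
    smooth entries and the inverse of a nonvanishing function. *)
Lemma sm_ainv i j : smoothW U (fun p _ => ainv a p i j).
Proof.
apply: (@sm_ext _ _ _ U_open (fun p _ => (\det (a p))^-1 * ((-1) ^+ (j + i) * \det (row' j (col' i (a p)))))).
  move=> p y [Up _]; rewrite /ainv /invmx a_unit // !mxE /cofactor //.
apply: smM => //.
  apply: smV => //; last exact: sm_det sm_a.
  by move=> p y [Up _]; rewrite -unitfE -unitmxE a_unit.
apply: smM => //; first exact: sm_cst.
by apply: sm_det => r c; apply: sm_ext (sm_a (lift j r) (lift i c)) => // p y _; rewrite !mxE.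
Qed.

Lemma partial_near k (g h : V -> R) p : (forall q, U q -> g q = h q) -> U p ->
  partial k g p = partial k h p.
Proof.
move=> E Up; apply: near_eq_derive; near=> q; apply: E.
by near: q; exact: open_nbhs_nbhs.
Unshelve. all: by end_near. Qed.

Lemma partial_a_sym k i j p : U p ->
  partial k (fun q => a q i j) p = partial k (fun q => a q j i) p.
Proof. by move=> Up; apply: partial_near Up => q; exact: a_symE. Qed.

Lemma christoffel_sym k i j p : U p -> christoffel a k i j p = christoffel a k j i p.
Proof.
move=> Up; rewrite /christoffel; congr (_ * _); apply: eq_bigr => l _.
by rewrite (partial_a_sym l i j Up) (addrC (partial i _ p)).
Qed.

Lemma christoffel_low l i j p : U p ->
  \sum_k a p l k * christoffel a k i j p =
  2^-1 * (partial i (fun q => a q j l) p + partial j (fun q => a q i l) p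
     - partial l (fun q => a q i j) p).
Proof.
move=> Up; rewrite -(lower_raise l (fun l => partial i (fun q => a q j l) p
  + partial j (fun q => a q i l) p - partial l (fun q => a q i j) p) Up).
rewrite mulr_sumr; apply: eq_bigr => k _; rewrite /christoffel; ring.
Qed.

Lemma metric_compat k i j p : U p -> partial k (fun q => a q i j) p =
  \sum_l (a p i l * christoffel a l j k p + a p j l * christoffel a l i k p).
Proof.
move=> Up; rewrite big_split /= !christoffel_low //.
rewrite (partial_a_sym j k i Up) (partial_a_sym k j i Up) (partial_a_sym i k j Up).
lra.
Qed.

Lemma sm_christoffel k i j : smoothW U (fun p _ => christoffel a k i j p).
Proof.
have sa := sm_a; have si := sm_ainv.
apply: smM => //; first exact: sm_cst.
apply: sm_sum => // l; apply: smM => //.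
by apply: smB => //; [apply: smD => //|]; apply: sm_partial.
Qed.

Definition normsq p y : R := \sum_i \sum_j a p i j * y 0 i * y 0 j.

Definition lowered l : fn := fun p y => \sum_j a p l j * y 0 j.

Lemma normsq_lowered p y : normsq p y = \sum_i y 0 i * lowered i p y.
Proof.
apply: eq_bigr => i _; rewrite mulr_sumr; apply: eq_bigr => j _; ring.
Qed.

Lemma normsq_gt0 p y : W p y -> 0 < normsq p y.
Proof. by case=> Up y0; rewrite /normsq -mulmx_sum3; exact: a_pos. Qed.

Lemma sm_lowered l : smoothW U (lowered l).
Proof. by have sa := sm_a; rewrite /lowered; sm. Qed.

Lemma sm_normsq : smoothW U normsq.
Proof. by have sa := sm_a; rewrite /normsq; sm. Qed.

Lemma pd_y_lowered l k p y : W p y -> pd (inr k) (lowered l) p y = a p l k.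
Proof.
move=> Wp; have sa := sm_a; rewrite /lowered (sm_pd_sum (U := U)) //; last by move=> ?; sm.
rewrite -[RHS](sum_delta_r k (fun j => a p l j)); apply: eq_bigr => j _.
rewrite (sm_pdM (U := U)) //; last by sm.
by rewrite (pd_base_y k (fun p => a p l j)) mul0r add0r pd_coord_y.
Qed.

Lemma pd_y_normsq k p y : W p y -> pd (inr k) normsq p y = 2 * lowered k p y.
Proof.
move=> Wp; have sl := sm_lowered.
have E : eqW U normsq (fun p y => \sum_i y 0 i * lowered i p y).
  by move=> q z _; exact: normsq_lowered.
rewrite (eqW_pd U_open _ E Wp) (sm_pd_sum (U := U)) //; last by move=> ?; sm.
under eq_bigr => i _.
  rewrite (sm_pdM (U := U)) //; last by sm.
  rewrite pd_coord_y pd_y_lowered //; over.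
rewrite big_split /= sum_delta_l mulr2n mulrDl mul1r; congr (_ + _).
by rewrite /lowered; apply: eq_bigr => i _; rewrite mulrC (a_symE i k Wp.1).
Qed.

Lemma pd_x_normsq k p y : W p y -> pd (inl k) normsq p y =
  \sum_i \sum_j partial k (fun q => a q i j) p * y 0 i * y 0 j.
Proof.
move=> Wp; have sa := sm_a; rewrite /normsq (sm_pd_sum (U := U)) //; last by move=> ?; sm.
apply: eq_bigr => i _; rewrite (sm_pd_sum (U := U)) //; last by move=> ?; sm.
apply: eq_bigr => j _.
rewrite (sm_pdM (U := U)) //; [|by sm|by sm].
rewrite (sm_pdM (U := U)) //; last by sm.
by rewrite pd_base_x !pd_coord_x !mulr0 !addr0.
Qed.

(** The nonlinear connection N^m_k of alpha, which is the y-derivative of the geodesic coefficients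
    [geod]. *)
Definition nonlin m k : fn := fun p y => \sum_j christoffel a m k j p * y 0 j.

Definition geod i : fn := fun p y =>
  2^-1 * \sum_k y 0 k * nonlin i k p y.

Lemma sm_nonlin m k : smoothW U (nonlin m k).
Proof. by have sc := sm_christoffel; rewrite /nonlin; sm. Qed.

Lemma sm_geod i : smoothW U (geod i).
Proof. by have sc := sm_nonlin; rewrite /geod; sm. Qed.

Lemma pd_y_nonlin m k l p y : W p y -> pd (inr l) (nonlin m k) p y = christoffel a m k l p.
Proof.
move=> Wp; have sc := sm_christoffel.
rewrite /nonlin (sm_pd_sum (U := U)) //; last by move=> ?; sm.
rewrite -[RHS](sum_delta_r l (fun j => christoffel a m k j p)); apply: eq_bigr => j _.
rewrite (sm_pdM (U := U)) //; last by sm.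
by rewrite (pd_base_y l (fun p => christoffel a m k j p)) mul0r add0r pd_coord_y.
Qed.

Lemma pd_y_geod m k p y : W p y -> pd (inr k) (geod m) p y = nonlin m k p y.
Proof.
move=> Wp; have sc := sm_nonlin.
rewrite /geod (sm_pdZ _ _ (U := U)) //; last by sm.
rewrite (sm_pd_sum (U := U)) //; last by move=> ?; sm.
under eq_bigr => i _.
  rewrite (sm_pdM (U := U)) //; last by sm.
  rewrite pd_coord_y pd_y_nonlin //; over.
rewrite big_split /= sum_delta_l.
have -> : \sum_i y 0 i * christoffel a m i k p = nonlin m k p y.
  by apply: eq_bigr => i _; rewrite (christoffel_sym _ _ _ Wp.1) mulrC.
lra.
Qed.

Lemma sum_y_nonlin m p y : \sum_k y 0 k * nonlin m k p y = 2 * geod m p y.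
Proof. by rewrite /geod mulrA divff ?mul1r // pnatr_eq0. Qed.

Lemma homog_geod m : homog U 2 (geod m).
Proof.
move=> p y Wp; rewrite -sum_y_nonlin; apply: eq_bigr => k _.
by rewrite pd_y_geod.
Qed.

Local Notation al := (alpha_of a).

Lemma sm_al : smoothW U al.
Proof. exact: sm_sqrt normsq_gt0 sm_normsq. Qed.

Lemma al_gt0 p y : W p y -> 0 < al p y.
Proof. by move=> Wp; rewrite sqrtr_gt0; exact: normsq_gt0. Qed.

Lemma al_sq p y : W p y -> al p y ^+ 2 = normsq p y.
Proof. by move=> Wp; rewrite sqr_sqrtr // ltW // normsq_gt0. Qed.

Lemma pd_al d p y : W p y -> 2 * al p y * pd d al p y = pd d normsq p y.
Proof.
move=> Wp; rewrite (sm_pd_sqrt _ normsq_gt0 sm_normsq Wp) mulrCA divff ?mulr1 //.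
by rewrite mulf_neq0 ?pnatr_eq0 // gt_eqF // al_gt0.
Qed.

Lemma pd_y_al k p y : W p y -> al p y * pd (inr k) al p y = lowered k p y.
Proof.
move=> Wp; have := pd_al (inr k) Wp; rewrite pd_y_normsq // -mulrA.
by apply: mulfI; rewrite pnatr_eq0.
Qed.

Lemma pd_yy_al k l p y : W p y ->
  al p y * pd (inr k) (pd (inr l) al) p y =
  a p l k - pd (inr k) al p y * pd (inr l) al p y.
Proof.
move=> Wp; have sa := sm_al.
have E : eqW U (fun p y => al p y * pd (inr l) al p y) (lowered l).
  by move=> q z; exact: pd_y_al.
have := eqW_pd U_open (inr k) E Wp; rewrite pd_y_lowered // => <-.
by rewrite (sm_pdM (U := U)) //; [ring|sm].
Qed.

(** Parallel transport preserves lengths: by [metric_compat] the horizontal derivative of alpha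
    vanishes. *)
Lemma al_horizontal k p y : W p y ->
  pd (inl k) al p y = \sum_m nonlin m k p y * pd (inr m) al p y.
Proof.
move=> Wp; have al0 : al p y != 0 by rewrite gt_eqF // al_gt0.
have Up := Wp.1.
apply: (@mulfI _ (2 * al p y)); first by rewrite mulf_neq0 ?pnatr_eq0.
rewrite pd_al // pd_x_normsq // mulr_sumr.
transitivity (2 * \sum_m nonlin m k p y * lowered m p y); last first.
  rewrite mulr_sumr; apply: eq_bigr => m _; rewrite -pd_y_al //; ring.
have E : \sum_i \sum_j \sum_l a p i l * christoffel a l j k p * y 0 i * y 0 j =
    \sum_m nonlin m k p y * lowered m p y.
  rewrite exchange_big /=.
  under eq_bigr => j _ do rewrite exchange_big /=.
  rewrite exchange_big /=; apply: eq_bigr => l _.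
  rewrite /nonlin mulr_suml; apply: eq_bigr => j _.
  rewrite /lowered mulr_sumr; apply: eq_bigr => i _.
  rewrite (a_symE l i Up) (christoffel_sym l j k Up); ring.
rewrite -E mulr2n mulrDl mul1r [X in _ = _ + X]exchange_big /= -big_split /=.
apply: eq_bigr => i _; rewrite -big_split /=; apply: eq_bigr => j _.
rewrite metric_compat // -big_split /= !mulr_suml; apply: eq_bigr => l _; ring.
Qed.

Lemma homog_al : homog U 1 al.
Proof.
apply: homog_sqrt normsq_gt0 sm_normsq _ => // p y Wp.
under eq_bigr => k _ do rewrite pd_y_normsq // mulrCA.
by rewrite -mulr_sumr -normsq_lowered mulr1.
Qed.

(** Contracting [al_horizontal] with y^k says that alpha is constant along its own geodesics. *)
Lemma spray_al p y : W p y ->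
  2 * \sum_i pd (inr i) al p y * geod i p y = \sum_k pd (inl k) al p y * y 0 k.
Proof.
move=> Wp; under [RHS]eq_bigr => k _ do rewrite al_horizontal // mulr_suml.
rewrite exchange_big mulr_sumr /=; apply: eq_bigr => m _.
rewrite mulrCA -sum_y_nonlin mulr_sumr; apply: eq_bigr => k _; ring.
Qed.

(** The Euler-Lagrange equation of alpha, obtained by differentiating [al_horizontal] in y^l before
    contracting. With [spray_al] it is the information about [geod] that enters the verification of
    the spray of F. *)
Lemma spray_al_y l p y : W p y ->
  2 * \sum_i pd (inr i) (pd (inr l) al) p y * geod i p y =
  \sum_k pd (inr l) (pd (inl k) al) p y * y 0 k - pd (inl l) al p y.
Proof.
move=> Wp; have sa := sm_al; have sn := sm_nonlin.
have E k : pd (inr l) (pd (inl k) al) p y = \sum_m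
   (christoffel a m k l p * pd (inr m) al p y
     + nonlin m k p y * pd (inr m) (pd (inr l) al) p y).
  have E : eqW U (pd (inl k) al) (fun p y => \sum_m nonlin m k p y * pd (inr m) al p y).
    by move=> q z; exact: al_horizontal.
  rewrite (eqW_pd U_open _ E Wp) (sm_pd_sum (U := U)) //; last by move=> ?; sm.
  apply: eq_bigr => m _; rewrite (sm_pdM (U := U)) //; last by sm.
  by rewrite pd_y_nonlin // (pd_comm (inr l) _ sa).
under [in RHS]eq_bigr => k _ do rewrite E mulr_suml.
rewrite exchange_big al_horizontal // mulr_sumr /= -sumrB; apply: eq_bigr => m _.
rewrite mulrCA -sum_y_nonlin mulr_sumr.
rewrite [X in _ - X](_ : _ = \sum_k christoffel a m k l p * pd (inr m) al p y * y 0 k); last first.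
  rewrite /nonlin mulr_suml; apply: eq_bigr => k _.
  rewrite (christoffel_sym m k l Wp.1); ring.
rewrite -sumrB; apply: eq_bigr => k _; ring.
Qed.

End RiemannianMetric.

(** * Randers metrics with a Killing form *)

Section InnerProduct.
Context {R : realType} {n : nat}.
Local Notation V := 'rV[R]_n.
Variable A : 'M[R]_n.
Hypothesis A_sym : A^T = A.
Hypothesis A_pos : forall y : V, y != 0 -> 0 < (y *m A *m y^T) 0 0.
Implicit Types (u v y : V) (c : R).

Definition ip u v : R := (u *m A *m v^T) 0 0.

Lemma ipDl u u' v : ip (u + u') v = ip u v + ip u' v.
Proof. by rewrite /ip !mulmxDl mxE. Qed.

Lemma ipZl c u v : ip (c *: u) v = c * ip u v.
Proof. by rewrite /ip -!scalemxAl mxE. Qed.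

Lemma ipC u v : ip u v = ip v u.
Proof.
rewrite /ip; have -> : v *m A *m u^T = (u *m A *m v^T)^T.
  by rewrite !trmx_mul trmxK A_sym mulmxA.
by rewrite [RHS]mxE.
Qed.

Lemma ipDr u u' v : ip v (u + u') = ip v u + ip v u'.
Proof. by rewrite ![ip v _]ipC ipDl. Qed.

Lemma ipZr c u v : ip v (c *: u) = c * ip v u.
Proof. by rewrite ![ip v _]ipC ipZl. Qed.

Lemma ip_ge0 u : 0 <= ip u u.
Proof.
have [->|u0] := eqVneq u 0; last exact/ltW/A_pos.
by rewrite /ip !mul0mx mxE.
Qed.

Lemma ip_eq0 u : ip u u = 0 -> u = 0.
Proof.
move=> h; apply/eqP; apply: contraT => /A_pos.
by rewrite -/(ip u u) h ltxx.
Qed.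

Lemma ip_lagrange u y : ip y y * ip u u - ip u y ^+ 2 =
  ip y y * ip (u - (ip u y / ip y y) *: y) (u - (ip u y / ip y y) *: y).
Proof.
have [->|y0] := eqVneq y 0; first by rewrite /ip trmx0 !mul0mx mulmx0 !mxE; ring.
have yy : ip y y != 0 by rewrite gt_eqF // A_pos.
set t := _ / _.
have -> : ip (u - t *: y) (u - t *: y) = ip u u - 2 * t * ip u y + t ^+ 2 * ip y y.
  by rewrite -scaleNr ipDl !ipDr !(ipZl, ipZr) (ipC y u); ring.
by rewrite /t; field.
Qed.

Lemma cauchy_schwarz u y : ip u y ^+ 2 <= ip y y * ip u u.
Proof. by rewrite -subr_ge0 ip_lagrange mulr_ge0 // ip_ge0. Qed.

Lemma cauchy_schwarz_eq u y : y != 0 -> ip u y ^+ 2 = ip y y * ip u u ->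
  u = (ip u y / ip y y) *: y.
Proof.
move=> y0 /eqP; rewrite eq_sym -subr_eq0 ip_lagrange mulf_eq0 gt_eqF ?A_pos //=.
by move/eqP/ip_eq0/eqP; rewrite subr_eq0 => /eqP.
Qed.

Lemma ip_sum u v : ip u v = \sum_i \sum_j A i j * u 0 i * v 0 j.
Proof. exact: mulmx_sum3. Qed.

Lemma ip_sumr u v : ip u v = \sum_i u 0 i * \sum_j A i j * v 0 j.
Proof.
rewrite ip_sum; apply: eq_bigr => i _; rewrite mulr_sumr.
by apply: eq_bigr => j _; ring.
Qed.

End InnerProduct.

Record killing_form_on {R : realType} {n : nat} (U : set 'rV[R]_n)
    (a : 'rV[R]_n -> 'M[R]_n) (b : 'rV[R]_n -> 'rV[R]_n) : Prop := KillingFormOn {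
  kf_smooth : forall i, smooth_on U (fun p => b p 0 i);
  kf_killing : forall p (k l : 'I_n), U p -> cov_b a b k l p + cov_b a b l k p = 0;
  kf_lt1 : forall p, U p -> b_norm a b p < 1
}.

(** * The candidate spray of F and its Euler-Lagrange equations *)

Section RandersMetric.
Context {R : realType} {n : nat}.
Local Notation V := 'rV[R]_n.
Local Notation fn := (V -> V -> R).
Variable U : set V.
Local Notation W := (slit U).
Variable a : V -> 'M[R]_n.
Hypothesis Hm : metric_on U a.
Variable b : V -> V.
Hypothesis Hb : killing_form_on U a b.
Let U_open := mo_open Hm.
Let a_sym := mo_sym Hm.
Let a_pos := mo_pos Hm.
Let b_killing := kf_killing Hb.
Let b_lt1 := kf_lt1 Hb.
Implicit Types (p y u v : V) (i j k l m : 'I_n).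

Local Notation al := (alpha_of a).
Local Notation be := (beta_of b).

Let Hal := sm_al Hm.
Let Hainv := sm_ainv Hm.
Let Hgeod := sm_geod Hm.
Let Hchr := sm_christoffel Hm.

Lemma s_low_antisym i j p : s_low a b i j p = - s_low a b j i p.
Proof.
by rewrite /s_low; move: (cov_b a b i j p) (cov_b a b j i p) => x z; ring.
Qed.

Lemma s_low_cov i j p : U p -> s_low a b i j p = cov_b a b i j p.
Proof.
move=> Up; rewrite /s_low; have := b_killing i j Up.
move: (cov_b a b i j p) (cov_b a b j i p) => x z; lra.
Qed.

(** The Christoffel terms cancel by symmetry, so s_{ij} is up to a factor the exterior derivative of
    beta; its closedness will be read off this form. *)
Lemma s_low_partial i j p : U p -> s_low a b i j p =
  2^-1 * (partial j (fun q => b q 0 i) p - partial i (fun q => b q 0 j) p).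
Proof.
move=> Up; rewrite /s_low /cov_b /cov1; congr (_ * _).
rewrite (eq_bigr (fun k => christoffel a k j i p * b p 0 k)); first by ring.
by move=> k _; rewrite (christoffel_sym Hm).
Qed.

Lemma sm_b i : smoothW U (fun p _ => b p 0 i).
Proof. exact: (sm_base U_open (kf_smooth Hb i)). Qed.

Lemma sm_s_low i j : smoothW U (fun p _ => s_low a b i j p).
Proof.
have sb := sm_b; have sc := Hchr.
have sd k l : smoothW U (fun p _ => partial k (fun q => b q 0 l) p).
  exact: (sm_partial k (sm_b l)).
rewrite /s_low /cov_b /cov1; sm.
Qed.

Lemma sm_s_mix i j : smoothW U (fun p _ => s_mix a b i j p).
Proof. have h1 := Hainv; have h2 := sm_s_low; rewrite /s_mix; by sm. Qed.

Lemma sm_b_up i : smoothW U (fun p _ => b_up a b i p).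
Proof. have h1 := Hainv; have h2 := sm_b; rewrite /b_up; by sm. Qed.

Lemma sm_s_one i : smoothW U (fun p _ => s_one a b i p).
Proof. have h1 := sm_b_up; have h2 := sm_s_low; rewrite /s_one; by sm. Qed.

Definition s_up0 i : fn := fun p y => \sum_j s_mix a b i j p * y 0 j.
Definition s_low0 i : fn := fun p y => \sum_j s_low a b i j p * y 0 j.
Definition s_one0 : fn := fun p y => \sum_j s_one a b j p * y 0 j.

Lemma sm_s_up0 i : smoothW U (s_up0 i).
Proof. have h := sm_s_mix; rewrite /s_up0; by sm. Qed.

Lemma sm_s_one0 : smoothW U s_one0.
Proof. have h := sm_s_one; rewrite /s_one0; by sm. Qed.

Lemma sm_be : smoothW U be.
Proof. have h := sm_b; rewrite /beta_of; by sm. Qed.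

Lemma pd_y_be k p y : W p y -> pd (inr k) be p y = b p 0 k.
Proof. by move=> Wp; rewrite (pd_y_linear U_open (h := fun j p => b p 0 j)) //; exact: sm_b. Qed.

Lemma pd_x_be k p y : W p y ->
  pd (inl k) be p y = \sum_j partial k (fun q => b q 0 j) p * y 0 j.
Proof. by move=> Wp; rewrite (pd_x_linear U_open (h := fun j p => b p 0 j)) //; exact: sm_b. Qed.

Lemma lower_s_mix l j p : U p -> \sum_i a p l i * s_mix a b i j p = s_low a b l j p.
Proof.
by move=> Up; rewrite -[RHS](lower_raise Hm l (fun k => s_low a b k j p) Up).
Qed.

Lemma lower_s_up0 l p y : U p -> \sum_i a p l i * s_up0 i p y = s_low0 l p y.
Proof.
move=> Up; rewrite /s_up0 /s_low0.
under eq_bigr => i _ do rewrite mulr_sumr.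
rewrite exchange_big /=; apply: eq_bigr => j _.
by rewrite -lower_s_mix // mulr_suml; apply: eq_bigr => i _; rewrite mulrA.
Qed.

Lemma y_s_low0 p y : \sum_i y 0 i * s_low0 i p y = 0.
Proof.
rewrite -[RHS](sum_antisym (fun i => y 0 i) (fun i j => s_low_antisym i j p)).
by apply: eq_bigr => i _; rewrite mulr_sumr; apply: eq_bigr => j _; ring.
Qed.

Lemma lowered_s_up0 p y : U p -> \sum_i lowered a i p y * s_up0 i p y = 0.
Proof.
move=> Up; rewrite -[RHS](y_s_low0 p y).
under [RHS]eq_bigr => i _ do rewrite -lower_s_up0 // mulr_sumr.
rewrite exchange_big /=; apply: eq_bigr => i _.
rewrite /lowered mulr_suml; apply: eq_bigr => j _.
by rewrite (a_symE Hm _ _ Up); ring.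
Qed.

Lemma b_s_up0 p y : U p -> \sum_i b p 0 i * s_up0 i p y = s_one0 p y.
Proof.
move=> Up; rewrite /s_up0 /s_one0.
under eq_bigr => i _ do rewrite mulr_sumr.
rewrite exchange_big /=; apply: eq_bigr => j _.
rewrite /s_one mulr_suml.
under [RHS]eq_bigr => i _ do rewrite /b_up mulr_suml mulr_suml.
under [LHS]eq_bigr => i _ do rewrite /s_mix mulr_suml mulr_sumr.
rewrite exchange_big /=; apply: eq_bigr => i _; apply: eq_bigr => k _.
by rewrite (ainv_sym Hm _ _ Up); ring.
Qed.

Definition b_vec p : V := \row_i b_up a b i p.

Definition bsq p : R := \sum_i b_up a b i p * b p 0 i.

Lemma ip_b_vec p y : U p -> ip (a p) y (b_vec p) = be p y.
Proof.
move=> Up; rewrite ip_sumr /beta_of; apply: eq_bigr => i _.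
rewrite (eq_bigr (fun j => a p i j * (\sum_k ainv a p j k * b p 0 k))); last first.
  by move=> j _; rewrite mxE.
by rewrite (lower_raise Hm i (fun k => b p 0 k) Up) mulrC.
Qed.

Lemma be_b_vec p : be p (b_vec p) = bsq p.
Proof. by apply: eq_bigr => i _; rewrite mxE mulrC. Qed.

Lemma ip_bb p : U p -> ip (a p) (b_vec p) (b_vec p) = bsq p.
Proof. by move=> Up; rewrite ip_b_vec // be_b_vec. Qed.

Lemma b_normE p : b_norm a b p = Num.sqrt (bsq p).
Proof.
rewrite /b_norm /bsq; congr Num.sqrt.
apply: eq_bigr => i _; rewrite /b_up mulr_suml; apply: eq_bigr => j _; ring.
Qed.

Lemma bsq_ge0 p : U p -> 0 <= bsq p.
Proof. by move=> Up; rewrite -ip_bb //; apply: ip_ge0 => y; exact: a_pos. Qed.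

Lemma bsq_lt1 p : U p -> bsq p < 1.
Proof.
move=> Up; have := b_lt1 Up; rewrite b_normE => h.
by rewrite -(sqr_sqrtr (bsq_ge0 Up)) expr_lt1 // sqrtr_ge0.
Qed.

Lemma ip_normsq p y : ip (a p) y y = normsq a p y.
Proof. exact: ip_sum. Qed.

Lemma ip_lowered p u y : ip (a p) u y = \sum_i u 0 i * lowered a i p y.
Proof. exact: ip_sumr. Qed.

Lemma be_sq_lt p y : W p y -> be p y ^+ 2 < al p y ^+ 2.
Proof.
move=> Wp; have [Up y0] := Wp.
rewrite (al_sq Hm Wp) -ip_b_vec // -ip_normsq.
have ap z := @a_pos p z Up.
apply: le_lt_trans (cauchy_schwarz (a_sym Up) ap y (b_vec p)) _.
by rewrite ip_bb // gtr_pMl ?bsq_lt1 // ap.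
Qed.

Lemma al_be_gt0 (e : R) p y : e ^+ 2 = 1 -> W p y -> 0 < al p y + e * be p y.
Proof.
move=> e1 Wp; have h := be_sq_lt Wp; have al0 := al_gt0 Hm Wp.
have : (e * be p y) ^+ 2 < al p y ^+ 2 by rewrite exprMn e1 mul1r.
move: (e * be p y) (al p y) al0 => x z z0 hx.
rewrite -[z + x]opprK oppr_gt0 ltNge; apply/negP => hn.
have : z ^+ 2 <= x ^+ 2 by rewrite -[x ^+ 2]sqrrN ler_sqr ?nnegrE; lra.
by rewrite leNgt hx.
Qed.

(** With e = -1 this is F at -y; both signs are treated together. *)
Definition signed_randers (e : R) : fn := fun p y => al p y + e * be p y.

Lemma sm_signed_randers e : smoothW U (signed_randers e).
Proof. have h1 := Hal; have h2 := sm_be; rewrite /signed_randers; by sm. Qed.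

Lemma homog_be : homog U 1 be.
Proof. by apply: (homog_linear U_open (h := fun j p => b p 0 j)); exact: sm_b. Qed.

Lemma homog_signed_randers e : homog U 1 (signed_randers e).
Proof.
have h1 := Hal; have h2 := sm_be.
apply: homogD => //; [by sm|exact: (homog_al Hm)|].
have := homogM (sm_cst U_open e) h2 (homog_base (U := U) (fun _ => e)) homog_be.
by rewrite add0r.
Qed.

(** Only the denominator depends on [e]: s_i is quadratic in beta and keeps its sign when beta is
    reversed. *)
Definition proj_factor (e : R) : fn := fun p y => - (al p y * s_one0 p y) * (signed_randers e p y)^-1.

Lemma signed_randers_neq0 e : e ^+ 2 = 1 -> forall p y, W p y -> signed_randers e p y != 0.
Proof. by move=> e1 p y Wp; rewrite gt_eqF // al_be_gt0. Qed.

Lemma sm_proj_factor e : e ^+ 2 = 1 -> smoothW U (proj_factor e).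
Proof.
move=> e1; have h1 := Hal; have h2 := sm_s_one0; have h3 := smV U_open (signed_randers_neq0 e1) (sm_signed_randers e).
rewrite /proj_factor; by sm.
Qed.

Lemma homog_s_one0 : homog U 1 s_one0.
Proof. by apply: (homog_linear U_open (h := s_one a b)); exact: sm_s_one. Qed.

Lemma homog_proj_factor e : e ^+ 2 = 1 -> homog U 1 (proj_factor e).
Proof.
move=> e1; have h1 := Hal; have h2 := sm_s_one0; have h3 := smV U_open (signed_randers_neq0 e1) (sm_signed_randers e).
have -> : 1 = 1 + 1 + (- 1) :> R by ring.
apply: homogM => //; first by sm.
  apply: homogN => //; first by sm.
  by apply: homogM => //; [exact: (homog_al Hm)|exact: homog_s_one0].
by apply: homogV => //; [exact: signed_randers_neq0|exact: sm_signed_randers|exact: homog_signed_randers].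
Qed.

Definition spray_H (e : R) i : fn := fun p y => geod a i p y + e * (al p y * s_up0 i p y).

Definition spray_G (e : R) i : fn := fun p y => spray_H e i p y + proj_factor e p y * y 0 i.

Lemma sm_spray_H e i : smoothW U (spray_H e i).
Proof. have h1 := Hal; have h2 := sm_s_up0; have h3 := Hgeod; rewrite /spray_H; by sm. Qed.

Lemma homog_spray_H e i : homog U 2 (spray_H e i).
Proof.
have h1 := Hal; have h2 := sm_s_up0; have h3 := Hgeod.
apply: homogD => //; [by sm|exact: (homog_geod Hm)|].
have h4 : homog U 1 (s_up0 i).
  by apply: (homog_linear U_open (h := s_mix a b i)); exact: sm_s_mix.
have h5 := homogM Hal (h2 i) (homog_al Hm) h4.
have := homogM (sm_cst U_open e) (smM U_open Hal (h2 i)) (homog_base (U := U) (fun _ => e)) h5.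
by rewrite add0r.
Qed.

Lemma sm_spray_G e i : e ^+ 2 = 1 -> smoothW U (spray_G e i).
Proof.
move=> e1; have h1 := sm_spray_H; have h2 := sm_proj_factor e1.
rewrite /spray_G; by sm.
Qed.

Lemma homog_spray_G e i : e ^+ 2 = 1 -> homog U 2 (spray_G e i).
Proof.
move=> e1; have h1 := sm_spray_H; have h2 := sm_proj_factor e1.
have h3 := homogM h2 (sm_coord U_open i) (homog_proj_factor e1) (homog_coord (U := U) i).
exact: (homogD (h1 e i) (smM U_open h2 (sm_coord U_open i)) (homog_spray_H e i) h3).
Qed.

(** Clairaut's relation: b_{i;k} y^i y^k = 0 makes beta constant along the geodesics of alpha. *)
Lemma killing_geod p y : W p y ->
  2 * \sum_i b p 0 i * geod a i p y = \sum_k pd (inl k) be p y * y 0 k.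
Proof.
move=> Wp; have Up := Wp.1.
have Z : \sum_i \sum_k cov_b a b i k p * y 0 i * y 0 k = 0.
  apply: (sum_antisym (fun i => y 0 i)) => i j; have := b_killing i j Up.
  move: (cov_b a b i j p) (cov_b a b j i p) => x z; lra.
have -> : \sum_k pd (inl k) be p y * y 0 k =
    \sum_i \sum_k partial k (fun q => b q 0 i) p * y 0 i * y 0 k.
  rewrite exchange_big /=; apply: eq_bigr => k _.
  by rewrite pd_x_be // mulr_suml.
have E : \sum_i \sum_k cov_b a b i k p * y 0 i * y 0 k =
    \sum_i \sum_k partial k (fun q => b q 0 i) p * y 0 i * y 0 k
    - \sum_i \sum_k \sum_m christoffel a m i k p * b p 0 m * y 0 i * y 0 k.
  rewrite -sumrB; apply: eq_bigr => i _; rewrite -sumrB; apply: eq_bigr => k _.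
  by rewrite /cov_b /cov1 -!mulr_suml !mulrBl.
move/eqP: E; rewrite Z eq_sym subr_eq0 => /eqP ->.
rewrite mulr_sumr.
under [RHS]eq_bigr => i _ do rewrite exchange_big /=.
rewrite [RHS]exchange_big /=; apply: eq_bigr => m _.
rewrite mulrCA -(sum_y_nonlin a) mulr_sumr; apply: eq_bigr => i _.
rewrite /nonlin !mulr_sumr; apply: eq_bigr => k _; ring.
Qed.

(** The Euler-Lagrange expression of beta is the force that bends the geodesics of F away from those
    of alpha. *)
Lemma ds_be l p y : W p y -> 2 * s_low0 l p y =
  \sum_k pd (inr l) (pd (inl k) be) p y * y 0 k - pd (inl l) be p y.
Proof.
move=> Wp; have h := sm_b; have Up := Wp.1.
rewrite pd_x_be // mulr_sumr -sumrB; apply: eq_bigr => k _.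
rewrite (pd_comm (inr l) _ sm_be) //.
have E : eqW U (pd (inr l) be) (fun p _ => b p 0 l) by move=> q z; exact: pd_y_be.
rewrite (eqW_pd U_open _ E Wp) pd_base_x s_low_partial //.
by move: (partial _ _ _) (partial _ _ _) => X Y; field.
Qed.

Lemma sum_pd_y_al_s_up0 p y : W p y -> \sum_i pd (inr i) al p y * s_up0 i p y = 0.
Proof.
move=> Wp; apply: (@mulfI _ (al p y)); first by rewrite gt_eqF // (al_gt0 Hm).
rewrite mulr0 -[RHS](lowered_s_up0 y Wp.1) mulr_sumr; apply: eq_bigr => i _.
by rewrite mulrA (pd_y_al Hm).
Qed.

(** Up to the factor alpha, the Hessian of alpha is the metric minus a term that annihilates s^i_0
    by skewness. Hence alpha s^i_0 is the correction of the spray that produces the force in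
    [ds_be]. *)
Lemma sum_pd_yy_al_s_up0 l p y : W p y ->
  al p y * \sum_i pd (inr i) (pd (inr l) al) p y * s_up0 i p y = s_low0 l p y.
Proof.
move=> Wp; have Up := Wp.1.
transitivity (\sum_i (a p l i * s_up0 i p y
    - pd (inr l) al p y * (pd (inr i) al p y * s_up0 i p y))).
  by rewrite mulr_sumr; apply: eq_bigr => i _; rewrite mulrA (pd_yy_al Hm) //; ring.
by rewrite sumrB -mulr_sumr sum_pd_y_al_s_up0 // mulr0 subr0 lower_s_up0.
Qed.

Lemma sum_pd_yy_al_y l p y : W p y ->
  \sum_i pd (inr i) (pd (inr l) al) p y * y 0 i = 0.
Proof.
move=> Wp; have := homog_pd_y U_open l Hal (homog_al Hm) Wp.
by rewrite subrr mul0r => h; rewrite -[RHS]h; apply: eq_bigr => i _; exact: mulrC.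
Qed.

Local Notation F := (randers a b).

Lemma sm_F : smoothW U F.
Proof. have h1 := Hal; have h2 := sm_be; rewrite /randers; by sm. Qed.

Lemma pd_F d p y : W p y -> pd d F p y = pd d al p y + pd d be p y.
Proof. by move=> Wp; rewrite (sm_pdD _ Hal sm_be). Qed.

Lemma pd_pd_F d e p y : W p y ->
  pd d (pd e F) p y = pd d (pd e al) p y + pd d (pd e be) p y.
Proof.
move=> Wp; have E : eqW U (pd e F) (fun p y => pd e al p y + pd e be p y).
  by move=> q z; exact: pd_F.
have h1 := Hal; have h2 := sm_be.
by rewrite (eqW_pd U_open _ E Wp) (sm_pdD (U := U)) //; sm.
Qed.

Lemma pd_yy_F k l p y : W p y ->
  pd (inr k) (pd (inr l) F) p y = pd (inr k) (pd (inr l) al) p y.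
Proof.
move=> Wp; rewrite pd_pd_F //.
have E : eqW U (pd (inr l) be) (fun p _ => b p 0 l) by move=> q z; exact: pd_y_be.
by rewrite (eqW_pd U_open _ E Wp) pd_base_y addr0.
Qed.

Lemma randers_signed : F = signed_randers 1.
Proof. by apply/funext => p; apply/funext => y; rewrite /randers /signed_randers mul1r. Qed.

Lemma F_gt0 p y : W p y -> 0 < F p y.
Proof. by move=> Wp; rewrite randers_signed; apply: al_be_gt0 => //; rewrite expr1n. Qed.

Lemma homog_F : homog U 1 F.
Proof. by rewrite randers_signed; exact: homog_signed_randers. Qed.

Lemma sum_pd_F_y p y : W p y -> \sum_i pd (inr i) F p y * y 0 i = F p y.
Proof.
move=> Wp; rewrite -[RHS]mul1r -(homog_F Wp).
by apply: eq_bigr => i _; exact: mulrC.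
Qed.

Lemma spray_G1 p y i : spray_G 1 i p y =
  geod a i p y + al p y * s_up0 i p y + proj_factor 1 p y * y 0 i.
Proof. by rewrite /spray_G /spray_H mul1r. Qed.

(** This equation dictates [proj_factor]: the correction alpha s^i_0 contributes alpha s_0 through
    b_i s^i_0 = s_0, and the product of the projective factor with F cancels it. *)
Lemma spray_F p y : W p y ->
  2 * \sum_i pd (inr i) F p y * spray_G 1 i p y = \sum_k pd (inl k) F p y * y 0 k.
Proof.
move=> Wp; have Up := Wp.1.
have -> : \sum_i pd (inr i) F p y * spray_G 1 i p y =
    \sum_i pd (inr i) al p y * geod a i p y + \sum_i b p 0 i * geod a i p y
  + al p y * (\sum_i pd (inr i) al p y * s_up0 i p y + \sum_i b p 0 i * s_up0 i p y)
  + proj_factor 1 p y * \sum_i pd (inr i) F p y * y 0 i.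
  rewrite -!big_split /= !mulr_sumr -!big_split /=; apply: eq_bigr => i _.
  rewrite spray_G1 pd_F // pd_y_be //; ring.
have -> : \sum_k pd (inl k) F p y * y 0 k =
    \sum_k pd (inl k) al p y * y 0 k + \sum_k pd (inl k) be p y * y 0 k.
  by rewrite -big_split /=; apply: eq_bigr => k _; rewrite pd_F // mulrDl.
rewrite -(spray_al Hm Wp) -killing_geod // sum_pd_y_al_s_up0 // b_s_up0 //.
rewrite sum_pd_F_y // /proj_factor -randers_signed.
by field; rewrite gt_eqF // F_gt0.
Qed.

(** Since y lies in the kernel of the Hessian, the projective term drops out and the force of beta
    is balanced by alpha s^i_0 alone. *)
Lemma spray_F_y l p y : W p y ->
  2 * \sum_i pd (inr i) (pd (inr l) F) p y * spray_G 1 i p y =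
  \sum_k pd (inr l) (pd (inl k) F) p y * y 0 k - pd (inl l) F p y.
Proof.
move=> Wp.
have -> : \sum_i pd (inr i) (pd (inr l) F) p y * spray_G 1 i p y =
    \sum_i pd (inr i) (pd (inr l) al) p y * geod a i p y
  + al p y * (\sum_i pd (inr i) (pd (inr l) al) p y * s_up0 i p y)
  + proj_factor 1 p y * \sum_i pd (inr i) (pd (inr l) al) p y * y 0 i.
  rewrite !mulr_sumr -!big_split /=; apply: eq_bigr => i _.
  rewrite spray_G1 pd_yy_F //; ring.
have -> : \sum_k pd (inr l) (pd (inl k) F) p y * y 0 k =
    \sum_k pd (inr l) (pd (inl k) al) p y * y 0 k
  + \sum_k pd (inr l) (pd (inl k) be) p y * y 0 k.
  by rewrite -big_split /=; apply: eq_bigr => k _; rewrite pd_pd_F // mulrDl.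
rewrite sum_pd_yy_al_s_up0 // sum_pd_yy_al_y // pd_F // !mulrDr (spray_al_y Hm) //.
by rewrite ds_be //; ring.
Qed.

Lemma g_fund_F i j p y : W p y -> g_fund F p y i j =
  pd (inr i) F p y * pd (inr j) F p y + F p y * pd (inr j) (pd (inr i) al) p y.
Proof.
move=> Wp; have sF := sm_F; rewrite mxE !dy_pd.
have E : eqW U (pd (inr i) (Fsq F)) (fun p y => 2 * (F p y * pd (inr i) F p y)).
  by move=> q z Wq; rewrite /Fsq (sm_pdM _ sF sF) //; ring.
rewrite (eqW_pd U_open _ E Wp) (sm_pdZ _ _ (U := U)) //; last by sm.
rewrite (sm_pdM (U := U)) //; last by sm.
by rewrite pd_yy_F //; field.
Qed.

End RandersMetric.

(** * Reduction of the flag curvature *)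

Section FlagCurvature.
Context {R : realType} {n : nat}.
Local Notation V := 'rV[R]_n.
Local Notation fn := (V -> V -> R).
Variable U : set V.
Local Notation W := (slit U).
Variable a : V -> 'M[R]_n.
Hypothesis Hm : metric_on U a.
Variable b : V -> V.
Hypothesis Hb : killing_form_on U a b.
Let U_open := mo_open Hm.
Let a_sym := mo_sym Hm.
Let a_pos := mo_pos Hm.
Implicit Types (p y u v w : V) (i j k l m : 'I_n).

Local Notation al := (alpha_of a).
Local Notation be := (beta_of b).
Local Notation F := (randers a b).
Local Notation sigma := (s_up0 a b).

Let Hal := sm_al Hm.
Let HF := sm_F Hm Hb.

Definition dal p y v : R := \sum_i pd (inr i) al p y * v 0 i.
Definition dF p y v : R := \sum_i pd (inr i) F p y * v 0 i.
Definition hess p y u v : R :=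
  \sum_i \sum_j pd (inr j) (pd (inr i) al) p y * u 0 i * v 0 j.

Lemma al_dal p y v : W p y -> al p y * dal p y v = ip (a p) v y.
Proof.
move=> Wp; rewrite (ip_lowered a) /dal mulr_sumr; apply: eq_bigr => i _.
by rewrite mulrA (pd_y_al Hm) // mulrC.
Qed.

Lemma dFE p y v : W p y -> dF p y v = dal p y v + be p v.
Proof.
move=> Wp; rewrite /dF /dal /beta_of -big_split /=; apply: eq_bigr => i _.
by rewrite (pd_F Hm Hb) // (pd_y_be Hm Hb) // mulrDl.
Qed.

Lemma dF_y p y : W p y -> dF p y y = F p y.
Proof. exact: (sum_pd_F_y Hm Hb). Qed.

Lemma sum_prod2 (f g : 'I_n -> R) u v :
  (\sum_i f i * u 0 i) * (\sum_i g i * v 0 i) =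
  \sum_i \sum_j f i * g j * u 0 i * v 0 j.
Proof.
rewrite mulr_suml; apply: eq_bigr => i _; rewrite mulr_sumr.
by apply: eq_bigr => j _; ring.
Qed.

Lemma al_hess p y u v : W p y ->
  al p y * hess p y u v = ip (a p) u v - dal p y u * dal p y v.
Proof.
move=> Wp; rewrite ip_sum /dal sum_prod2 /hess mulr_sumr -sumrB; apply: eq_bigr => i _.
rewrite mulr_sumr -sumrB; apply: eq_bigr => j _.
by rewrite !mulrA (pd_yy_al Hm) //; ring.
Qed.

Lemma dFD p y u v : dF p y (u + v) = dF p y u + dF p y v.
Proof. by rewrite /dF -big_split /=; apply: eq_bigr => i _; rewrite mxE mulrDr. Qed.

Lemma dFZ p y c u : dF p y (c *: u) = c * dF p y u.
Proof. by rewrite /dF mulr_sumr; apply: eq_bigr => i _; rewrite mxE mulrCA. Qed.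

Lemma hess_y p y u : W p y -> hess p y u y = 0.
Proof.
move=> Wp; apply: (@mulfI _ (al p y)); first by rewrite gt_eqF // (al_gt0 Hm).
rewrite mulr0 al_hess // -(al_dal u Wp).
suff -> : dal p y y = al p y by ring.
rewrite -[RHS]mul1r -(homog_al Hm Wp).
by apply: eq_bigr => i _; exact: mulrC.
Qed.

Lemma hessC p y u v : W p y -> hess p y u v = hess p y v u.
Proof.
move=> Wp; apply: (@mulfI _ (al p y)); first by rewrite gt_eqF // (al_gt0 Hm).
by rewrite !al_hess // (ipC (a_sym Wp.1)) [X in _ - X]mulrC.
Qed.

Lemma hessDr p y u v w : hess p y u (v + w) = hess p y u v + hess p y u w.
Proof.
rewrite /hess -big_split /=; apply: eq_bigr => i _; rewrite -big_split /=.
by apply: eq_bigr => j _; rewrite mxE mulrDr.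
Qed.

Lemma hessZr p y u c v : hess p y u (c *: v) = c * hess p y u v.
Proof.
rewrite /hess mulr_sumr; apply: eq_bigr => i _; rewrite mulr_sumr.
by apply: eq_bigr => j _; rewrite mxE mulrCA.
Qed.

Lemma hess_ge0 p y v : W p y -> 0 <= hess p y v v.
Proof.
move=> Wp; have al0 := al_gt0 Hm Wp.
(* Multiplied by alpha^3, the Hessian at (v, v) becomes the Gram determinant of y and v. *)
rewrite -(pmulr_rge0 _ (exprn_gt0 3 al0)).
have -> : al p y ^+ 3 * hess p y v v = ip (a p) y y * ip (a p) v v - ip (a p) v y ^+ 2.
  rewrite -(al_dal v Wp) ip_normsq -(al_sq Hm Wp) exprSr -mulrA al_hess //; ring.
by rewrite subr_ge0; apply: cauchy_schwarz; [exact: a_sym Wp.1|move=> z; exact: a_pos Wp.1].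
Qed.

Lemma hess_eq0 p y v : W p y -> hess p y v v = 0 -> exists t, v = t *: y.
Proof.
move=> Wp h; have [Up y0] := Wp.
exists (ip (a p) v y / ip (a p) y y).
apply: cauchy_schwarz_eq => //; [exact: a_sym|by move=> z; exact: a_pos|].
have := al_hess v v Wp; rewrite h mulr0 => /esym/eqP; rewrite subr_eq0 => /eqP ->.
by rewrite -(al_dal v Wp) ip_normsq -(al_sq Hm Wp); ring.
Qed.

Lemma g_prod_F p y u v : W p y ->
  g_prod F p y u v = dF p y u * dF p y v + F p y * hess p y u v.
Proof.
move=> Wp; rewrite /g_prod /dF sum_prod2 /hess mulr_sumr -big_split /=; apply: eq_bigr => i _.
rewrite mulr_sumr -big_split /=; apply: eq_bigr => j _.
by rewrite (g_fund_F Hm Hb) //; ring.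
Qed.

(** A kernel vector makes both nonnegative terms dF(v)^2 and F Hess(v, v) vanish: the second forces
    v = t y, and then dF(v) = t F forces t = 0. It ensures that [invmx] in [G_spray] is a true
    inverse. *)
Lemma g_fund_unit p y : W p y -> g_fund F p y \in unitmx.
Proof.
move=> Wp; rewrite -row_free_unit -kermx_eq0; apply/eqP/row_matrixP => r.
rewrite row0; set v := row r _.
have F0 := F_gt0 Hm Hb Wp.
have : g_prod F p y v v = 0.
  rewrite /g_prod -mulmx_sum3.
  suff -> : v *m g_fund F p y = 0 by rewrite mul0mx mxE.
  by rewrite /v -row_mul mulmx_ker row0.
rewrite g_prod_F // -expr2 => /eqP.
rewrite paddr_eq0 ?sqr_ge0 ?mulr_ge0 ?hess_ge0 ?(ltW F0) //.
rewrite sqrf_eq0 mulf_eq0 (gt_eqF F0) /= => /andP[/eqP d0 /eqP /(hess_eq0 Wp) [t vE]].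
have : t * F p y = 0 by rewrite -dF_y // -dFZ -vE.
by move/eqP; rewrite mulf_eq0 (gt_eqF F0) orbF vE => /eqP ->; rewrite scale0r.
Qed.

(** The fundamental tensor is not inverted explicitly: it is applied to the candidate, and [spray_F]
    and [spray_F_y] give the bracket in [G_spray], with the factor 4 that its definition divides
    out. *)
Lemma G_spray_F i p y : W p y -> G_spray F i p y = spray_G a b 1 i p y.
Proof.
move=> Wp; rewrite /G_spray.
have E l : \sum_k dy l (dx k (Fsq F)) p y * y 0 k - dx l (Fsq F) p y =
    4 * \sum_j g_fund F p y l j * spray_G a b 1 j p y.
  have sF := HF; rewrite !dx_pd.
  have Ex k : eqW U (pd (inl k) (Fsq F)) (fun p y => 2 * (F p y * pd (inl k) F p y)).
    by move=> q z Wq; rewrite /Fsq (sm_pdM _ sF sF) //; ring.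
  have Eyx k : pd (inr l) (pd (inl k) (Fsq F)) p y =
      2 * (pd (inr l) F p y * pd (inl k) F p y + F p y * pd (inr l) (pd (inl k) F) p y).
    rewrite (eqW_pd U_open _ (Ex k) Wp) (sm_pdZ _ _ (U := U)) //; last by sm.
    by rewrite (sm_pdM (U := U)) //; sm.
  transitivity (2 * (pd (inr l) F p y * (\sum_k pd (inl k) F p y * y 0 k)
     + F p y * (\sum_k pd (inr l) (pd (inl k) F) p y * y 0 k - pd (inl l) F p y))).
    have -> : \sum_k dy l (dx k (Fsq F)) p y * y 0 k =
        2 * (pd (inr l) F p y * \sum_k pd (inl k) F p y * y 0 k
        + F p y * \sum_k pd (inr l) (pd (inl k) F) p y * y 0 k).
      rewrite mulrDr !mulr_sumr -big_split /=; apply: eq_bigr => k _.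
      by rewrite dy_pd dx_pd Eyx; ring.
    by rewrite (Ex l) //; ring.
  rewrite -(spray_F Hm Hb Wp) -(spray_F_y Hm Hb l Wp).
  rewrite !mulr_sumr -big_split /= mulr_sumr; apply: eq_bigr => j _.
  rewrite (g_fund_F Hm Hb) // (pd_yy_F Hm Hb) //; ring.
under eq_bigr => l _ do rewrite E mulrCA.
rewrite -mulr_sumr mulrA mulVf ?mul1r ?pnatr_eq0 //.
have := mulVmx (g_fund_unit Wp) => /matrixP M.
under eq_bigr => l _ do rewrite mulr_sumr.
rewrite exchange_big /= -[RHS](sum_delta_l i (fun j => spray_G a b 1 j p y)).
apply: eq_bigr => j _; have := M i j; rewrite !mxE => <-.
by rewrite mulr_suml; apply: eq_bigr => l _; rewrite mulrA.
Qed.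

Definition curvv (G : 'I_n -> fn) p y u : V := \row_i \sum_k curv G i k p y * u 0 k.

Lemma riem_map_F p y u : W p y -> riem_map F p y u = curvv (spray_G a b 1) p y u.
Proof.
move=> Wp; apply/rowP => i; rewrite !mxE; apply: eq_bigr => k _; congr (_ * _).
by rewrite riem_curv; apply: (curv_ext U_open) => // j q z; exact: G_spray_F.
Qed.

Lemma curvvD G p y u v : curvv G p y (u + v) = curvv G p y u + curvv G p y v.
Proof.
apply/rowP => i; rewrite !mxE -big_split /=; apply: eq_bigr => k _.
by rewrite mxE mulrDr.
Qed.

Lemma curvvZ G p y c u : curvv G p y (c *: u) = c *: curvv G p y u.
Proof.
apply/rowP => i; rewrite !mxE mulr_sumr; apply: eq_bigr => k _.
by rewrite mxE mulrCA.
Qed.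

Lemma dal_orth p y u : W p y -> ip (a p) u y = 0 -> dal p y u = 0.
Proof.
move=> Wp h; apply: (@mulfI _ (al p y)); first by rewrite gt_eqF // (al_gt0 Hm).
by rewrite al_dal // h mulr0.
Qed.

(* Subtracting a multiple of [y] makes [u] orthogonal to [y] for the
   fundamental tensor, on which [g] is a multiple of [a]. *)
Lemma flag_ip p y u : W p y -> u != 0 -> ip (a p) u y = 0 ->
  ip (a p) (curvv (spray_G a b 1) p y u) u =
  flag_curvature F p y (u - (be p u / F p y) *: y) * F p y ^+ 2 * ip (a p) u u.
Proof.
move=> Wp u0 uy; have F0 := F_gt0 Hm Hb Wp; have al0 := al_gt0 Hm Wp.
have du := dal_orth Wp uy.
set u' := u - _.
have u'E : u' = u + (- (be p u / F p y)) *: y by rewrite /u' scaleNr.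
have dFu : dF p y u' = 0.
  by rewrite u'E dFD dFZ dF_y // dFE // du add0r; field; rewrite gt_eqF.
have hu w : hess p y w u' = hess p y w u.
  by rewrite u'E hessDr hessZr hess_y // mulr0 addr0.
have Ry : curvv (spray_G a b 1) p y y = 0.
  apply/rowP => i; rewrite !mxE; apply: (curv_y U_open) => //.
    by move=> j; apply: (sm_spray_G Hm Hb); rewrite expr1n.
  by move=> j; apply: (homog_spray_G Hm Hb); rewrite expr1n.
have Ru : curvv (spray_G a b 1) p y u' = curvv (spray_G a b 1) p y u.
  by rewrite u'E curvvD curvvZ Ry scaler0 addr0.
rewrite /flag_curvature riem_map_F // Ru !g_prod_F // dFu dF_y // !hess_y //.
rewrite !hu (hessC u' u) // hu.
(* For u orthogonal to y the rank-one part of the Hessian vanishes, so g reduces to (F / alpha)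
   a. *)
have hE v : hess p y v u = ip (a p) v u / al p y.
  have := al_hess v u Wp; rewrite du mulr0 subr0 => <-.
  by rewrite mulrC mulKf // gt_eqF.
rewrite !hE; have uu : ip (a p) u u != 0 by rewrite gt_eqF //; apply: a_pos Wp.1 u0.
field.
by rewrite uu !gt_eqF.
Qed.

Lemma al_opp p y : al p (- y) = al p y.
Proof.
rewrite /alpha_of; congr Num.sqrt; apply: eq_bigr => i _; apply: eq_bigr => j _.
by rewrite !mxE; ring.
Qed.

Lemma linear_opp (h : 'I_n -> R) y : \sum_i h i * (- y) 0 i = - \sum_i h i * y 0 i.
Proof. by rewrite -sumrN; apply: eq_bigr => i _; rewrite mxE mulrN. Qed.

(** alpha and [geod] are even in y, while s^i_0, s_0 and beta are odd. *)
Lemma spray_G_opp i p y : spray_G a b 1 i p (- y) = spray_G a b (-1) i p y.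
Proof.
rewrite /spray_G /spray_H /proj_factor /signed_randers al_opp.
have -> : geod a i p (- y) = geod a i p y.
  rewrite /geod; congr (_ * _); apply: eq_bigr => k _.
  by rewrite /nonlin linear_opp mxE mulrNN.
have -> : sigma i p (- y) = - sigma i p y by exact: linear_opp.
have -> : s_one0 a b p (- y) = - s_one0 a b p y by exact: linear_opp.
have -> : be p (- y) = - be p y by exact: linear_opp.
rewrite mxE !mulN1r !mul1r; ring.
Qed.

Lemma curvv_opp p y u : W p y ->
  curvv (spray_G a b 1) p (- y) u = curvv (spray_G a b (-1)) p y u.
Proof.
move=> Wp; apply/rowP => i; rewrite !mxE; apply: eq_bigr => k _; congr (_ * _).
have s1 j : smoothW U (spray_G a b 1 j) by apply: (sm_spray_G Hm Hb); rewrite expr1n.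
rewrite -(curv_refl U_open _ _ s1 Wp); apply: (curv_ext U_open) => // j q z _.
by rewrite /refl spray_G_opp.
Qed.

Lemma ip_curvv_proj e p y u : e ^+ 2 = 1 -> W p y -> ip (a p) u y = 0 ->
  ip (a p) (curvv (spray_G a b e) p y u) u =
  ip (a p) (curvv (spray_H a b e) p y u) u
  + Xi (spray_H a b e) (proj_factor a b e) p y * ip (a p) u u.
Proof.
move=> e1 Wp uy.
have [tau hc] := curv_proj U_open (sm_spray_H Hm Hb e) (homog_spray_H Hm Hb e)
  (sm_proj_factor Hm Hb e1) (homog_proj_factor Hm Hb e1) Wp.
have -> : curvv (spray_G a b e) p y u = curvv (spray_H a b e) p y u
    + Xi (spray_H a b e) (proj_factor a b e) p y *: u + (\sum_k tau k * u 0 k) *: y.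
  apply/rowP => i; rewrite !mxE.
  rewrite mulr_suml -[u 0 i](sum_delta_r i (fun k => u 0 k)) mulr_sumr -!big_split /=.
  apply: eq_bigr => k _; rewrite (hc i k) eq_sym; ring.
have as_ := a_sym Wp.1.
by rewrite !ipDl !ipZl (ipC as_ y) uy mulr0 addr0.
Qed.

End FlagCurvature.

(** * The part of the curvature odd in the direction *)

Section IndexAlgebra.
Context {R : realType} {n : nat}.
Implicit Types (i j k l m : 'I_n).

Section CovariantDerivative.
Variables (Gam : 'I_n -> 'I_n -> 'I_n -> R) (s : 'I_n -> 'I_n -> R).
Variable ds : 'I_n -> 'I_n -> 'I_n -> R.
Hypothesis GamC : forall m i j, Gam m i j = Gam m j i.

(** The formula of s_{lj;k} for arrays of numbers, which stand for the values of s, its partial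
    derivatives and the Christoffel symbols at one point; the identities below are pure index
    algebra in them. *)
Definition cov_idx l j k : R :=
  ds k l j - \sum_m Gam m l k * s m j - \sum_m Gam m j k * s l m.

Section Antisymmetric.
Hypothesis s_anti : forall i j, s i j = - s j i.
Hypothesis ds_anti : forall k i j, ds k i j = - ds k j i.
Hypothesis ds_cyclic : forall l j k, ds k l j + ds l j k + ds j k l = 0.

Lemma cov_idx_antisym l j k : cov_idx l j k = - cov_idx j l k.
Proof.
rewrite /cov_idx (ds_anti k j l).
have E1 : \sum_m Gam m l k * s m j = - \sum_m Gam m l k * s j m.
  by rewrite -sumrN; apply: eq_bigr => m _; rewrite (s_anti m) mulrN.
have E2 : \sum_m Gam m j k * s m l = - \sum_m Gam m j k * s l m.
  by rewrite -sumrN; apply: eq_bigr => m _; rewrite (s_anti m) mulrN.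
rewrite E1 E2; ring.
Qed.

(** A torsion-free connection may replace partial derivatives in the closedness of a 2-form: the
    Christoffel terms cancel in pairs. *)
Lemma cov_idx_cyclic l j k : cov_idx l j k + cov_idx j k l + cov_idx k l j = 0.
Proof.
rewrite /cov_idx; have := ds_cyclic l j k.
have G3 c d e : \sum_m Gam m c d * s m e = - \sum_m Gam m d c * s e m.
  by rewrite -sumrN; apply: eq_bigr => m _; rewrite s_anti mulrN GamC.
rewrite (G3 l k j) (G3 j l k) (G3 k j l).
move: (ds k l j) (ds l j k) (ds j k l) => x1 x2 x3 E.
lra.
Qed.

End Antisymmetric.

Variables (A t : 'I_n -> 'I_n -> R) (dA dt : 'I_n -> 'I_n -> 'I_n -> R).
Hypothesis AC : forall i j, A i j = A j i.
Hypothesis compat : forall k i j,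
  dA k i j = \sum_l (A i l * Gam l j k + A j l * Gam l i k).
Hypothesis lower_t : forall l j, \sum_i A l i * t i j = s l j.
Hypothesis lower_dt : forall k l j,
  ds k l j = \sum_i (dA k l i * t i j + A l i * dt k i j).

(** Lowering an index commutes with covariant differentiation, because [compat] expresses that the
    metric is parallel. *)
Lemma lower_cov_idx l j k :
  \sum_i A l i * (dt k i j + \sum_m Gam i k m * t m j - \sum_m Gam m k j * t i m)
  = cov_idx l j k.
Proof.
rewrite /cov_idx lower_dt big_split /=.
have -> : \sum_i A l i * (dt k i j + \sum_m Gam i k m * t m j - \sum_m Gam m k j * t i m) =
    \sum_i A l i * dt k i j + \sum_i \sum_m A l i * (Gam i k m * t m j)
    - \sum_m Gam m j k * s l m.
  have -> : \sum_m Gam m j k * s l m = \sum_i A l i * \sum_m Gam m k j * t i m.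
    under [RHS]eq_bigr => i _ do rewrite mulr_sumr.
    rewrite exchange_big /=; apply: eq_bigr => m _.
    rewrite -lower_t mulr_sumr; apply: eq_bigr => i _.
    by rewrite (GamC m k j); ring.
  rewrite -big_split /= -sumrB; apply: eq_bigr => i _.
  by rewrite mulrBr mulrDr -mulr_sumr.
have -> : \sum_i dA k l i * t i j = \sum_i \sum_m A l m * Gam m i k * t i j
    + \sum_m Gam m l k * s m j.
  have -> : \sum_m Gam m l k * s m j = \sum_i \sum_m A i m * Gam m l k * t i j.
    rewrite exchange_big /=; apply: eq_bigr => m _.
    rewrite -lower_t mulr_sumr; apply: eq_bigr => i _.
    by rewrite (AC m i); ring.
  rewrite -big_split /=; apply: eq_bigr => i _.
  by rewrite compat // -big_split /= mulr_suml; apply: eq_bigr => m _; ring.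
have -> : \sum_i \sum_m A l i * (Gam i k m * t m j) = \sum_i \sum_m A l m * Gam m i k * t i j.
  rewrite exchange_big /=; apply: eq_bigr => i _; apply: eq_bigr => m _.
  by rewrite (GamC m k i) mulrA.
ring.
Qed.

End CovariantDerivative.

End IndexAlgebra.

(** * Difference of the curvatures of two sprays with opposite odd parts *)

Section OddPart.
Context {R : realType} {n : nat}.
Local Notation V := 'rV[R]_n.
Local Notation fn := (V -> V -> R).
Variable U : set V.
Hypothesis U_open : open U.
Local Notation W := (slit U).
Implicit Types (p y u v w : V) (i j k l m : 'I_n).
Variables (al : fn) (G sigma : 'I_n -> fn) (Nl : 'I_n -> 'I_n -> fn).
Variables (Gam T : 'I_n -> 'I_n -> 'I_n -> V -> R) (s : 'I_n -> 'I_n -> V -> R).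
Hypothesis Hal : smoothW U al.
Hypothesis HG : forall i, smoothW U (G i).
Hypothesis Hsig : forall i, smoothW U (sigma i).
Hypothesis HNl : forall m k, smoothW U (Nl m k).
Hypothesis HGam : forall m i j, smoothW U (fun p _ => Gam m i j p).
Hypothesis HT : forall i j k, smoothW U (fun p _ => T i j k p).
Hypothesis GamC : forall m i j p, U p -> Gam m i j p = Gam m j i p.
Hypothesis NlE : forall m k p y, Nl m k p y = \sum_j Gam m k j p * y 0 j.
Hypothesis pd_y_G : forall m k p y, W p y -> pd (inr k) (G m) p y = Nl m k p y.
Hypothesis pd_y_Nl : forall m k l p y, W p y -> pd (inr l) (Nl m k) p y = Gam m k l p.
Hypothesis sum_y_Nl : forall m p y, \sum_k y 0 k * Nl m k p y = 2 * G m p y.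
Hypothesis pd_x_horizontal : forall k p y, W p y ->
  pd (inl k) al p y = \sum_m Nl m k p y * pd (inr m) al p y.
Hypothesis pd_y_sigma : forall i k p y, W p y -> pd (inr k) (sigma i) p y = s i k p.
Hypothesis hor_sigma : forall i m p y, W p y ->
  pd (inl m) (sigma i) p y - \sum_l Nl l m p y * pd (inr l) (sigma i) p y =
  \sum_j T i j m p * y 0 j - \sum_l Gam i m l p * sigma l p y.

(** The horizontal derivative of s^i_0, by [hor_sigma]: the Christoffel term of the upper index
    separates it from s^i_{0;m}. *)
Definition tau i m : fn := fun p y =>
  \sum_j T i j m p * y 0 j - \sum_l Gam i m l p * sigma l p y.

Lemma sm_tau i m : smoothW U (tau i m).
Proof. rewrite /tau; by sm. Qed.

Lemma pd_y_tau i m k p y : W p y -> pd (inr k) (tau i m) p y =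
  T i k m p - \sum_l Gam i m l p * s l k p.
Proof.
move=> Wp; rewrite (sm_pdB (U := U)) //; [|by sm|by sm].
rewrite (pd_y_linear U_open (h := fun j => T i j m)) //.
rewrite (sm_pd_sum (U := U)) //; last by move=> ?; sm.
congr (_ - _); apply: eq_bigr => l _.
rewrite (sm_pdM _ (HGam i m l) (Hsig l)) // pd_y_sigma //.
by rewrite (pd_base_y k (fun p => Gam i m l p)) mul0r add0r.
Qed.

Lemma sum_y_tau i p y : W p y -> \sum_m y 0 m * tau i m p y +
  \sum_m Nl i m p y * sigma m p y = \sum_j \sum_m T i j m p * y 0 j * y 0 m.
Proof.
move=> Wp; have Up := Wp.1.
have -> : \sum_m Nl i m p y * sigma m p y =
    \sum_m y 0 m * \sum_l Gam i m l p * sigma l p y.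
  under [RHS]eq_bigr => m _ do rewrite mulr_sumr.
  rewrite exchange_big /=; apply: eq_bigr => l _; rewrite NlE mulr_suml.
  by apply: eq_bigr => m _; rewrite (GamC i m l Up); ring.
rewrite -big_split /= exchange_big /=; apply: eq_bigr => m _.
rewrite /tau -mulrDr subrK mulr_sumr; apply: eq_bigr => j _; ring.
Qed.

Definition odd_term i : fn := fun p y => al p y * sigma i p y.

Lemma sm_odd_term i : smoothW U (odd_term i).
Proof. rewrite /odd_term; by sm. Qed.

(** Because alpha is horizontally constant, the horizontal derivative acts on [sigma] only. *)
Lemma pd_x_odd_term i m : eqW U (pd (inl m) (odd_term i))
  (fun p y => \sum_l Nl l m p y * pd (inr l) (odd_term i) p y + al p y * tau i m p y).
Proof.
move=> p y Wp; rewrite (sm_pdM _ Hal (Hsig i)) // pd_x_horizontal // /tau -hor_sigma //.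
have -> : \sum_l Nl l m p y * pd (inr l) (odd_term i) p y =
    (\sum_l Nl l m p y * pd (inr l) al p y) * sigma i p y
    + al p y * \sum_l Nl l m p y * pd (inr l) (sigma i) p y.
  rewrite mulr_suml mulr_sumr -big_split /=; apply: eq_bigr => l _.
  by rewrite (sm_pdM _ Hal (Hsig i)) //; ring.
ring.
Qed.

Lemma pd_yx_odd_term i m k p y : W p y -> pd (inr k) (pd (inl m) (odd_term i)) p y =
  \sum_l (Gam l m k p * pd (inr l) (odd_term i) p y
    + Nl l m p y * pd (inr k) (pd (inr l) (odd_term i)) p y)
  + pd (inr k) al p y * tau i m p y
  + al p y * (T i k m p - \sum_l Gam i m l p * s l k p).
Proof.
move=> Wp; have h2 := sm_odd_term; have h4 := sm_tau.
rewrite (eqW_pd U_open _ (@pd_x_odd_term i m) Wp).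
rewrite (sm_pdD (U := U)) //; [|by sm|by sm].
rewrite (sm_pdM _ Hal (h4 i m)) // pd_y_tau // addrA; congr (_ + _ + _).
rewrite (sm_pd_sum (U := U)) //; last by move=> ?; sm.
apply: eq_bigr => l _; rewrite (sm_pdM (U := U)) //; last by sm.
by rewrite pd_y_Nl.
Qed.

Definition even_odd (e : R) i : fn := fun p y => G i p y + e * (al p y * sigma i p y).

Lemma pd_even_odd e d i : eqW U (pd d (even_odd e i))
  (fun p y => pd d (G i) p y + e * pd d (odd_term i) p y).
Proof.
move=> p y Wp; have h1 := sm_odd_term.
rewrite (sm_pdD (U := U)) //; last exact: (smM U_open (sm_cst U_open e) (h1 i)).
by rewrite (sm_pdZ U_open _ _ (h1 i)).
Qed.

Lemma pd_pd_even_odd e d d' i p y : W p y -> pd d' (pd d (even_odd e i)) p y =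
  pd d' (pd d (G i)) p y + e * pd d' (pd d (odd_term i)) p y.
Proof.
move=> Wp; have h1 := sm_odd_term.
rewrite (eqW_pd U_open _ (@pd_even_odd e d i) Wp).
rewrite (sm_pdD (U := U)) //; [|by sm|by sm].
by rewrite (sm_pdZ _ _ (U := U)) //; sm.
Qed.

(** The curvature is quadratic in the spray, so the difference keeps only the terms linear in e,
    doubled. With T = s^i_{j;k} they combine into alpha (2 s^i_{0;k} - s^i_{k;0}) - alpha_{y^k}
    s^i_{0;0}. *)
Lemma curv_odd i k p y : W p y ->
  curv (even_odd 1) i k p y - curv (even_odd (-1)) i k p y =
  2 * (al p y * (2 * (\sum_j T i j k p * y 0 j) - \sum_m T i k m p * y 0 m)
    - pd (inr k) al p y * \sum_j \sum_m T i j m p * y 0 j * y 0 m).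
Proof.
move=> Wp; have Up := Wp.1; rewrite !curvE.
set Q := odd_term.
have gyy m : pd (inr k) (pd (inr m) (G i)) p y = Gam i m k p.
  have E : eqW U (pd (inr m) (G i)) (Nl i m) by move=> q z; exact: pd_y_G.
  by rewrite (eqW_pd U_open _ E Wp) pd_y_Nl.
pose e1 m := pd (inr k) (pd (inl m) (G i)) p y.
have step e : 2 * pd (inl k) (even_odd e i) p y
  - (\sum_m pd (inr k) (pd (inl m) (even_odd e i)) p y * y 0 m)
  + 2 * (\sum_m even_odd e m p y * pd (inr k) (pd (inr m) (even_odd e i)) p y)
  - \sum_m pd (inr m) (even_odd e i) p y * pd (inr k) (even_odd e m) p y =
  2 * (pd (inl k) (G i) p y + e * pd (inl k) (Q i) p y)
  - (\sum_m (e1 m + e * pd (inr k) (pd (inl m) (Q i)) p y) * y 0 m)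
  + 2 * (\sum_m (G m p y + e * Q m p y)
      * (Gam i m k p + e * pd (inr k) (pd (inr m) (Q i)) p y))
  - \sum_m (Nl i m p y + e * pd (inr m) (Q i) p y)
      * (Nl m k p y + e * pd (inr k) (Q m) p y).
  rewrite pd_even_odd //; congr (_ - _ + 2 * _ - _); apply: eq_bigr => m _.
  - by rewrite pd_pd_even_odd.
  - by rewrite pd_pd_even_odd // gyy.
  - by rewrite !pd_even_odd // !pd_y_G.
rewrite !step {step}.
(* Terms free of e, or with e^2, agree for e = 1 and e = -1; the cross terms between [G] and [Q]
   remain. *)
transitivity (2 * (2 * pd (inl k) (Q i) p y
  - (\sum_m pd (inr k) (pd (inl m) (Q i)) p y * y 0 m)
  + 2 * (\sum_m G m p y * pd (inr k) (pd (inr m) (Q i)) p y)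
  + 2 * (\sum_m Gam i m k p * Q m p y)
  - (\sum_m Nl i m p y * pd (inr k) (Q m) p y)
  - (\sum_m Nl m k p y * pd (inr m) (Q i) p y))).
  have S1 e : \sum_m (e1 m + e * pd (inr k) (pd (inl m) (Q i)) p y) * y 0 m =
      \sum_m e1 m * y 0 m + e * \sum_m pd (inr k) (pd (inl m) (Q i)) p y * y 0 m.
    by rewrite mulr_sumr -big_split /=; apply: eq_bigr => m _; ring.
  have S2 e : \sum_m (G m p y + e * Q m p y)
        * (Gam i m k p + e * pd (inr k) (pd (inr m) (Q i)) p y) =
      \sum_m G m p y * Gam i m k p
      + e * (\sum_m G m p y * pd (inr k) (pd (inr m) (Q i)) p y
             + \sum_m Gam i m k p * Q m p y)
      + e ^+ 2 * \sum_m Q m p y * pd (inr k) (pd (inr m) (Q i)) p y.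
    rewrite mulrDr !mulr_sumr -!big_split /=; apply: eq_bigr => m _; ring.
  have S3 e : \sum_m (Nl i m p y + e * pd (inr m) (Q i) p y)
        * (Nl m k p y + e * pd (inr k) (Q m) p y) =
      \sum_m Nl i m p y * Nl m k p y
      + e * (\sum_m Nl i m p y * pd (inr k) (Q m) p y
             + \sum_m Nl m k p y * pd (inr m) (Q i) p y)
      + e ^+ 2 * \sum_m pd (inr m) (Q i) p y * pd (inr k) (Q m) p y.
    rewrite mulrDr !mulr_sumr -!big_split /=; apply: eq_bigr => m _; ring.
  by rewrite !S1 !S2 !S3; ring.
(* With the horizontal derivatives written out, all derivatives of [Q] weighted by [Nl] or [G]
   cancel; the Christoffel terms left over complete [tau] to [T]. *)
rewrite (@pd_x_odd_term i k p y Wp).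
have -> : \sum_m pd (inr k) (pd (inl m) (Q i)) p y * y 0 m =
    \sum_m Nl m k p y * pd (inr m) (Q i) p y
    + 2 * (\sum_m G m p y * pd (inr k) (pd (inr m) (Q i)) p y)
    + pd (inr k) al p y * (\sum_m y 0 m * tau i m p y)
    + al p y * (\sum_m T i k m p * y 0 m - \sum_m Nl i m p y * s m k p).
  have -> : \sum_m Nl m k p y * pd (inr m) (Q i) p y =
      \sum_m (\sum_l Gam l m k p * pd (inr l) (Q i) p y) * y 0 m.
    under [RHS]eq_bigr => m _ do rewrite mulr_suml.
    rewrite exchange_big /=; apply: eq_bigr => l _; rewrite NlE mulr_suml.
    by apply: eq_bigr => m _; rewrite (GamC l m k Up); ring.
  have -> : 2 * (\sum_m G m p y * pd (inr k) (pd (inr m) (Q i)) p y) =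
      \sum_m (\sum_l Nl l m p y * pd (inr k) (pd (inr l) (Q i)) p y) * y 0 m.
    under [RHS]eq_bigr => m _ do rewrite mulr_suml.
    rewrite exchange_big mulr_sumr /=; apply: eq_bigr => l _.
    rewrite mulrA -sum_y_Nl mulr_suml.
    by apply: eq_bigr => m _; ring.
  have -> : \sum_m Nl i m p y * s m k p = \sum_m (\sum_l Gam i m l p * s l k p) * y 0 m.
    under [RHS]eq_bigr => m _ do rewrite mulr_suml.
    rewrite exchange_big /=; apply: eq_bigr => l _; rewrite NlE mulr_suml.
    by apply: eq_bigr => m _; rewrite (GamC i m l Up); ring.
  rewrite -sumrB !mulr_sumr -!big_split /=; apply: eq_bigr => m _.
  by rewrite pd_yx_odd_term // big_split /=; ring.
have -> : \sum_m Nl i m p y * pd (inr k) (Q m) p y =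
    pd (inr k) al p y * (\sum_m Nl i m p y * sigma m p y)
    + al p y * (\sum_m Nl i m p y * s m k p).
  rewrite !mulr_sumr -big_split /=; apply: eq_bigr => m _.
  by rewrite (sm_pdM _ Hal (Hsig m)) // pd_y_sigma //; ring.
have -> : \sum_m Gam i m k p * Q m p y = al p y * (\sum_m Gam i k m p * sigma m p y).
  rewrite mulr_sumr; apply: eq_bigr => m _.
  by rewrite (GamC i m k Up) /Q /odd_term; ring.
rewrite -sum_y_tau // [tau i k p y]/tau; ring.
Qed.

End OddPart.

(** * Cubic forms determined by their orthogonal values *)

Section CubicForm.
Context {R : realType} {n : nat}.
Local Notation V := 'rV[R]_n.
Variable A : 'M[R]_n.
Hypothesis A_sym : A^T = A.
Hypothesis A_pos : forall y : V, y != 0 -> 0 < (y *m A *m y^T) 0 0.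
Implicit Types (i j k l m : 'I_n) (u v w y : V).

Definition cub (S : 'I_n -> 'I_n -> 'I_n -> R) u v w : R :=
  \sum_l \sum_j \sum_k S l j k * u 0 l * v 0 j * w 0 k.

Lemma cubDl S u u' v w : cub S (u + u') v w = cub S u v w + cub S u' v w.
Proof.
rewrite /cub -big_split /=; apply: eq_bigr => l _; rewrite -big_split /=.
apply: eq_bigr => j _; rewrite -big_split /=; apply: eq_bigr => k _.
by rewrite mxE; ring.
Qed.

Lemma cubZl S c u v w : cub S (c *: u) v w = c * cub S u v w.
Proof.
rewrite /cub mulr_sumr; apply: eq_bigr => l _; rewrite mulr_sumr.
apply: eq_bigr => j _; rewrite mulr_sumr; apply: eq_bigr => k _.
by rewrite mxE; ring.
Qed.

Lemma cubDr S u v w w' : cub S u v (w + w') = cub S u v w + cub S u v w'.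
Proof.
rewrite /cub -big_split /=; apply: eq_bigr => l _; rewrite -big_split /=.
apply: eq_bigr => j _; rewrite -big_split /=; apply: eq_bigr => k _.
by rewrite mxE; ring.
Qed.

Lemma cubZr S c u v w : cub S u v (c *: w) = c * cub S u v w.
Proof.
rewrite /cub mulr_sumr; apply: eq_bigr => l _; rewrite mulr_sumr.
apply: eq_bigr => j _; rewrite mulr_sumr; apply: eq_bigr => k _.
by rewrite mxE; ring.
Qed.

Lemma cub_antisym S u v w : (forall l j k, S l j k = - S j l k) ->
  cub S u v w = - cub S v u w.
Proof.
move=> hS; rewrite /cub exchange_big /= -sumrN; apply: eq_bigr => j _.
rewrite -sumrN; apply: eq_bigr => l _; rewrite -sumrN; apply: eq_bigr => k _.
by rewrite hS; ring.
Qed.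

Lemma cub_alt S u w : (forall l j k, S l j k = - S j l k) -> cub S u u w = 0.
Proof. by move=> hS; have := cub_antisym u u w hS; lra. Qed.

Lemma quadratic_zero (B : 'I_n -> 'I_n -> R) :
  (forall u, \sum_l \sum_k B l k * u 0 l * u 0 k = 0) -> forall l k, B l k = - B k l.
Proof.
move=> h l k.
have d i m : (delta_mx 0 i : V) 0 m = (i == m)%:R by rewrite mxE eqxx /= eq_sym.
have q i m : \sum_l \sum_k B l k * (delta_mx 0 i : V) 0 l * (delta_mx 0 m : V) 0 k = B i m.
  rewrite -[RHS](sum_delta_r i (fun i => B i m)); apply: eq_bigr => i' _.
  rewrite -[B i' m](sum_delta_r m (fun m => B i' m)) mulr_suml.
  by apply: eq_bigr => m' _; rewrite !d; ring.
have := h (delta_mx 0 l + delta_mx 0 k).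
have -> : \sum_l0 \sum_k0 B l0 k0 * (delta_mx 0 l + delta_mx 0 k : V) 0 l0
    * (delta_mx 0 l + delta_mx 0 k : V) 0 k0 = B l l + B k k + (B l k + B k l).
  rewrite -(q l l) -(q k k) -(q l k) -(q k l) -!big_split /=.
  apply: eq_bigr => i _; rewrite -!big_split /=; apply: eq_bigr => m _.
  by rewrite ![(_ + _ : V) _ _]mxE; ring.
rewrite -{1}(q l l) -{1}(q k k) !h; lra.
Qed.

Variable S : 'I_n -> 'I_n -> 'I_n -> R.
Hypothesis S_antisym : forall l j k, S l j k = - S j l k.
Hypothesis S_cyclic : forall l j k, S l j k + S j k l + S k l j = 0.
Hypothesis n_gt1 : (1 < n)%N.
Hypothesis S_orth : forall y, y != 0 -> exists mu, forall u,
  ip A u y = 0 -> cub S u y u = mu * ip A u u.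
Variable Ai : 'M[R]_n.
Hypothesis AAi : A *m Ai = 1%:M.

(** For S_{ljk} = A_{lk} omega_j - A_{jk} omega_l the trace over l and k is (n - 1) omega_j, whence
    the normalisation. *)
Definition omega j : R := (n%:R - 1)^-1 * \sum_l \sum_k Ai l k * S l j k.

Definition omega_at y : R := \sum_j omega j * y 0 j.

Lemma metricC i j : A i j = A j i.
Proof. by rewrite -{1}A_sym mxE. Qed.

Lemma inv_metricK : Ai *m A = 1%:M.
Proof. exact: mulmx1C. Qed.

Lemma inv_metric_sym : Ai^T = Ai.
Proof.
have : Ai^T *m A = 1%:M by rewrite -{1}A_sym -trmx_mul AAi trmx1.
by move=> h; rewrite -[RHS]mul1mx -h -mulmxA AAi mulmx1.
Qed.

Lemma inv_metricC i j : Ai i j = Ai j i.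
Proof. by rewrite -{1}inv_metric_sym mxE. Qed.

Lemma sum_inv_metricK i j : \sum_k Ai i k * A k j = (i == j)%:R.
Proof. by have := inv_metricK => /matrixP /(_ i j); rewrite !mxE. Qed.

Lemma trace_inv_metric : \sum_l \sum_k Ai l k * A l k = n%:R.
Proof.
transitivity (\sum_(l < n) (1 : R)); last by rewrite sumr_const card_ord.
apply: eq_bigr => l _; have -> : 1 = (l == l)%:R :> R by rewrite eqxx.
by rewrite -sum_inv_metricK; apply: eq_bigr => k _; rewrite metricC.
Qed.

Lemma sum_inv_metric_low (f : 'I_n -> R) y :
  \sum_l \sum_k Ai l k * (\sum_j A k j * y 0 j) * f l = \sum_l f l * y 0 l.
Proof.
apply: eq_bigr => l _; rewrite -mulr_suml mulrC; congr (_ * _).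
under eq_bigr => k _ do rewrite mulr_sumr.
rewrite exchange_big /= -[RHS](sum_delta_l l (fun j => y 0 j)).
apply: eq_bigr => j _; rewrite -sum_inv_metricK mulr_suml.
by apply: eq_bigr => k _; rewrite mulrA.
Qed.

(** Inserting the orthogonal projection of an arbitrary u and clearing the denominator makes the
    condition polynomial in u, so that it can be polarised and traced. *)
Lemma orth_expand y mu u : y != 0 ->
  (forall u, ip A u y = 0 -> cub S u y u = mu * ip A u u) ->
  ip A y y * cub S u y u - ip A u y * cub S u y y =
  mu * (ip A y y * ip A u u - ip A u y ^+ 2).
Proof.
move=> y0 h; have yy : ip A y y != 0 by rewrite gt_eqF // A_pos.
rewrite ip_lagrange //; set t := ip A u y / ip A y y.
have uE : u - t *: y = u + (- t) *: y by rewrite scaleNr.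
have o : ip A (u - t *: y) y = 0.
  by rewrite uE ipDl ipZl /t; field.
have := h _ o.
have -> : cub S (u - t *: y) y (u - t *: y) = cub S u y u - t * cub S u y y.
  rewrite uE cubDl cubZl cub_alt // mulr0 addr0 cubDr cubZr; ring.
move=> E; rewrite mulrCA -E /t; field.
exact: yy.
Qed.

(** The trace over u of the quadratic identity for fixed y reads |y|^2 (n - 1) omega(y) = mu |y|^2
    (n - 1). So [mu], which came from the curvature without any linearity in y, is linear. *)
Lemma mu_omega y mu : y != 0 ->
  (forall u, ip A u y = 0 -> cub S u y u = mu * ip A u u) -> mu = omega_at y.
Proof.
move=> y0 h; set N := ip A y y.
have N0 : N != 0 by rewrite gt_eqF // A_pos.
have n1 : (n%:R - 1 : R) != 0 by rewrite subr_eq0 (eqr_nat R n 1) gtn_eqF.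
pose low l := \sum_j A l j * y 0 j.
pose D l k := \sum_j S l j k * y 0 j.
pose C l := \sum_k D l k * y 0 k.
pose B l k := N * D l k - low k * C l - mu * (N * A l k - low l * low k).
have ipE u : ip A u y = \sum_l u 0 l * low l by rewrite ip_sumr.
have c1 u w : cub S u y w = \sum_l \sum_k D l k * u 0 l * w 0 k.
  apply: eq_bigr => l _; rewrite exchange_big /=; apply: eq_bigr => k _.
  by rewrite /D !mulr_suml; apply: eq_bigr => j _; ring.
have c2 u : cub S u y y = \sum_l u 0 l * C l.
  rewrite c1; apply: eq_bigr => l _; rewrite /C mulr_sumr.
  by apply: eq_bigr => k _; ring.
have pr (f g : 'I_n -> R) (u : V) : (\sum_l u 0 l * f l) * (\sum_k u 0 k * g k) =
    \sum_l \sum_k f l * g k * u 0 l * u 0 k.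
  rewrite mulr_suml; apply: eq_bigr => l _; rewrite mulr_sumr.
  by apply: eq_bigr => k _; ring.
have hB u : \sum_l \sum_k B l k * u 0 l * u 0 k = 0.
  have := orth_expand u y0 h; rewrite -/N => /eqP; rewrite -subr_eq0 => /eqP E.
  have -> : \sum_l \sum_k B l k * u 0 l * u 0 k =
      N * (\sum_l \sum_k D l k * u 0 l * u 0 k)
      - (\sum_l u 0 l * C l) * (\sum_l u 0 l * low l)
      - mu * (N * (\sum_l \sum_k A l k * u 0 l * u 0 k)
              - (\sum_l u 0 l * low l) * (\sum_l u 0 l * low l)).
    rewrite !pr !mulr_sumr -!sumrB mulr_sumr -!sumrB; apply: eq_bigr => l _.
    rewrite !mulr_sumr -!sumrB mulr_sumr -!sumrB; apply: eq_bigr => k _; rewrite /B; ring.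
  by rewrite -[RHS]E c1 c2 (ipE u) ip_sum; ring.
(* A vanishing quadratic form has skew coefficients, and these have no trace against the symmetric
   inverse metric. *)
have tr : \sum_l \sum_k Ai l k * B l k = 0.
  have anti := quadratic_zero hB.
  set X := LHS; have : X = - X; last by lra.
  rewrite {1}/X exchange_big /= -sumrN; apply: eq_bigr => k _; rewrite -sumrN.
  by apply: eq_bigr => l _; rewrite anti inv_metricC mulrN.
have t1 : \sum_l \sum_k Ai l k * D l k = (n%:R - 1) * omega_at y.
  rewrite /omega_at mulr_sumr.
  under [RHS]eq_bigr => j _ do rewrite /omega mulrA mulrA divff // mul1r mulr_suml.
  rewrite [RHS]exchange_big /=; apply: eq_bigr => l _.
  under [RHS]eq_bigr => j _ do rewrite mulr_suml.
  rewrite [RHS]exchange_big /=; apply: eq_bigr => k _; rewrite /D mulr_sumr.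
  by apply: eq_bigr => j _; ring.
have t2 : \sum_l \sum_k Ai l k * low k * C l = 0.
  rewrite sum_inv_metric_low; under eq_bigr => l _ do rewrite mulrC.
  by rewrite -c2 cub_alt.
have t3 : \sum_l \sum_k Ai l k * low k * low l = N.
  rewrite sum_inv_metric_low /N ip_sumr; apply: eq_bigr => l _; rewrite mulrC.
  by [].
have E : \sum_l \sum_k Ai l k * B l k =
    N * (\sum_l \sum_k Ai l k * D l k) - \sum_l \sum_k Ai l k * low k * C l
    - mu * (N * (\sum_l \sum_k Ai l k * A l k) - \sum_l \sum_k Ai l k * low k * low l).
  rewrite !mulr_sumr -!sumrB mulr_sumr -!sumrB; apply: eq_bigr => l _.
  rewrite !mulr_sumr -!sumrB mulr_sumr -!sumrB; apply: eq_bigr => k _; rewrite /B; ring.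
move: E; rewrite tr t1 t2 t3 trace_inv_metric => E.
apply: (@mulfI _ (N * (n%:R - 1))); first by rewrite mulf_neq0.
by apply/eqP; rewrite -subr_eq0 -oppr_eq0 E; apply/eqP; ring.
Qed.

Definition cubic_defect l j k : R := S l j k - (A l k * omega j - A j k * omega l).

Lemma cubic_defect_antisym l j k : cubic_defect l j k = - cubic_defect j l k.
Proof. by rewrite /cubic_defect (S_antisym l); ring. Qed.

Lemma cubic_defect_cyclic l j k : cubic_defect l j k + cubic_defect j k l + cubic_defect k l j = 0.
Proof.
rewrite /cubic_defect (metricC k l) (metricC j l) (metricC k j); have := S_cyclic l j k.
move: (S l j k) (S j k l) (S k l j) => x z t E.
have -> : x = - z - t by lra.
ring.
Qed.

Lemma cub_defect u v w : cub cubic_defect u v w =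
  cub S u v w - (ip A u w * omega_at v - ip A v w * omega_at u).
Proof.
have -> : ip A u w * omega_at v =
    \sum_l \sum_j \sum_k A l k * omega j * u 0 l * v 0 j * w 0 k.
  rewrite ip_sum /omega_at mulr_suml; apply: eq_bigr => l _.
  rewrite mulr_sumr; apply: eq_bigr => j _; rewrite mulr_suml.
  by apply: eq_bigr => k _; ring.
have -> : ip A v w * omega_at u =
    \sum_l \sum_j \sum_k A j k * omega l * u 0 l * v 0 j * w 0 k.
  rewrite ip_sum /omega_at mulrC mulr_suml; apply: eq_bigr => l _.
  rewrite mulr_sumr; apply: eq_bigr => j _; rewrite mulr_sumr.
  by apply: eq_bigr => k _; ring.
rewrite /cub -!sumrB; apply: eq_bigr => l _; rewrite -!sumrB; apply: eq_bigr => j _.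
rewrite -!sumrB; apply: eq_bigr => k _; rewrite /cubic_defect; ring.
Qed.

(** Once mu = omega(y), the part subtracted in the defect accounts exactly for the right-hand side
    of [orth_expand]. *)
Lemma cub_defect_yy y u : y != 0 -> ip A y y * cub cubic_defect u y u = ip A u y * cub cubic_defect u y y.
Proof.
move=> y0; have [mu h] := S_orth y0.
have := orth_expand u y0 h; rewrite (mu_omega y0 h) => /eqP; rewrite -subr_eq0 => /eqP E.
rewrite !cub_defect (ipC A_sym y u).
by apply/eqP; rewrite -subr_eq0; apply/eqP; rewrite -[RHS]E; ring.
Qed.

(** Using [cub_defect_yy] for (u, y) and for (y, u) multiplies the value by the Gram determinant of
    u and y. If that determinant vanishes, u is a multiple of y and skewness suffices. *)
Lemma cub_defect_eq0 u y : cub cubic_defect u y u = 0.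
Proof.
have z w v : cub cubic_defect w w v = 0 by apply: cub_alt; exact: cubic_defect_antisym.
have [->|y0] := eqVneq y 0.
  by rewrite (cub_antisym _ _ _ cubic_defect_antisym) -(scale0r u) cubZl z mulr0 oppr0.
have [->|u0] := eqVneq u 0; first by rewrite -{1}(scale0r y) cubZl z mulr0.
have e1 := cub_defect_yy u y0; have e2 := cub_defect_yy y u0.
rewrite (cub_antisym y u y cubic_defect_antisym) (cub_antisym y u u cubic_defect_antisym) (ipC A_sym y u) in e2.
have e3 : (ip A y y * ip A u u - ip A u y ^+ 2) * cub cubic_defect u y u = 0.
  have -> : (ip A y y * ip A u u - ip A u y ^+ 2) * cub cubic_defect u y u =
    ip A u u * (ip A y y * cub cubic_defect u y u) + ip A u y * (ip A u y * - cub cubic_defect u y u) by ring.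
  by rewrite e1 -e2; ring.
move/eqP: e3; rewrite mulf_eq0 => /orP[|/eqP //]; rewrite subr_eq0 eq_sym => /eqP.
move/(cauchy_schwarz_eq A_sym A_pos y0) => ->.
by rewrite cubZl z mulr0.
Qed.

(** The defect is skew in its first two indices and, by polarisation, in its outer two. It is
    therefore invariant under cyclic shifts, and the cyclic identity says that three times it is
    zero. *)
Lemma cubic_form l j k : S l j k = A l k * omega j - A j k * omega l.
Proof.
have swap i m : forall c, cubic_defect i c m = - cubic_defect m c i.
  move=> c; apply: (quadratic_zero (B := fun l k => cubic_defect l c k)) => u.
  rewrite -[RHS](cub_defect_eq0 u (delta_mx 0 c)) /cub; apply: eq_bigr => l' _.
  rewrite exchange_big /=; apply: eq_bigr => k' _.
  rewrite -[cubic_defect l' c k'](sum_delta_r c (fun c => cubic_defect l' c k')) !mulr_suml.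
  by apply: eq_bigr => c' _; rewrite mxE eqxx /= (eq_sym c'); ring.
apply/eqP; rewrite -subr_eq0; apply/eqP; rewrite -/(cubic_defect l j k).
have h1 : cubic_defect l j k = cubic_defect k l j by rewrite cubic_defect_antisym swap opprK.
have h2 : cubic_defect j k l = cubic_defect k l j by rewrite swap cubic_defect_antisym opprK.
by have := cubic_defect_cyclic l j k; rewrite h1 h2; lra.
Qed.

End CubicForm.

(** * Covariant derivatives of a Killing form *)

Section KillingIndexAlgebra.
Context {R : realType} {n : nat}.
Implicit Types (i j k l m : 'I_n).
Variables (Gam : 'I_n -> 'I_n -> 'I_n -> R) (s : 'I_n -> 'I_n -> R).
Variable ds : 'I_n -> 'I_n -> 'I_n -> R.
Variables (A t : 'I_n -> 'I_n -> R) (dA : 'I_n -> 'I_n -> 'I_n -> R).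
Variables (B bb : 'I_n -> R) (dB db : 'I_n -> 'I_n -> R).
Hypothesis s_anti : forall i j, s i j = - s j i.
Hypothesis AC : forall i j, A i j = A j i.
Hypothesis A_inj : forall f g : 'I_n -> R,
  (forall k, \sum_l A k l * f l = \sum_l A k l * g l) -> forall l, f l = g l.
Hypothesis compat : forall k i j,
  dA k i j = \sum_l (A i l * Gam l j k + A j l * Gam l i k).
Hypothesis lower_t : forall l j, \sum_i A l i * t i j = s l j.
Hypothesis lower_B : forall k, \sum_l A k l * B l = bb k.
Hypothesis dbE : forall j k, db j k = s k j + \sum_m Gam m k j * bb m.
Hypothesis db_leibniz : forall j k, db j k = \sum_l (dA j k l * B l + A k l * dB j l).

(** That is b^m_{;j} = s^m_j: [dbE] is the Killing condition b_{k;j} = s_{kj}, and after lowering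
    the index the derivative of the metric in [db_leibniz] is absorbed by [compat]. *)
Lemma dB_idx j m : dB j m = t m j - \sum_l Gam m l j * B l.
Proof.
apply: (A_inj (f := dB j) (g := fun m => t m j - \sum_l Gam m l j * B l)) => k.
have E := db_leibniz j k; rewrite dbE big_split /= in E.
have E1 : \sum_l A k l * (t l j - \sum_l0 Gam l l0 j * B l0) =
    s k j - \sum_m \sum_l A k l * Gam l m j * B m.
  rewrite exchange_big /= -lower_t -sumrB; apply: eq_bigr => l _.
  by rewrite mulrBr mulr_sumr; congr (_ - _); apply: eq_bigr => m' _; rewrite mulrA.
have E2 : \sum_l dA j k l * B l =
    \sum_m \sum_l A k l * Gam l m j * B m + \sum_m Gam m k j * bb m.
  have -> : \sum_m Gam m k j * bb m = \sum_m \sum_l A m l * Gam l k j * B m.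
    rewrite exchange_big /=; apply: eq_bigr => m' _.
    rewrite -lower_B mulr_sumr; apply: eq_bigr => l _.
    by rewrite (AC l m'); ring.
  rewrite -big_split /=; apply: eq_bigr => m' _.
  by rewrite compat mulr_suml -big_split /=; apply: eq_bigr => l _; ring.
rewrite E1; rewrite E2 in E; lra.
Qed.

(** Leibniz rule for s_i = b^m s_{mi}: the term b^m_{;j} s_{mi} equals -t_{ij} by skewness of s. *)
Lemma hessian_idx i j :
  \sum_m s i m * t m j
  + (\sum_m (dB j m * s m i + B m * ds j m i) - \sum_k Gam k i j * \sum_m B m * s m k)
  = \sum_m B m * cov_idx Gam s ds m i j.
Proof.
have -> : \sum_m B m * cov_idx Gam s ds m i j = \sum_m B m * ds j m i
    - \sum_m \sum_l B m * Gam l m j * s l i - \sum_k Gam k i j * \sum_m B m * s m k.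
  have -> : \sum_k Gam k i j * \sum_m B m * s m k = \sum_m B m * \sum_k Gam k i j * s m k.
    under eq_bigr => k _ do rewrite mulr_sumr.
    rewrite exchange_big /=; apply: eq_bigr => m _; rewrite mulr_sumr.
    by apply: eq_bigr => k _; ring.
  rewrite -!sumrB; apply: eq_bigr => m _; rewrite /cov_idx !mulrBr; congr (_ - _ - _).
  by rewrite mulr_sumr; apply: eq_bigr => l _; rewrite mulrA.
rewrite big_split /=.
have -> : \sum_m dB j m * s m i = - (\sum_m s i m * t m j)
    - \sum_m \sum_l B m * Gam l m j * s l i.
  rewrite exchange_big /= -sumrN -sumrB; apply: eq_bigr => m _.
  rewrite dB_idx mulrBl (s_anti i m) mulr_suml; congr (_ - _); first by ring.
  by apply: eq_bigr => l _; ring.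
ring.
Qed.

(** The derivative of b^2 = b^k b_k is 2 b^k b_{k;j}, and b_{k;j} = s_{kj} for a Killing form. *)
Lemma grad_bsq_idx j :
  \sum_k (dB j k * bb k + B k * db j k) = 2 * \sum_k B k * s k j.
Proof.
rewrite big_split /=.
have -> : \sum_k B k * db j k = \sum_k B k * s k j + \sum_k \sum_m B k * Gam m k j * bb m.
  rewrite -big_split /=; apply: eq_bigr => k _; rewrite dbE mulrDr mulr_sumr.
  by congr (_ + _); apply: eq_bigr => m _; rewrite mulrA.
have -> : \sum_k dB j k * bb k = \sum_k B k * s k j - \sum_k \sum_m B k * Gam m k j * bb m.
  have -> : \sum_k B k * s k j = \sum_k t k j * bb k.
    under eq_bigr => k _ do rewrite -lower_t mulr_sumr.
    rewrite exchange_big /=; apply: eq_bigr => k _; rewrite -lower_B mulr_sumr.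
    by apply: eq_bigr => l _; rewrite (AC l k); ring.
  rewrite exchange_big /= -sumrB; apply: eq_bigr => k _; rewrite dB_idx mulrBl mulr_suml.
  by congr (_ - _); apply: eq_bigr => l _; ring.
ring.
Qed.

End KillingIndexAlgebra.

Section KillingForm.
Context {R : realType} {n : nat}.
Local Notation V := 'rV[R]_n.
Variable U : set V.
Local Notation W := (slit U).
Variable a : V -> 'M[R]_n.
Hypothesis Hm : metric_on U a.
Variable b : V -> V.
Hypothesis Hb : killing_form_on U a b.
Let U_open := mo_open Hm.
Implicit Types (p y : V) (i j k l m : 'I_n).

Lemma partial_sum_mul (f g : 'I_n -> V -> R) k p y :
  (forall i, smoothW U (fun p _ => f i p)) -> (forall i, smoothW U (fun p _ => g i p)) ->
  W p y -> partial k (fun q => \sum_i f i q * g i q) p =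
  \sum_i (partial k (f i) p * g i p + f i p * partial k (g i) p).
Proof.
move=> sf sg Wp.
transitivity (pd (inl k) (fun p _ => \sum_i f i p * g i p) p y); first by rewrite pd_base_x.
rewrite (sm_pd_sum (U := U)) //; last by move=> ?; sm.
by apply: eq_bigr => i _; rewrite (sm_pdM _ (sf i) (sg i)) // !pd_base_x.
Qed.

Lemma partial_comm (f : V -> R) k l p y : smoothW U (fun p _ => f p) -> W p y ->
  partial k (partial l f) p = partial l (partial k f) p.
Proof. by move=> sf Wp; have := pd_comm (inl k) (inl l) sf Wp; rewrite !pd_base_x. Qed.

(* [cov_s p l j k] is s_{lj;k}. *)
Definition cov_s p l j k : R :=
  cov_idx (fun m i j => christoffel a m i j p) (fun i j => s_low a b i j p)
    (fun k i j => partial k (s_low a b i j) p) l j k.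

Lemma partial_s_low c d e p y : W p y -> partial e (s_low a b c d) p =
  2^-1 * (partial e (partial d (fun q => b q 0 c)) p
          - partial e (partial c (fun q => b q 0 d)) p).
Proof.
move=> Wp; have sb := sm_b Hm Hb.
have sp x z : smoothW U (fun p _ => partial x (fun q => b q 0 z) p).
  exact: (sm_partial x (sb z)).
transitivity (pd (inl e) (fun p _ => 2^-1 * (partial d (fun q => b q 0 c) p
    - partial c (fun q => b q 0 d) p)) p y).
  rewrite pd_base_x; apply: (partial_near Hm) Wp.1 => q Uq.
  exact: (s_low_partial Hm).
rewrite (sm_pdZ U_open) //; last by sm.
by rewrite (sm_pdB U_open _ (sp d c) (sp c d)) // !pd_base_x.
Qed.

Lemma partial_s_low_antisym k i j p y : W p y ->
  partial k (s_low a b i j) p = - partial k (s_low a b j i) p.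
Proof.
move=> Wp; rewrite !(partial_s_low _ _ _ Wp).
move: (partial k (partial j _) p) (partial k (partial i _) p) => x z; ring.
Qed.

Lemma cov_s_antisym p y l j k : W p y -> cov_s p l j k = - cov_s p j l k.
Proof.
move=> Wp; apply: cov_idx_antisym; first by move=> i m; exact: s_low_antisym.
by move=> i m c; exact: partial_s_low_antisym Wp.
Qed.

Lemma cov_s_cyclic p y l j k : W p y -> cov_s p l j k + cov_s p j k l + cov_s p k l j = 0.
Proof.
move=> Wp; apply: cov_idx_cyclic.
- by move=> m i c; exact: (christoffel_sym Hm) Wp.1.
- by move=> i m; exact: s_low_antisym.
move=> c d e; rewrite !(partial_s_low _ _ _ Wp).
have sb := sm_b Hm Hb.
rewrite (partial_comm e d (sb c) Wp) (partial_comm c e (sb d) Wp) (partial_comm d c (sb e) Wp).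
move: (partial d (partial e _) p) (partial e (partial c _) p) (partial c (partial d _) p) => x z t.
ring.
Qed.

Lemma lower_cov11 p y l j k : W p y ->
  \sum_i a p l i * cov11 a (s_mix a b) i j k p = cov_s p l j k.
Proof.
move=> Wp; have Up := Wp.1.
have GC m i c : christoffel a m i c p = christoffel a m c i p.
  exact: (christoffel_sym Hm).
apply: (lower_cov_idx GC (A := fun i j => a p i j) (t := fun i j => s_mix a b i j p)
  (dA := fun k i j => partial k (fun q => a q i j) p)
  (dt := fun k i j => partial k (s_mix a b i j) p)).
- by move=> i c; exact: (a_symE Hm).
- by move=> c i d; exact: (metric_compat Hm).
- by move=> c d; exact: (lower_s_mix Hm).
- move=> c d e.
  rewrite -(partial_sum_mul (f := fun i q => a q d i) (g := fun i => s_mix a b i e) c _ _ Wp).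
  + by apply: (partial_near Hm) Up => q Uq; rewrite (lower_s_mix Hm).
  + by move=> i; exact: (sm_a Hm).
  + by move=> i; exact: (sm_s_mix Hm Hb).
Qed.

Lemma lower_b_up p k : U p -> \sum_l a p k l * b_up a b l p = b p 0 k.
Proof. by move=> Up; exact: (lower_raise Hm k (fun k => b p 0 k)). Qed.

Lemma a_inj p (f g : 'I_n -> R) : U p ->
  (forall k, \sum_l a p k l * f l = \sum_l a p k l * g l) -> forall l, f l = g l.
Proof.
move=> Up E l; rewrite -(raise_lower Hm l f Up) -(raise_lower Hm l g Up).
by apply: eq_bigr => i _; rewrite E.
Qed.

Lemma partial_b p j k : U p -> partial j (fun q => b q 0 k) p =
  s_low a b k j p + \sum_m christoffel a m k j p * b p 0 m.
Proof. by move=> Up; rewrite (s_low_cov Hb) // /cov_b /cov1 subrK. Qed.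

Lemma partial_b_leibniz p y j k : W p y -> partial j (fun q => b q 0 k) p =
  \sum_l (partial j (fun q => a q k l) p * b_up a b l p + a p k l * partial j (b_up a b l) p).
Proof.
move=> Wp.
rewrite -(partial_sum_mul (f := fun l q => a q k l) (g := fun l => b_up a b l) j _ _ Wp).
- by apply: (partial_near Hm) Wp.1 => q Uq; rewrite lower_b_up.
- by move=> i; exact: (sm_a Hm).
- by move=> i; exact: (sm_b_up Hm Hb).
Qed.

Lemma partial_s_one p y i j : W p y -> partial j (s_one a b i) p =
  \sum_m (partial j (b_up a b m) p * s_low a b m i p
          + b_up a b m p * partial j (s_low a b m i) p).
Proof.
move=> Wp; apply: (partial_sum_mul (f := fun m => b_up a b m) (g := fun m => s_low a b m i) j _ _ Wp).
- by move=> m; exact: (sm_b_up Hm Hb).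
- by move=> m; exact: (sm_s_low Hm Hb).
Qed.

Lemma t_low_cov_s_one p y i j : W p y ->
  t_low a b i j p + cov1 a (s_one a b) i j p = \sum_m b_up a b m p * cov_s p m i j.
Proof.
move=> Wp; have Up := Wp.1; rewrite /t_low /cov1 (partial_s_one _ _ Wp).
exact: (@hessian_idx R n (fun m i j => christoffel a m i j p)
  (fun i j => s_low a b i j p) (fun k i j => partial k (s_low a b i j) p)
  (fun i j => a p i j) (fun i j => s_mix a b i j p)
  (fun k i j => partial k (fun q => a q i j) p)
  (fun m => b_up a b m p) (fun k => b p 0 k)
  (fun k m => partial k (b_up a b m) p) (fun j k => partial j (fun q => b q 0 k) p)
  (fun c d => s_low_antisym a b c d p) (fun c d => a_symE Hm c d Up)
  (fun f g => @a_inj p f g Up) (fun c d e => metric_compat Hm c d e Up)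
  (fun c d => lower_s_mix Hm b c d Up) (fun c => lower_b_up c Up)
  (fun c d => partial_b c d Up) (fun c d => partial_b_leibniz c d Wp) i j).
Qed.

Lemma sm_bsq : smoothW U (fun p _ => bsq a b p).
Proof.
have h1 := sm_b_up Hm Hb; have h2 := sm_b Hm Hb; rewrite /bsq; by sm.
Qed.

Lemma partial_bsq p y j : W p y -> partial j (bsq a b) p = 2 * s_one a b j p.
Proof.
move=> Wp; have Up := Wp.1.
rewrite (partial_sum_mul (f := fun k => b_up a b k) (g := fun k q => b q 0 k) j _ _ Wp).
- apply: (grad_bsq_idx (Gam := fun m i j => christoffel a m i j p)
    (s := fun i j => s_low a b i j p)
    (A := fun i j => a p i j) (t := fun i j => s_mix a b i j p)
    (dA := fun k i j => partial k (fun q => a q i j) p)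
    (bb := fun k => b p 0 k)
    (dB := fun k m => partial k (b_up a b m) p)
    (db := fun j k => partial j (fun q => b q 0 k) p)).
  + by move=> c d; exact: (a_symE Hm).
  + by move=> f g; exact: a_inj.
  + by move=> c d e; exact: (metric_compat Hm).
  + by move=> c d; exact: (lower_s_mix Hm).
  + by move=> c; exact: lower_b_up.
  + by move=> c d; exact: partial_b.
  + by move=> c d; exact: partial_b_leibniz Wp.
- by move=> m; exact: (sm_b_up Hm Hb).
- by move=> m; exact: (sm_b Hm Hb).
Qed.

(** s_i is half the differential of b^2, so s_{i;j} is half a Hessian. *)
Lemma cov_s_one_sym p y i j : W p y ->
  cov1 a (s_one a b) i j p = cov1 a (s_one a b) j i p.
Proof.
move=> Wp; have Up := Wp.1; have y0 := Wp.2.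
have D c d : partial c (s_one a b d) p = 2^-1 * partial c (partial d (bsq a b)) p.
  transitivity (pd (inl c) (fun p _ => 2^-1 * partial d (bsq a b) p) p y).
    rewrite pd_base_x; apply: (partial_near Hm) Up => q Uq.
    by rewrite (@partial_bsq q y d (conj Uq y0)) mulKf // pnatr_eq0.
  rewrite (sm_pdZ U_open _ _ (sm_partial d sm_bsq) Wp).
  by rewrite pd_base_x.
have E1 : partial j (s_one a b i) p = partial i (s_one a b j) p.
  by rewrite (D j i) (D i j) (partial_comm j i sm_bsq Wp).
have E2 : \sum_k christoffel a k i j p * s_one a b k p =
    \sum_k christoffel a k j i p * s_one a b k p.
  by apply: eq_bigr => k _; rewrite (christoffel_sym Hm k i j Up).
exact: (congr2 (fun x z => x - z) E1 E2).
Qed.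

Lemma t_low_sym p i j : U p -> t_low a b i j p = t_low a b j i p.
Proof.
move=> Up; rewrite /t_low /s_mix.
under eq_bigr => m _ do rewrite mulr_sumr.
rewrite exchange_big /=; apply: eq_bigr => k _; rewrite mulr_sumr; apply: eq_bigr => m _.
rewrite (ainv_sym Hm m k Up) (s_low_antisym a b i m) (s_low_antisym a b k j).
move: (s_low a b m i p) (s_low a b j k p) (ainv a p k m) => x z t; ring.
Qed.

(** The invariance of the exterior derivative of beta, without a Lie derivative: the cyclic identity
    rewrites the sum as b^k s_{kj;l} - b^k s_{kl;j}, a difference of two values of the symmetric
    tensor t + s_{i;j}. *)
Lemma b_cov_s p y l j : W p y -> \sum_k b_up a b k p * cov_s p l j k = 0.
Proof.
move=> Wp; have Up := Wp.1.
have E k : b_up a b k p * cov_s p l j k =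
    b_up a b k p * cov_s p k j l - b_up a b k p * cov_s p k l j.
  have := cov_s_cyclic l j k Wp; rewrite (cov_s_antisym j k l Wp).
  move: (cov_s p l j k) (cov_s p k j l) (cov_s p k l j) => x z t h.
  have -> : x = z - t by lra.
  ring.
under eq_bigr => k _ do rewrite E.
rewrite sumrB -!(t_low_cov_s_one _ _ Wp).
by rewrite (t_low_sym j l Up) (cov_s_one_sym j l Wp) subrr.
Qed.

End KillingForm.

(** * The equations in one chart *)

Section Contractions.
Context {R : realType} {n : nat}.
Local Notation V := 'rV[R]_n.
Implicit Types (i j k l m : 'I_n) (u y : V).

Lemma hor_idx (Gam dt : 'I_n -> 'I_n -> 'I_n -> R) (t : 'I_n -> 'I_n -> R) y i m :
  \sum_j dt m i j * y 0 j - \sum_l (\sum_j Gam l m j * y 0 j) * t i l =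
  \sum_j (dt m i j + \sum_l Gam i m l * t l j - \sum_l Gam l m j * t i l) * y 0 j
  - \sum_l Gam i m l * \sum_j t l j * y 0 j.
Proof.
have -> : \sum_l (\sum_j Gam l m j * y 0 j) * t i l =
    \sum_j (\sum_l Gam l m j * t i l) * y 0 j.
  under eq_bigr => l _ do rewrite mulr_suml.
  rewrite exchange_big /=; apply: eq_bigr => j _; rewrite mulr_suml.
  by apply: eq_bigr => l _; ring.
have -> : \sum_l Gam i m l * \sum_j t l j * y 0 j =
    \sum_j (\sum_l Gam i m l * t l j) * y 0 j.
  under eq_bigr => l _ do rewrite mulr_sumr.
  rewrite exchange_big /=; apply: eq_bigr => j _; rewrite mulr_suml.
  by apply: eq_bigr => l _; rewrite mulrA.
rewrite -!sumrB; apply: eq_bigr => j _; ring.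
Qed.

(** Pairing [curv_odd] with u twice: the term s^i_{k;0} gives S(u, u, y) = 0 by skewness, and the
    derivative of alpha vanishes on u. The first term remains with coefficient 2 times 2. *)
Lemma odd_contraction (A : 'I_n -> 'I_n -> R) (T S : 'I_n -> 'I_n -> 'I_n -> R)
    (al : R) (d Z : 'I_n -> R) u y :
  (forall i j, A i j = A j i) ->
  (forall l j k, \sum_i A l i * T i j k = S l j k) ->
  (forall l j k, S l j k = - S j l k) ->
  \sum_k d k * u 0 k = 0 ->
  \sum_i \sum_l A i l * (\sum_k (2 * (al * (2 * (\sum_j T i j k * y 0 j)
     - \sum_m T i k m * y 0 m) - d k * Z i)) * u 0 k) * u 0 l =
  4 * al * cub S u y u.
Proof.
move=> AC lower anti du.
have cE v w : cub S u v w =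
    \sum_i \sum_l A i l * (\sum_k \sum_j T i j k * v 0 j * w 0 k) * u 0 l.
  rewrite [RHS]exchange_big /=; apply: eq_bigr => l _.
  under [RHS]eq_bigr => i _ do rewrite mulr_sumr mulr_suml.
  rewrite [RHS]exchange_big /= exchange_big /=; apply: eq_bigr => k _.
  under [RHS]eq_bigr => i _ do rewrite mulr_sumr mulr_suml.
  rewrite [RHS]exchange_big /=; apply: eq_bigr => j _.
  rewrite -lower !mulr_suml; apply: eq_bigr => i _; rewrite (AC l i); ring.
have E i : \sum_k (2 * (al * (2 * (\sum_j T i j k * y 0 j)
     - \sum_m T i k m * y 0 m) - d k * Z i)) * u 0 k =
   4 * al * (\sum_k \sum_j T i j k * y 0 j * u 0 k)
   - 2 * al * (\sum_k \sum_j T i j k * u 0 j * y 0 k).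
  have -> : \sum_k \sum_j T i j k * u 0 j * y 0 k = \sum_k (\sum_m T i k m * y 0 m) * u 0 k.
    rewrite exchange_big /=; apply: eq_bigr => k _; rewrite mulr_suml.
    by apply: eq_bigr => m _; ring.
  transitivity (4 * al * (\sum_k \sum_j T i j k * y 0 j * u 0 k)
    - 2 * al * (\sum_k (\sum_m T i k m * y 0 m) * u 0 k)
    - 2 * Z i * \sum_k d k * u 0 k); last by rewrite du mulr0 subr0.
  rewrite !mulr_sumr -!sumrB.
  apply: eq_bigr => k _.
  have -> : \sum_j T i j k * y 0 j * u 0 k = (\sum_j T i j k * y 0 j) * u 0 k.
    by rewrite mulr_suml.
  ring.
under eq_bigr => i _ do under eq_bigr => l _ do rewrite E.
have -> : 4 * al * cub S u y u = 4 * al * cub S u y u - 2 * al * cub S u u y.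
  by rewrite (cub_alt _ _ anti) mulr0 subr0.
rewrite !cE [X in _ = X - _]mulr_sumr [X in _ = _ - X]mulr_sumr -sumrB.
apply: eq_bigr => i _.
rewrite [X in _ = X - _]mulr_sumr [X in _ = _ - X]mulr_sumr -sumrB.
by apply: eq_bigr => l _; ring.
Qed.

End Contractions.

(** * The cubic condition on s_{ij;k}, and the projective terms at y = b *)

Section LocalTheorem.
Context {R : realType} {n : nat}.
Local Notation V := 'rV[R]_n.
Variable U : set V.
Local Notation W := (slit U).
Variable a : V -> 'M[R]_n.
Hypothesis Hm : metric_on U a.
Variable b : V -> V.
Hypothesis Hb : killing_form_on U a b.
Let U_open := mo_open Hm.
Let a_sym := mo_sym Hm.
Let a_pos := mo_pos Hm.
Implicit Types (y u v w : V) (i j k l m : 'I_n).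

Local Notation al := (alpha_of a).
Local Notation F := (randers a b).
Local Notation sigma := (s_up0 a b).

Lemma hor_sigma i m p y : W p y ->
  pd (inl m) (sigma i) p y - \sum_l nonlin a l m p y * pd (inr l) (sigma i) p y =
  \sum_j cov11 a (s_mix a b) i j m p * y 0 j
  - \sum_l christoffel a i m l p * sigma l p y.
Proof.
move=> Wp; rewrite (pd_x_linear U_open (h := s_mix a b i)) //; last first.
  by move=> j; exact: (sm_s_mix Hm Hb).
have -> : \sum_l nonlin a l m p y * pd (inr l) (sigma i) p y =
    \sum_l nonlin a l m p y * s_mix a b i l p.
  apply: eq_bigr => l _; rewrite (pd_y_linear U_open (h := s_mix a b i)) //.
  by move=> j; exact: (sm_s_mix Hm Hb).
exact: (hor_idx (fun m i j => christoffel a m i j p)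
  (fun m i j => partial m (s_mix a b i j) p) (fun i j => s_mix a b i j p)).
Qed.

Lemma sm_cov11 i j m : smoothW U (fun p _ => cov11 a (s_mix a b) i j m p).
Proof.
have h := sm_christoffel Hm; have h1 := sm_s_mix Hm Hb.
have h2 : smoothW U (fun p _ => partial m (s_mix a b i j) p).
  exact: (sm_partial m (h1 i j)).
rewrite /cov11; by sm.
Qed.

Lemma curv_spray_odd i k p y : W p y ->
  curv (spray_H a b 1) i k p y - curv (spray_H a b (-1)) i k p y =
  2 * (al p y * (2 * (\sum_j cov11 a (s_mix a b) i j k p * y 0 j)
                 - \sum_m cov11 a (s_mix a b) i k m p * y 0 m)
    - pd (inr k) al p y * \sum_j \sum_m cov11 a (s_mix a b) i j m p * y 0 j * y 0 m).
Proof.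
move=> Wp.
apply: (@curv_odd R n U U_open al (geod a) sigma (nonlin a)
  (fun m i j p => christoffel a m i j p)
  (fun i j k p => cov11 a (s_mix a b) i j k p) (fun i j p => s_mix a b i j p)) Wp.
- exact: (sm_al Hm).
- by move=> c; exact: (sm_geod Hm).
- by move=> c; exact: (sm_s_up0 Hm Hb).
- by move=> c d; exact: (sm_nonlin Hm).
- by move=> c d e; exact: (sm_christoffel Hm).
- by move=> c d e; exact: sm_cov11.
- by move=> c d e q Uq; exact: (christoffel_sym Hm).
- by [].
- by move=> c d q z; exact: (pd_y_geod Hm).
- by move=> c d e q z; exact: (pd_y_nonlin Hm).
- by move=> c q z; exact: sum_y_nonlin.
- by move=> c q z; exact: (al_horizontal Hm).
- move=> c d q z Wq; rewrite (pd_y_linear U_open (h := s_mix a b c)) //.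
  by move=> j; exact: (sm_s_mix Hm Hb).
- by move=> c d q z; exact: hor_sigma.
Qed.

Lemma ip_curvv_odd p y u : W p y -> ip (a p) u y = 0 ->
  ip (a p) (curvv (spray_H a b 1) p y u) u
  - ip (a p) (curvv (spray_H a b (-1)) p y u) u =
  4 * al p y * cub (cov_s a b p) u y u.
Proof.
move=> Wp uy; have Up := Wp.1.
rewrite -(odd_contraction (A := fun i j => a p i j)
  (T := fun i j k => cov11 a (s_mix a b) i j k p) (d := fun k => pd (inr k) al p y)
  (al p y) (fun i => \sum_j \sum_m cov11 a (s_mix a b) i j m p * y 0 j * y 0 m)).
- rewrite !ip_sum -sumrB; apply: eq_bigr => i _; rewrite -sumrB; apply: eq_bigr => l _.
  rewrite -mulrBl -mulrBr; congr (_ * _ * _).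
  rewrite !mxE -sumrB; apply: eq_bigr => k _; rewrite -mulrBl.
  by rewrite curv_spray_odd.
- by move=> c d; exact: (a_symE Hm).
- by move=> l j k; exact: (lower_cov11 Hm Hb l j k Wp).
- by move=> l j k; exact: (cov_s_antisym Hm Hb l j k Wp).
- exact: (dal_orth Hm Wp uy).
Qed.

Variable p : V.
Hypothesis Up : U p.
Variable Kp : V -> R.
Hypothesis scalar : forall y u, free [:: y; u] -> flag_curvature F p y u = Kp y.

(** [flag_ip] evaluates the flag spanned by [y] and a shift of [u] along [y]; this makes [scalar]
    applicable to that pair. *)
Lemma free_orth y u (c : R) : y != 0 -> u != 0 -> ip (a p) u y = 0 ->
  free [:: y; u - c *: y].
Proof.
move=> y0 u0 uy; rewrite free_cons span_seq1 seq1_free.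
have uu : ip (a p) u u != 0 by rewrite gt_eqF //; exact: a_pos.
have E : ip (a p) (u - c *: y) u = ip (a p) u u.
  by rewrite -scaleNr ipDl ipZl (ipC (a_sym Up)) uy mulr0 addr0.
apply/andP; split.
  apply/negP => /vlineP [k yE].
  have : ip (a p) y u = k * ip (a p) u u by rewrite {1}yE ipZl E.
  rewrite (ipC (a_sym Up)) uy => /eqP; rewrite eq_sym mulf_eq0 (negbTE uu) orbF => /eqP k0.
  by move: y0; rewrite yE k0 scale0r eqxx.
apply: contra uu => /eqP h; rewrite -E h.
by rewrite /ip !mul0mx mxE.
Qed.

Definition mu_of y : R :=
  Kp y * F p y ^+ 2 - Kp (- y) * F p (- y) ^+ 2
  - Xi (spray_H a b 1) (proj_factor a b 1) p y
  + Xi (spray_H a b (-1)) (proj_factor a b (-1)) p y.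

Lemma cub_mu y u : y != 0 -> ip (a p) u y = 0 ->
  4 * al p y * cub (cov_s a b p) u y u = mu_of y * ip (a p) u u.
Proof.
move=> y0 uy; have Wp : W p y by split.
have Wn := slit_opp Wp.
have [->|u0] := eqVneq u 0.
  rewrite -(scale0r (0 : V)) cubZl /ip !(mul0mx, scale0r) mxE; ring.
have uny : ip (a p) u (- y) = 0.
  by rewrite -scaleN1r (ipZr (a_sym Up)) uy mulr0.
have e1 := flag_ip Hm Hb Wp u0 uy.
have e2 := flag_ip Hm Hb Wn u0 uny.
rewrite scalar in e1; last exact: free_orth.
rewrite scalar in e2; last by apply: free_orth => //; rewrite oppr_eq0.
rewrite (curvv_opp Hm Hb) // in e2.
rewrite (ip_curvv_proj Hm Hb) // ?expr1n // in e1.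
rewrite (ip_curvv_proj Hm Hb) // ?sqrrN ?expr1n // in e2.
rewrite -ip_curvv_odd // /mu_of.
have subtract (x z q q' X X' N : R) : x + X * N = q * N -> z + X' * N = q' * N ->
    x - z = (q - q' - X + X') * N.
  move=> E1 E2; have -> : x = q * N - X * N by rewrite -E1; ring.
  have -> : z = q' * N - X' * N by rewrite -E2; ring.
  ring.
by rewrite (subtract _ _ _ _ _ _ _ e1 e2).
Qed.

Definition ssq : R := \sum_l \sum_m ainv a p l m * s_one a b l p * s_one a b m p.

Local Notation B := (b_vec a b p).

Lemma s_up0_B m : sigma m p B = - \sum_k ainv a p m k * s_one a b k p.
Proof.
rewrite /s_up0 /s_mix -sumrN.
under eq_bigr => j _ do rewrite mulr_suml.
rewrite exchange_big /=; apply: eq_bigr => k _.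
rewrite /s_one mulr_sumr -sumrN; apply: eq_bigr => j _.
rewrite mxE (s_low_antisym a b k j).
move: (ainv a p m k) (s_low a b j k p) (b_up a b j p) => x z t; ring.
Qed.

Lemma s_one_s_up0_B : \sum_m s_one a b m p * sigma m p B = - ssq.
Proof.
rewrite /ssq exchange_big /= -sumrN; apply: eq_bigr => m _.
rewrite s_up0_B mulrN mulr_sumr; congr (- _); apply: eq_bigr => k _.
rewrite (ainv_sym Hm m k Up); move: (s_one a b m p) (s_one a b k p) (ainv a p k m) => x z t; ring.
Qed.

(** By skewness s_0 vanishes at y = b^i, hence so does the projective factor, and only its first
    derivatives enter [Xi] there. *)
Lemma s_one0_B : s_one0 a b p B = 0.
Proof.
rewrite -[RHS](sum_antisym (fun i => b_up a b i p) (fun i j => s_low_antisym a b i j p)).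
rewrite exchange_big /=; apply: eq_bigr => j _; rewrite /s_one mulr_suml.
apply: eq_bigr => i _; rewrite mxE.
move: (s_low a b i j p) (b_up a b i p) (b_up a b j p) => x z t; ring.
Qed.

Lemma t00_B : t00 a b p B = - ssq.
Proof.
rewrite -s_one_s_up0_B /t00 /t_low.
under eq_bigr => i _.
  under eq_bigr => j _ do rewrite !mulr_suml.
  rewrite exchange_big /=; over.
rewrite exchange_big /=; apply: eq_bigr => m _.
rewrite /s_one mulr_suml; apply: eq_bigr => i _; rewrite /s_up0 mulr_sumr.
apply: eq_bigr => j _; rewrite !mxE.
move: (s_low a b i m p) (s_mix a b m j p) (b_up a b i p) (b_up a b j p) => x z t w; ring.
Qed.

(** s_{0;0} is the derivative of s_0 along the spray of alpha, which is how it meets the terms of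
    [Xi]. *)
Lemma s0_0_E y : y != 0 -> s0_0 a b p y =
  \sum_m pd (inl m) (s_one0 a b) p y * y 0 m - 2 * \sum_m geod a m p y * s_one a b m p.
Proof.
move=> y0; have Wp : W p y by split.
have -> : \sum_m pd (inl m) (s_one0 a b) p y * y 0 m =
    \sum_i \sum_j partial j (s_one a b i) p * y 0 i * y 0 j.
  rewrite exchange_big /=; apply: eq_bigr => m _.
  rewrite (pd_x_linear U_open (h := s_one a b)) //; last by move=> j; exact: (sm_s_one Hm Hb).
  by rewrite mulr_suml.
have -> : 2 * \sum_m geod a m p y * s_one a b m p =
    \sum_i \sum_j (\sum_k christoffel a k i j p * s_one a b k p) * y 0 i * y 0 j.
  rewrite mulr_sumr.
  under [RHS]eq_bigr => i _.
    under eq_bigr => j _ do rewrite !mulr_suml.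
    rewrite exchange_big /=; over.
  rewrite [RHS]exchange_big /=; apply: eq_bigr => k _.
  rewrite mulrA -(sum_y_nonlin a) mulr_suml; apply: eq_bigr => i _.
  rewrite /nonlin mulr_sumr mulr_suml; apply: eq_bigr => j _.
  move: (christoffel a k i j p) (s_one a b k p) => x z; ring.
rewrite -sumrB; apply: eq_bigr => i _; rewrite -sumrB; apply: eq_bigr => j _.
by rewrite /cov1 -!mulrBl.
Qed.

Lemma pd_proj_factor e d y : e ^+ 2 = 1 -> y != 0 -> s_one0 a b p y = 0 ->
  pd d (proj_factor a b e) p y = - (al p y / signed_randers a b e p y) * pd d (s_one0 a b) p y.
Proof.
move=> e1 y0 z; have Wp : W p y by split.
have h1 := sm_al Hm; have h2 := sm_s_one0 Hm Hb.
have h3 := smV U_open (signed_randers_neq0 Hm Hb e1) (sm_signed_randers Hm Hb e).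
rewrite (sm_pdM (U := U)) //; last by apply: smN => //; apply: smM.
rewrite (sm_pdN U_open) //; last by apply: smM.
by rewrite (sm_pdM (U := U)) // z; ring.
Qed.

(** The assumption, which is the second equation at y = b, trades the derivative of s_0 along the
    spray for [ssq]. The value then contains only scalar invariants. *)
Lemma Xi_B e : e ^+ 2 = 1 -> B != 0 -> t00 a b p B + s0_0 a b p B = 0 ->
  Xi (spray_H a b e) (proj_factor a b e) p B =
  al p B / signed_randers a b e p B * (ssq + 2 * e * al p B * ssq).
Proof.
move=> e1 B0; rewrite t00_B s0_0_E // => E.
have {}E : \sum_m pd (inl m) (s_one0 a b) p B * B 0 m =
    ssq + 2 * \sum_m geod a m p B * s_one a b m p by lra.
have Wp : W p B by split.
rewrite /Xi /(proj_factor a b e p B) s_one0_B.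
under eq_bigr => m _ do rewrite (pd_proj_factor _ e1 B0 s_one0_B) -mulrA.
rewrite -mulr_sumr E.
have -> : \sum_m spray_H a b e m p B * pd (inr m) (proj_factor a b e) p B =
   - (al p B / signed_randers a b e p B) * (\sum_m geod a m p B * s_one a b m p
     + e * al p B * \sum_m s_one a b m p * sigma m p B).
  rewrite mulrDr !mulr_sumr -big_split /=; apply: eq_bigr => m _.
  rewrite (pd_proj_factor _ e1 B0 s_one0_B).
  rewrite (pd_y_linear U_open (h := s_one a b)) //; last by move=> j; exact: (sm_s_one Hm Hb).
  rewrite /spray_H; ring.
rewrite s_one_s_up0_B; ring.
Qed.

End LocalTheorem.

(** * The two equations at a point and the invariant formula for c *)

Section LocalEquations.
Context {R : realType} {n : nat}.
Local Notation V := 'rV[R]_n.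
Variable U : set V.
Local Notation W := (slit U).
Variable a : V -> 'M[R]_n.
Hypothesis Hm : metric_on U a.
Variable b : V -> V.
Hypothesis Hb : killing_form_on U a b.
Let a_sym := mo_sym Hm.
Let a_pos := mo_pos Hm.
Implicit Types (y u v w : V) (i j k l m : 'I_n).

Local Notation al := (alpha_of a).
Local Notation be := (beta_of b).
Local Notation F := (randers a b).

Variable p : V.
Hypothesis Up : U p.
Hypothesis bp0 : b p != 0.
Variable Kp : V -> R.
Hypothesis scalar : forall y u, free [:: y; u] -> flag_curvature F p y u = Kp y.
Hypothesis n_gt1 : (1 < n)%N.

Local Notation B := (b_vec a b p).
Local Notation om := (omega (cov_s a b p) (ainv a p)).

Lemma b_vec_neq0 : B != 0.
Proof.
apply: contra bp0 => /eqP h; apply/eqP/rowP => k.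
rewrite -(lower_b_up Hm b k Up) mxE big1 // => l _.
by have /rowP/(_ l) := h; rewrite !mxE => ->; rewrite mulr0.
Qed.

Lemma bsq_gt0 : 0 < bsq a b p.
Proof. by rewrite -(ip_bb Hm) //; apply: a_pos => //; exact: b_vec_neq0. Qed.

Lemma al_sq_all y : al p y ^+ 2 = ip (a p) y y.
Proof.
rewrite sqr_sqrtr; first by rewrite ip_normsq.
by rewrite -/(normsq a p y) -ip_normsq; apply: ip_ge0 => z; exact: a_pos.
Qed.

Lemma WB : W p B.
Proof. by split => //; exact: b_vec_neq0. Qed.

Lemma mu_al y : y != 0 -> forall u, ip (a p) u y = 0 ->
  cub (cov_s a b p) u y u = mu_of a b p Kp y / (4 * al p y) * ip (a p) u u.
Proof.
move=> y0 u uy; have al0 : al p y != 0 by rewrite gt_eqF // (al_gt0 Hm (conj Up y0)).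
have := cub_mu Hm Hb Up scalar y0 uy.
move: (mu_of a b p Kp y) (cub _ _ _ _) (ip _ u u) => x z t h.
by rewrite mulrAC -h; field.
Qed.

Lemma a_ainv : a p *m ainv a p = 1%:M.
Proof. exact/mulmxV/(a_unit Hm). Qed.

Lemma cov_s_antisym_at l j k : cov_s a b p l j k = - cov_s a b p j l k.
Proof. exact: (cov_s_antisym Hm Hb _ _ _ WB). Qed.

Lemma cov_s_form l j k : cov_s a b p l j k = a p l k * om j - a p j k * om l.
Proof.
apply: (cubic_form (a_sym Up) (fun y => a_pos Up (y := y)) cov_s_antisym_at _ n_gt1 _ a_ainv).
  by move=> c d e; exact: (cov_s_cyclic Hm Hb _ _ _ WB).
by move=> y y0; eexists; exact: mu_al.
Qed.

(** Evaluating omega = - b^{-2} c beta at b^i gives -c. *)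
Definition c_at : R := - omega_at (cov_s a b p) (ainv a p) B.

(** Inserting [cov_s_form] into [b_cov_s] gives b_l omega_j = b_j omega_l; contraction with b^j
    isolates omega_l. *)
Lemma om_b l : om l = - (bsq a b p)^-1 * c_at * b p 0 l.
Proof.
have bq : bsq a b p != 0 by rewrite gt_eqF // bsq_gt0.
have E j : b p 0 l * om j = b p 0 j * om l.
  apply/eqP; rewrite -subr_eq0 -(b_cov_s Hm Hb l j WB); apply/eqP.
  rewrite -!(lower_b_up Hm b _ Up) !mulr_suml -sumrB; apply: eq_bigr => k _.
  rewrite cov_s_form.
  move: (a p l k) (a p j k) (om l) (om j) (b_up a b k p) => x1 x2 x3 x4 x5; ring.
apply: (@mulfI _ (bsq a b p)) => //.
have -> : bsq a b p * om l = b p 0 l * omega_at (cov_s a b p) (ainv a p) B.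
  rewrite /omega_at mulr_sumr /bsq mulr_suml; apply: eq_bigr => j _.
  by rewrite mxE mulrA E; ring.
rewrite /c_at; move: (omega_at _ _ _) => x; field.
exact: bq.
Qed.

Lemma div_s0_form y : div_s0 a b p y =
  - (n%:R - 1) * (bsq a b p)^-1 * c_at * be p y.
Proof.
have T m j : cov11 a (s_mix a b) m j m p = \sum_l ainv a p m l * (a p l m * om j - a p j m * om l).
  rewrite -(raise_lower Hm m (fun i => cov11 a (s_mix a b) i j m p) Up).
  by apply: eq_bigr => l _; rewrite (lower_cov11 Hm Hb _ _ _ WB) cov_s_form.
have tr j : \sum_m cov11 a (s_mix a b) m j m p = (n%:R - 1) * om j.
  under eq_bigr => m _ do rewrite T.
  have -> : \sum_m \sum_l ainv a p m l * (a p l m * om j - a p j m * om l) =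
      (\sum_m \sum_l ainv a p m l * a p l m) * om j
      - \sum_l (\sum_m a p j m * ainv a p m l) * om l.
    rewrite [X in _ = _ - X](_ : _ = \sum_m \sum_l a p j m * ainv a p m l * om l); last first.
      by rewrite exchange_big /=; apply: eq_bigr => l _; rewrite mulr_suml.
    rewrite mulr_suml -sumrB; apply: eq_bigr => m _; rewrite mulr_suml -sumrB.
    apply: eq_bigr => l _.
    by move: (ainv a p m l) (a p l m) (a p j m) (om l) (om j) => x1 x2 x3 x4 x5; ring.
  under [X in X * _]eq_bigr => m _ do rewrite (ainvKr Hm _ _ Up) eqxx.
  under [X in _ - X]eq_bigr => l _ do rewrite (ainvK Hm _ _ Up).
  by rewrite sum_delta_l sumr_const card_ord mulrBl mul1r.
rewrite /div_s0 /beta_of mulr_sumr; apply: eq_bigr => j _.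
rewrite tr om_b; ring.
Qed.

Lemma t00_s0_0_form y : t00 a b p y + s0_0 a b p y =
  c_at * (al p y ^+ 2 - (bsq a b p)^-1 * be p y ^+ 2).
Proof.
have oE : \sum_m b_up a b m p * om m = - c_at.
  rewrite opprK /omega_at; apply: eq_bigr => m _; by rewrite mxE mulrC.
(* The first summand will give the beta^2 term through [om_b], the second the alpha^2 term. *)
have E i j : t_low a b i j p + cov1 a (s_one a b) i j p = b p 0 j * om i + c_at * a p i j.
  rewrite (t_low_cov_s_one Hm Hb _ _ WB).
  transitivity (\sum_m (a p j m * b_up a b m p * om i - b_up a b m p * om m * a p i j)).
    by apply: eq_bigr => m _; rewrite cov_s_form (a_symE Hm m j Up);
      move: (a p j m) (a p i j) (om i) (om m) (b_up a b m p) => x1 x2 x3 x4 x5; ring.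
  by rewrite sumrB -!mulr_suml oE (lower_b_up Hm b j Up); ring.
have -> : t00 a b p y + s0_0 a b p y =
    \sum_i \sum_j (b p 0 j * om i + c_at * a p i j) * y 0 i * y 0 j.
  rewrite /t00 /s0_0 -big_split /=; apply: eq_bigr => i _.
  by rewrite -big_split /=; apply: eq_bigr => j _; rewrite -E; ring.
rewrite al_sq_all ip_sum expr2 /beta_of sum_prod2 mulrBr mulrA.
rewrite [X in _ = X - _]mulr_sumr [X in _ = _ - X]mulr_sumr -sumrB.
apply: eq_bigr => i _.
rewrite [X in _ = X - _]mulr_sumr [X in _ = _ - X]mulr_sumr -sumrB.
apply: eq_bigr => j _; rewrite om_b.
move: (a p i j) c_at => x z; ring.
Qed.

Lemma al_B : al p B = Num.sqrt (bsq a b p).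
Proof. by rewrite /alpha_of -/(normsq a p B) -ip_normsq (ip_bb Hm). Qed.

(** This is -mu(b) / (4 alpha(b)) with q = b^2 and s the squared norm of s_i: at y = b one has alpha
    = r and beta = q, so F(b) = r + q and F(-b) = r - q, and the two quotients are the values from
    [Xi_B]. *)
Definition c_formula (kp km q s : R) : R :=
  let r := Num.sqrt q in
  - (kp * (r + q) ^+ 2 - km * (r - q) ^+ 2
     - r / (r + q) * (s + 2 * r * s) + r / (r - q) * (s - 2 * r * s)) / (4 * r).

Lemma c_atE : c_at = c_formula (Kp B) (Kp (- B)) (bsq a b p) (ssq a b p).
Proof.
have B0 := b_vec_neq0.
have := mu_omega (a_sym Up) (fun y => a_pos Up (y := y)) cov_s_antisym_at n_gt1 a_ainv B0 (mu_al B0).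
rewrite /c_at => <-; rewrite /mu_of.
have bq : bsq a b p != 0 by rewrite gt_eqF // bsq_gt0.
(* The second equation is already established with [c_at], and its right-hand side vanishes at y = b
   because alpha^2 = beta = b^2 there. *)
have z : t00 a b p B + s0_0 a b p B = 0.
  rewrite t00_s0_0_form al_sq_all (ip_bb Hm) // be_b_vec.
  by move: (bsq a b p) bq => q q0; field.
rewrite !(Xi_B Hm Hb Up) // ?sqrrN ?expr1n // /randers (al_opp a p B).
have -> : be p (- B) = - bsq a b p.
  by rewrite -(be_b_vec a) /beta_of linear_opp.
rewrite /signed_randers !be_b_vec al_B /c_formula !mulN1r !mul1r !mulr1 !mulrN1 !mulNr.
by [].
Qed.

End LocalEquations.

(** * Independence of the chart *)

Section FrechetDifferentiability.
Local Open Scope classical_set_scope.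
Context {R : realType} {n : nat}.
Local Notation V := 'rV[R]_n.
Implicit Types (x v : V).

Lemma differentiable_row m (f : V -> 'rV[R]_m) x :
  (forall k, differentiable (fun p => f p 0 k) x) -> differentiable f x.
Proof.
move=> df.
have -> : f = \sum_(k < m) (fun p => f p 0 k *: (delta_mx 0 k : 'rV[R]_m)).
  by apply/funext => p; rewrite fct_sumE [LHS]row_sum_delta.
by apply: differentiable_sum => k; apply: differentiableZl.
Qed.

Lemma differentiable_big_sum (I : Type) (r : seq I) (P : pred I) (f : I -> V -> R) x :
  (forall i, differentiable (f i) x) ->
  differentiable (fun p => \sum_(i <- r | P i) f i p) x.
Proof.
move=> df; elim: r => [|i r IH].
  have -> : (fun p => \sum_(i <- [::] | P i) f i p) = cst 0.
    by apply/funext => p; rewrite big_nil.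
  exact: differentiable_cst.
case Pi: (P i).
  have -> : (fun p => \sum_(i <- i :: r | P i) f i p) =
      f i + (fun p => \sum_(i <- r | P i) f i p).
    by apply/funext => p; rewrite big_cons Pi.
  exact: differentiableD.
have -> : (fun p => \sum_(i <- i :: r | P i) f i p) = fun p => \sum_(i <- r | P i) f i p.
  by apply/funext => p; rewrite big_cons Pi.
exact: IH.
Qed.

Lemma differentiable_big_prod (I : Type) (r : seq I) (P : pred I) (f : I -> V -> R) x :
  (forall i, differentiable (f i) x) ->
  differentiable (fun p => \prod_(i <- r | P i) f i p) x.
Proof.
move=> df; elim: r => [|i r IH].
  have -> : (fun p => \prod_(i <- [::] | P i) f i p) = cst 1.
    by apply/funext => p; rewrite big_nil.
  exact: differentiable_cst.
case Pi: (P i).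
  have -> : (fun p => \prod_(i <- i :: r | P i) f i p) =
      f i * (fun p => \prod_(i <- r | P i) f i p).
    by apply/funext => p; rewrite big_cons Pi.
  exact: differentiableM.
have -> : (fun p => \prod_(i <- i :: r | P i) f i p) = fun p => \prod_(i <- r | P i) f i p.
  by apply/funext => p; rewrite big_cons Pi.
exact: IH.
Qed.

Lemma differentiable_mul (f g : V -> R) x : differentiable f x -> differentiable g x ->
  differentiable (fun p => f p * g p) x.
Proof. exact: differentiableM. Qed.

Lemma differentiable_det (N : nat) (A : V -> 'M[R]_N) x :
  (forall r c, differentiable (fun p => A p r c) x) ->
  differentiable (fun p => \det (A p)) x.
Proof.
move=> dA; apply: differentiable_big_sum => s.
apply: differentiable_mul.
  exact: differentiable_cst.
by apply: differentiable_big_prod => r; exact: dA.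
Qed.

(* Cramer's rule makes the Frechet differentiability of [bsq a b] visible: the
   junk value of [invmx] on singular matrices plays no role near a point. *)
Definition bsq_cramer (a : V -> 'M[R]_n) (b : V -> V) p : R :=
  \sum_(i < n) \sum_(j < n) (\det (a p))^-1 * ((-1) ^+ (j + i) * \det (row' j (col' i (a p))))
    * (b p 0 j * b p 0 i).

Lemma bsq_cramerE (a : V -> 'M[R]_n) (b : V -> V) p : a p \in unitmx ->
  bsq a b p = bsq_cramer a b p.
Proof.
move=> ua; apply: eq_bigr => i _; rewrite /b_up mulr_suml; apply: eq_bigr => j _.
by rewrite /ainv /invmx ua !mxE /cofactor -mulrA.
Qed.

Lemma differentiable_bsq_cramer (a : V -> 'M[R]_n) (b : V -> V) x :
  (forall i j, differentiable (fun p => a p i j) x) ->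
  (forall i, differentiable (fun p => b p 0 i) x) -> a x \in unitmx ->
  differentiable (bsq_cramer a b) x.
Proof.
move=> da db ua; apply: differentiable_big_sum => i; apply: differentiable_big_sum => j.
apply: differentiable_mul; last exact: differentiable_mul.
apply: differentiable_mul.
  apply: (@differentiableV _ _ (fun p => \det (a p))); first exact: differentiable_det.
  by rewrite -unitfE -unitmxE.
apply: differentiable_mul; first exact: differentiable_cst.
apply: differentiable_det => r c.
have -> : (fun p => row' j (col' i (a p)) r c) = (fun p => a p (lift j r) (lift i c)).
  by apply/funext => p; rewrite !mxE.
exact: da.
Qed.

Lemma derive_comp_row m (f : V -> 'rV[R]_m) (g : 'rV[R]_m -> R) x v :
  differentiable f x -> differentiable g (f x) ->
  'D_v (g \o f) x = \sum_l (v *m 'J f x) 0 l * 'D_(delta_mx 0 l) g (f x).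
Proof.
move=> df dg; rewrite deriveE; last exact: differentiable_comp.
rewrite diff_comp //= -[in LHS](deriveE v df) deriveEjacobian //.
rewrite [X in 'd _ _ X = _]row_sum_delta linear_sum; apply: eq_bigr => l _.
by rewrite linearZ -deriveE.
Qed.

Lemma mul_jacobian r m (f : 'rV[R]_r -> 'rV[R]_m) (x v : 'rV[R]_r) : v *m 'J f x = 'd f x v.
Proof. exact: mul_rV_lin1. Qed.

(** Agreement near [x] is the right hypothesis: transition maps compose only on the overlap of the
    chart domains. *)
Lemma jacobian_comp m q (f : V -> 'rV[R]_m) (g : 'rV[R]_m -> 'rV[R]_q) (h : V -> 'rV[R]_q)
    x v :
  differentiable f x -> differentiable g (f x) -> differentiable h x ->
  (\near x, (g \o f) x = h x) -> v *m 'J f x *m 'J g (f x) = v *m 'J h x.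
Proof.
move=> df dg dh E; rewrite (mul_jacobian h) (mul_jacobian f) (mul_jacobian g).
rewrite -(deriveE v dh) -(near_eq_derive v E).
by rewrite (deriveE v (differentiable_comp df dg)) (diff_comp df dg).
Qed.

End FrechetDifferentiability.

(** * Dimension at most one *)

Section SmallDimension.
Local Open Scope classical_set_scope.
Context {R : realType} {n : nat}.
Local Notation V := 'rV[R]_n.
Variable U : set V.
Variable a : V -> 'M[R]_n.
Hypothesis Hm : metric_on U a.
Variable b : V -> V.
Hypothesis Hb : killing_form_on U a b.
Variable p : V.
Hypothesis Up : U p.
Hypothesis bp0 : b p != 0.
Hypothesis n_le1 : (n <= 1)%N.

(** All indices coincide, so skewness replaces the curvature argument and c = 0 solves both
    equations. *)
Lemma cov_s_dim1 l j k : cov_s a b p l j k = 0.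
Proof.
have -> : j = l.
  by apply: val_inj; have := ltn_ord j; have := ltn_ord l; case: n n_le1 j l => [|[|]] //= _ [[|]] // ? [[|]].
have := cov_s_antisym Hm Hb l l k (WB Hm Up bp0).
lra.
Qed.

Lemma div_s0_dim1 y : div_s0 a b p y = 0.
Proof.
rewrite /div_s0 big1 // => j _; rewrite big1 ?mul0r // => m _.
rewrite -(raise_lower Hm m (fun i => cov11 a (s_mix a b) i j m p) Up).
by rewrite big1 // => l _; rewrite (lower_cov11 Hm Hb _ _ _ (WB Hm Up bp0)) cov_s_dim1 mulr0.
Qed.

Lemma t00_s0_0_dim1 y : t00 a b p y + s0_0 a b p y = 0.
Proof.
rewrite /t00 /s0_0 -big_split big1 //= => i _; rewrite -big_split big1 //= => j _.
rewrite -!mulrDl (t_low_cov_s_one Hm Hb _ _ (WB Hm Up bp0)).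
by rewrite big1 ?mul0r // => m _; rewrite cov_s_dim1 mulr0.
Qed.

End SmallDimension.

(** * Raising indices under a change of basis *)

Section CongruentForms.
Local Open Scope classical_set_scope.
Context {R : realType} {n : nat}.
Implicit Types (A C J : 'M[R]_n) (w z : 'rV[R]_n).

Lemma congruence_unit A C J : A \in unitmx -> A = J *m C *m J^T ->
  J \in unitmx /\ C \in unitmx.
Proof.
by move=> uA E; move: uA; rewrite E !unitmx_mul => /andP[/andP[-> ->]].
Qed.

(** Covector rows change by the transposed Jacobian; raised by the respective metrics, they change
    by the Jacobian as tangent vectors do. Applied to beta, it identifies the vectors b of two
    charts. *)
Lemma raise_congruence A C J w z : A \in unitmx ->
  A = J *m C *m J^T -> w = z *m J^T ->
  w *m invmx A *m J = z *m invmx C.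
Proof.
move=> uA E wE; have [uJ uC] := congruence_unit uA E.
have uJt : J^T \in unitmx by rewrite unitmx_tr.
apply: (can_inj (mulmxK uC)); rewrite mulmxKV //.
apply: (can_inj (mulmxK uJt)); rewrite -wE.
have := mulmxKV uA w; move: (w *m invmx A) => X; rewrite E !mulmxA => EX.
exact: EX.
Qed.

Lemma norm_congruence A C J w z : A \in unitmx ->
  A = J *m C *m J^T -> w = z *m J^T ->
  w *m invmx A *m w^T = z *m invmx C *m z^T.
Proof.
move=> uA E wE; rewrite -(raise_congruence uA E wE) {2}wE trmx_mul trmxK.
by rewrite !mulmxA.
Qed.

End CongruentForms.

(** * Tangent vectors from charts, and independence of c from the chart *)

Section Charts.
Local Open Scope classical_set_scope.
Context {R : realType} {n : nat} {M : manifold R n}.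
Implicit Types (i j k : chart M) (x : M) (v w : 'rV[R]_n).

Lemma map_in_image i x : chart_dom i x -> (chart_map i @` chart_dom i) (chart_map i x).
Proof. by move=> ix; exists x. Qed.

Lemma near_chart_dom i j x : chart_dom i x -> chart_dom j x ->
  \forall q \near chart_map i x,
    (chart_map i @` chart_dom i) q /\ chart_dom j (chart_inv i q).
Proof.
move=> ix jx; apply: filterI.
  by apply: open_nbhs_nbhs; split; [exact: image_open|exact: map_in_image].
apply: (chart_inv_continuous (map_in_image ix)); rewrite chart_mapK //.
by apply: open_nbhs_nbhs; split => //; exact: dom_open.
Qed.

Lemma chart_invK i q : (chart_map i @` chart_dom i) q ->
  chart_dom i (chart_inv i q) /\ chart_map i (chart_inv i q) = q.
Proof. by move=> [x ix <-]; rewrite chart_mapK. Qed.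

Lemma differentiable_transition i j x : chart_dom i x -> chart_dom j x ->
  differentiable (transition i j) (chart_map i x).
Proof.
move=> ix jx; apply: differentiable_row => k.
by apply: (@transition_smooth _ _ M i j k [::]); exists x.
Qed.

Lemma transitionE i j x : chart_dom i x -> transition i j (chart_map i x) = chart_map j x.
Proof. by move=> ix; rewrite /transition chart_mapK. Qed.

Lemma jacobian_refl i x v : chart_dom i x -> v *m transition_jacobian i i x = v.
Proof.
move=> ix; rewrite /transition_jacobian -deriveEjacobian; last exact: differentiable_transition.
rewrite -[RHS](derive_id (chart_map i x)); apply: near_eq_derive.
have := near_chart_dom ix ix; apply: filterS => q [hq _].
by rewrite /transition; have [_ ->] := chart_invK hq.
Qed.

Lemma jacobian_trans i j k x v : chart_dom i x -> chart_dom j x -> chart_dom k x ->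
  v *m transition_jacobian i j x *m transition_jacobian j k x =
  v *m transition_jacobian i k x.
Proof.
move=> ix jx kx; have djk := differentiable_transition jx kx.
rewrite -(transitionE j ix) in djk.
have near_ijk : \forall q \near chart_map i x,
    (transition j k \o transition i j) q = transition i k q.
  have := near_chart_dom ix jx; apply: filterS => q [_ hq].
  by rewrite /transition /= chart_mapK.
have := jacobian_comp v (differentiable_transition ix jx) djk
  (differentiable_transition ix kx) near_ijk.
by rewrite (transitionE j ix).
Qed.

Lemma tangent_ext x (s t : tangent x) : (forall i, s i = t i) -> s = t.
Proof.
case: s => f fl fo; case: t => g gl go /= E.
have fg : f = g by apply/funext.
by case: _ / fg gl go => gl go; congr Tangent; exact: Prop_irrelevance.
Qed.

Section TangentFromChart.
Variables (x : M) (i : chart M) (v : 'rV[R]_n).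
Hypothesis ix : chart_dom i x.

(** [K] takes an element of [tangent x], so a row given in one chart is first spread to all charts
    around [x]; consistency is the cocycle rule [jacobian_trans]. *)
Definition tangent_comp j : 'rV[R]_n :=
  if pselect (chart_dom j x) then v *m transition_jacobian i j x else 0.

Lemma tangent_comp_law j k : chart_dom j x -> chart_dom k x ->
  tangent_comp k = tangent_comp j *m transition_jacobian j k x.
Proof.
move=> jx kx; rewrite /tangent_comp.
case: pselect => [? /=|nk]; last by case: (nk kx).
case: pselect => [? /=|nj]; last by case: (nj jx).
exact: esym (jacobian_trans v ix jx kx).
Qed.

Lemma tangent_comp_out j : ~ chart_dom j x -> tangent_comp j = 0.
Proof. by move=> jx; rewrite /tangent_comp; case: pselect => [j'x|//]; case: (jx j'x). Qed.

Definition tangent_of : tangent x := Tangent tangent_comp_law tangent_comp_out.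

Lemma tangent_ofE j : chart_dom j x -> tangent_of j = v *m transition_jacobian i j x.
Proof. by move=> jx; rewrite /= /tangent_comp; case: pselect => [//|nj]; case: (nj jx). Qed.

Lemma tangent_of_self : tangent_of i = v.
Proof. by rewrite tangent_ofE // jacobian_refl. Qed.

End TangentFromChart.

Lemma tangent_of_eq i j x v w (ix : chart_dom i x) (jx : chart_dom j x) :
  w = v *m transition_jacobian i j x -> tangent_of v ix = tangent_of w jx.
Proof.
move=> E; apply: tangent_ext => k; have [kx|kx] := pselect (chart_dom k x).
  rewrite (tangent_ofE v ix kx) (tangent_ofE w jx kx) E.
  exact: esym (jacobian_trans v ix jx kx).
by rewrite (components_out _ kx) (components_out _ kx).
Qed.

Variables (alpha : riemannian_metric M) (beta : one_form M).
Hypothesis beta_neq0 : nowhere_vanishing beta.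
Hypothesis beta_lt1 : norm_lt1 alpha beta.
Hypothesis beta_killing : killing alpha beta.

Local Notation U i := (chart_map i @` chart_dom i).

Lemma chart_metric i : metric_on (U i) (alpha i).
Proof.
split.
- exact: image_open.
- by move=> k l; exact: metric_smooth.
- by move=> _ [x ix <-]; exact: (Defs.metric_sym alpha ix).
- by move=> _ y [x ix <-]; exact: (@metric_pos _ _ _ alpha i x y ix).
Qed.

Lemma chart_form i : killing_form_on (U i) (alpha i) (beta i).
Proof.
split.
- by move=> k; exact: form_smooth.
- by move=> _ k l [x ix <-]; exact: beta_killing.
- by move=> _ [x ix <-]; exact: beta_lt1.
Qed.

Lemma b_vec_mx i x : chart_dom i x ->
  b_vec (alpha i) (beta i) (chart_map i x) =
  beta i (chart_map i x) *m invmx (alpha i (chart_map i x)).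
Proof.
move=> ix; apply/rowP => k; rewrite [LHS]mxE [RHS]mxE /b_up; apply: eq_bigr => l _.
by rewrite (ainv_sym (chart_metric i) k l (map_in_image ix)) mulrC.
Qed.

Lemma b_vec_chart i j x : chart_dom i x -> chart_dom j x ->
  b_vec (alpha j) (beta j) (chart_map j x) =
  b_vec (alpha i) (beta i) (chart_map i x) *m transition_jacobian i j x.
Proof.
move=> ix jx; rewrite (b_vec_mx ix) (b_vec_mx jx).
exact: esym (raise_congruence (a_unit (chart_metric i) (map_in_image ix))
  (metric_law alpha ix jx) (form_law beta ix jx)).
Qed.

Lemma quadratic_mx (A : 'M[R]_n) w :
  (w *m A *m w^T) 0 0 = \sum_k \sum_l A k l * w 0 k * w 0 l.
Proof. exact: mulmx_sum3. Qed.

Lemma bsq_mx i p : bsq (alpha i) (beta i) p =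
  (beta i p *m invmx (alpha i p) *m (beta i p)^T) 0 0.
Proof.
rewrite quadratic_mx; apply: eq_bigr => k _; rewrite /b_up mulr_suml.
by apply: eq_bigr => l _; rewrite /ainv mulrAC.
Qed.

Lemma bsq_chart i j x : chart_dom i x -> chart_dom j x ->
  bsq (alpha i) (beta i) (chart_map i x) = bsq (alpha j) (beta j) (chart_map j x).
Proof.
move=> ix jx; rewrite !bsq_mx.
by rewrite (norm_congruence (a_unit (chart_metric i) (map_in_image ix))
  (metric_law alpha ix jx) (form_law beta ix jx)).
Qed.

Definition s_one_row i p : 'rV[R]_n := \row_k s_one (alpha i) (beta i) k p.

Lemma ssq_mx i p : ssq (alpha i) (beta i) p =
  (s_one_row i p *m invmx (alpha i p) *m (s_one_row i p)^T) 0 0.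
Proof.
by rewrite quadratic_mx; apply: eq_bigr => k _; apply: eq_bigr => l _; rewrite ![s_one_row _ _ _ _]mxE.
Qed.

Lemma chart_slit i x : chart_dom i x ->
  slit (U i) (chart_map i x) (b_vec (alpha i) (beta i) (chart_map i x)).
Proof.
by move=> ix; exact: (WB (chart_metric i) (map_in_image ix) (beta_neq0 ix)).
Qed.

Lemma partial_bsq_chart i j x (k : 'I_n) : chart_dom i x -> chart_dom j x ->
  partial k (bsq (alpha i) (beta i)) (chart_map i x) =
  \sum_l transition_jacobian i j x k l *
    partial l (bsq (alpha j) (beta j)) (chart_map j x).
Proof.
move=> ix jx; set g := bsq_cramer (alpha j) (beta j).
have dij := differentiable_transition ix jx.
have Uj : U j (chart_map j x) by exact: map_in_image.
have dg : differentiable g (transition i j (chart_map i x)).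
  rewrite transitionE //; apply: differentiable_bsq_cramer.
  - by move=> c d; exact: (@metric_smooth _ _ _ alpha j c d [::]).
  - by move=> c; exact: (@form_smooth _ _ _ beta j c [::]).
  - exact: (a_unit (chart_metric j)).
have -> : partial k (bsq (alpha i) (beta i)) (chart_map i x) =
    'D_(delta_mx 0 k) (g \o transition i j) (chart_map i x).
  apply: near_eq_derive; have := near_chart_dom ix jx; apply: filterS => q [Uq hq].
  have [hi qE] := chart_invK Uq.
  rewrite /= /g -bsq_cramerE; last first.
    by rewrite /transition; apply: (a_unit (chart_metric j)); exact: map_in_image.
  by rewrite -{1}qE (bsq_chart hi hq).
rewrite derive_comp_row // transitionE //; apply: eq_bigr => l _; congr (_ * _).
  by rewrite -rowE mxE.
apply: near_eq_derive; near=> q; rewrite /g bsq_cramerE //.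
apply: (a_unit (chart_metric j)); near: q.
by apply: open_nbhs_nbhs; split => //; exact: image_open.
Unshelve. all: by end_near. Qed.

(** Through s_i = (b^2)_{;i} / 2 the covector law follows from the chain rule for the scalar b^2;
    the definition by covariant derivatives would bring in second derivatives of the transition
    maps. *)
Lemma s_one_chart i j x : chart_dom i x -> chart_dom j x ->
  s_one_row i (chart_map i x) =
  s_one_row j (chart_map j x) *m (transition_jacobian i j x)^T.
Proof.
move=> ix jx; apply/rowP => k; rewrite [LHS]mxE [RHS]mxE.
have half c z : chart_dom c x -> s_one (alpha c) (beta c) z (chart_map c x) =
    2^-1 * partial z (bsq (alpha c) (beta c)) (chart_map c x).
  move=> cx; rewrite (partial_bsq (chart_metric c) (chart_form c) z (chart_slit cx)).
  by rewrite mulKf // pnatr_eq0.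
rewrite (half _ _ ix) (partial_bsq_chart k ix jx) mulr_sumr; apply: eq_bigr => l _.
rewrite [s_one_row _ _ _ _]mxE [_^T _ _]mxE (half _ _ jx).
by rewrite mulrCA mulrC.
Qed.

Lemma ssq_chart i j x : chart_dom i x -> chart_dom j x ->
  ssq (alpha i) (beta i) (chart_map i x) = ssq (alpha j) (beta j) (chart_map j x).
Proof.
move=> ix jx; rewrite !ssq_mx.
by rewrite (norm_congruence (a_unit (chart_metric i) (map_in_image ix))
  (metric_law alpha ix jx) (s_one_chart ix jx)).
Qed.

Variable K : forall x : M, tangent x -> R.
Hypothesis F_scalar :
  scalar_flag_curvature (fun i : chart M => randers (alpha i) (beta i)) K.

Lemma scalar_at i x (ix : chart_dom i x) y u : free [:: y; u] ->
  flag_curvature (randers (alpha i) (beta i)) (chart_map i x) y u = K (tangent_of y ix).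
Proof.
move=> fyu; rewrite -(F_scalar (u := tangent_of u ix) ix) ?tangent_of_self //.
Qed.

(** Every argument of [c_formula] is intrinsic: b^2, the norm of s_i, and K at the tangent vectors b
    and -b, on which the charts agree by [tangent_of_eq]. *)
Lemma c_at_chart i j x : (1 < n)%N -> chart_dom i x -> chart_dom j x ->
  c_at (alpha i) (beta i) (chart_map i x) = c_at (alpha j) (beta j) (chart_map j x).
Proof.
move=> n1 ix jx.
have cE k (kx : chart_dom k x) := c_atE (chart_metric k) (chart_form k)
  (map_in_image kx) (beta_neq0 kx) (scalar_at kx) n1.
rewrite (cE i ix) (cE j jx) (bsq_chart ix jx) (ssq_chart ix jx).
rewrite (tangent_of_eq ix jx (b_vec_chart ix jx)).
rewrite (@tangent_of_eq i j x _ (- b_vec (alpha j) (beta j) (chart_map j x)) ix jx) //.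
by rewrite (b_vec_chart ix jx) mulNmx.
Qed.

Lemma exists_c x : exists c, forall i (y : 'rV[R]_n), chart_dom i x ->
  let p := chart_map i x in
  div_s0 (alpha i) (beta i) p y =
    - (n%:R - 1) * (bsq (alpha i) (beta i) p)^-1 * c * beta_of (beta i) p y /\
  t00 (alpha i) (beta i) p y + s0_0 (alpha i) (beta i) p y =
    c * (alpha_of (alpha i) p y ^+ 2
         - (bsq (alpha i) (beta i) p)^-1 * beta_of (beta i) p y ^+ 2).
Proof.
have [n1|n1] := leqP n 1.
  exists 0 => i y ix p; have Up := map_in_image ix.
  rewrite (div_s0_dim1 (chart_metric i) (chart_form i) Up (beta_neq0 ix) n1).
  rewrite (t00_s0_0_dim1 (chart_metric i) (chart_form i) Up (beta_neq0 ix) n1).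
  by rewrite mulr0 !mul0r.
have [i0 i0x] := dom_cover x.
(* Any chart around [x] may supply the value; [c_at_chart] transports it to the chart [i] in which
   the equations are read. *)
exists (c_at (alpha i0) (beta i0) (chart_map i0 x)) => i y ix p.
have Up := map_in_image ix; rewrite (c_at_chart n1 i0x ix); split.
  exact: (div_s0_form (chart_metric i) (chart_form i) Up (beta_neq0 ix) (scalar_at ix) n1).
exact: (t00_s0_0_form (chart_metric i) (chart_form i) Up (beta_neq0 ix) (scalar_at ix) n1).
Qed.

End Charts.

Theorem theorem1p1 (R : realType) (n : nat) (M : manifold R n)
  (alpha : riemannian_metric M) (beta : one_form M)
  (beta_neq0 : nowhere_vanishing beta)
  (beta_lt1 : norm_lt1 alpha beta)
  (beta_killing : killing alpha beta)
  (K : forall x : M, tangent x -> R)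
  (F_scalar : scalar_flag_curvature
                (fun i : chart M => randers (alpha i) (beta i)) K) :
  exists c : M -> R,
    forall (x : M) (y : tangent x) (i : chart M), chart_dom i x ->
      let p := chart_map i x in
      let b := b_norm (alpha i) (beta i) p in
      div_s0 (alpha i) (beta i) p (y i) =
        - (n%:R - 1) * b ^- 2 * c x * beta_of (beta i) p (y i)
      /\
      t00 (alpha i) (beta i) p (y i) + s0_0 (alpha i) (beta i) p (y i) =
        c x * (alpha_of (alpha i) p (y i) ^+ 2
               - b ^- 2 * beta_of (beta i) p (y i) ^+ 2).
Proof.
have [c hc] := choice (exists_c beta_neq0 beta_lt1 beta_killing F_scalar).
exists c => x y i ix p b; have := hc x i (y i) ix; rewrite -/p.
suff -> : b ^- 2 = (bsq (alpha i) (beta i) p)^-1 by [].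
rewrite /b b_normE sqr_sqrtr //.
exact: (bsq_ge0 (chart_metric alpha i) (beta i) (map_in_image ix)).
Qed.
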